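(* Let $\Gamma=\{(x_1,x_2)\in\mathbb{R}^2:\ x_1x_2=1\}$, let $\alpha,\beta$ be positive real numbers, and let $$\Lambda=(\alpha\mathbb{Z}\times\{0\})\cup(\{0\}\times\beta\mathbb{Z}).$$ Then $(\Gamma,\Lambda)$ is a Heisenberg uniqueness pair if and only if $\alpha\beta\le 1$.
   Context: For a finite complex-valued Borel measure $\mu$ on $\mathbb{R}^2$, its Fourier transform is $\widehat\mu(\xi)=\int_{\mathbb{R}^2}\mathrm{e}^{\pi \mathrm{i}\langle x,\xi\rangle}\,\mathrm{d}\mu(x)$, where $\langle x,\xi\rangle=x_1\xi_1+x_2\xi_2$. Let $\Gamma\subset\mathbb{R}^2$ be a smooth curve or a finite disjoint union of smooth curves, and let $\Lambda\subset\mathbb{R}^2$. The pair $(\Gamma,\Lambda)$ is called a Heisenberg uniqueness pair if every finite complex Borel measure $\mu$ on $\mathbb{R}^2$ with $\operatorname{supp}\mu\subset\Gamma$, which is absolutely continuous with respect to arc length measure on $\Gamma$ and satisfies $\widehat\mu(\xi)=0$ for all $\xi\in\Lambda$, is the zero measure. *)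

(* Defs.v *)
From HB Require Import structures.
From mathcomp Require Import all_boot all_order all_algebra.
From mathcomp Require Import all_classical all_reals all_analysis.
From mathcomp Require Import measurable_realfun complex.

Set Implicit Arguments.
Unset Strict Implicit.
Unset Printing Implicit Defensive.

Import Order.TTheory GRing.Theory Num.Theory.
Import numFieldNormedType.Exports.

Local Open Scope classical_set_scope.
Local Open Scope ring_scope.
Local Open Scope complex_scope.

(* A finite complex measure is determined by its real and imaginary parts,
   which are finite signed measures. *)
Record complex_measure d (T : measurableType d) (R : realType) :=
  ComplexMeasure {
    re_part : {charge set T -> \bar R} ;
    im_part : {charge set T -> \bar R} }.

Section complex_measure.
Context d (T : measurableType d) (R : realType).
Implicit Types (nu : {charge set T -> \bar R}) (mu : complex_measure T R).

Definition measure_value mu (A : set T) : R[i] :=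
  fine (re_part mu A) +i* fine (im_part mu A).

Lemma hahn_pair nu :
  {PN : set T * set T | hahn_decomposition nu PN.1 PN.2}.
Proof. by apply: cid; have [P [N h]] := Hahn_decomposition nu; exists (P, N). Qed.

(* The Jordan decomposition, hence the integral, does not depend on the chosen
   Hahn decomposition (Hahn_decomposition_uniq). *)
Definition charge_integral nu (f : T -> R) : R :=
  let h := proj2_sig (hahn_pair nu) in
  (\int[jordan_pos h]_x f x - \int[jordan_neg h]_x f x)%R.

Definition complex_integral mu (f : T -> R[i]) : R[i] :=
  (charge_integral (re_part mu) (fun x => complex.Re (f x))
     - charge_integral (im_part mu) (fun x => complex.Im (f x)))
  +i* (charge_integral (re_part mu) (fun x => complex.Im (f x))
     + charge_integral (im_part mu) (fun x => complex.Re (f x))).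

Definition absolutely_continuous mu (sigma : set T -> \bar R) : Prop :=
  forall A, measurable A -> sigma A = 0%E -> measure_value mu A = 0.

Definition is_zero_measure mu : Prop :=
  forall A, measurable A -> measure_value mu A = 0.

End complex_measure.

Definition expi (R : realType) (t : R) : R[i] := cos t +i* sin t.

Section plane.
Variable R : realType.
Local Notation plane := (R * R)%type.

(* The measurable subsets of the plane, defined by the product sigma-algebra,
   are the Borel sets. *)
Lemma measurable_planeE : @measurable _ plane = <<s @open plane >>.
Proof.
apply/seteqP; split.
- apply: smallest_sub; first exact: smallest_sigma_algebra.
  have mproj (f : plane -> R) : continuous f ->
      measurable_fun [set: g_sigma_algebraType (@open plane)] f.
    move=> cf; apply: (measurability _ (RGenOpens.measurableE R)).
    move=> _ [_ [a [b ->] <-]]; rewrite setTI; apply: sub_sigma_algebra.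
    by move/continuousP: cf; apply; exact: interval_open.
  have m1 := mproj fst (fun x => cvg_fst).
  have m2 := mproj snd (fun x => cvg_snd).
  by rewrite subUset; split => _ [A mA <-]; [exact: m1|exact: m2].
- apply: smallest_sub; first exact: sigma_algebra_measurable.
  move=> U oU.
  pose box (p : (rat * rat) * (rat * rat)) : set plane :=
    `]ratr p.1.1, ratr p.1.2[%classic `*` `]ratr p.2.1, ratr p.2.2[%classic.
  have -> : U = \bigcup_p (if `[< box p `<=` U >] then box p else set0).
    apply/seteqP; split => [x Ux|x [p _]]; last first.
      by case: asboolP => // boxU; exact: boxU.
    have /nbhs_ballP[e /= e0 xU] : nbhs x U by exact: open_nbhs_nbhs.
    have sep (y : R) : exists p : rat * rat, y - e < ratr p.1 < y /\
        y < ratr p.2 < y + e.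
      have /rat_in_itvoo[a] : y - e < y by rewrite ltrBlDr ltrDl.
      have /rat_in_itvoo[b] : y < y + e by rewrite ltrDl.
      by rewrite !in_itv /= => hb ha; exists (a, b).
    have [p [/andP[p1 p2] /andP[p3 p4]]] := sep x.1.
    have [q [/andP[q1 q2] /andP[q3 q4]]] := sep x.2.
    exists (p, q) => //; case: asboolP => [_|].
      by split; rewrite /= in_itv /= ?p2 ?q2 ?p3 ?q3.
    case=> z [/=]; rewrite !in_itv /= => /andP[z1 z2] /andP[z3 z4].
    apply: xU; split; rewrite /ball /= ltr_distlC.
    - by rewrite (lt_trans p1 z1) (lt_trans z2 p4).
    - by rewrite (lt_trans q1 z3) (lt_trans z4 q4).
  apply: countable_bigcupT_measurable => // p; case: ifP => // _.
  by apply: measurableX; exact: measurable_itv.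
Qed.

Definition dot (x y : plane) : R := x.1 * y.1 + x.2 * y.2.

Definition fourier (mu : complex_measure plane R) (xi : plane) : R[i] :=
  complex_integral mu (fun x => expi (pi * dot x xi)).

(* An open set U has total variation |mu|(U) = 0 if and only if mu vanishes on
   every Borel subset of U. *)
Definition support (mu : complex_measure plane R) : set plane :=
  [set x | forall U : set plane, open U -> U x ->
     exists A, [/\ measurable A, A `<=` U & measure_value mu A <> 0]].

Definition smooth_on (U : set R) (f : R -> R) : Prop :=
  forall (k : nat) (t : R), U t -> derivable (derive1n k f) t 1.

Definition coord1 (g : R -> plane) (t : R) : R := (g t).1.
Definition coord2 (g : R -> plane) (t : R) : R := (g t).2.

Definition speed (g : R -> plane) (t : R) : R :=
  Num.sqrt (derive1 (coord1 g) t ^+ 2 + derive1 (coord2 g) t ^+ 2).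

(* I need not be open: a closed curve is parametrized injectively by a half-open
   interval. *)
Definition smooth_parametrization (I : interval R) (g : R -> plane) : Prop :=
  [/\ [set` I]° !=set0,
      exists U : set R,
        [/\ open U, [set` I] `<=` U, smooth_on U (coord1 g)
          & smooth_on U (coord2 g)],
      forall t, t \in I -> speed g t != 0
    & {in I &, injective g}].

Definition curve_image (I : interval R) (g : R -> plane) : set plane :=
  g @` [set` I].

Definition parametrizes (Gamma : set plane) (n : nat)
    (I : 'I_n -> interval R) (g : 'I_n -> R -> plane) : Prop :=
  [/\ (0 < n)%N,
      forall i, smooth_parametrization (I i) (g i),
      trivIset setT (fun i => curve_image (I i) (g i))
    & Gamma = \bigcup_i curve_image (I i) (g i)].

Definition arc_length (n : nat) (I : 'I_n -> interval R)
    (g : 'I_n -> R -> plane) (A : set plane) : \bar R :=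
  (\sum_(i < n) \int[@lebesgue_measure R]_(t in [set` I i] `&` g i @^-1` A)
     (speed (g i) t)%:E)%E.

(* The arc length measure on Gamma is the same for all parametrizations of
   Gamma, so one of them suffices. *)
Definition heisenberg_uniqueness_pair (Gamma Lambda : set plane) : Prop :=
  exists (n : nat) (I : 'I_n -> interval R) (g : 'I_n -> R -> plane),
    parametrizes Gamma I g /\
    forall mu : complex_measure plane R,
      support mu `<=` Gamma ->
      absolutely_continuous mu (arc_length I g) ->
      (forall xi, Lambda xi -> fourier mu xi = 0) ->
      is_zero_measure mu.

Definition hyperbola : set plane := [set x | x.1 * x.2 = 1].

Definition lattice_cross (alpha beta : R) : set plane :=
  [set (alpha * m%:~R, 0) | m in [set: int]] `|`
  [set (0, beta * m%:~R) | m in [set: int]].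

End plane.

Arguments hyperbola R : clear implicits.

(* Main.v *)
Require Import Defs.
From HB Require Import structures.
From mathcomp Require Import all_boot all_order all_algebra.
From mathcomp Require Import all_classical all_reals all_analysis.
From mathcomp Require Import measurable_realfun complex ring lra.

(* Let nu be a real charge on the hyperbola with Jordan parts p and n, and put X = alpha x1,
   Y = beta x2, gam = alpha beta, so that X Y = gam.  If the Fourier transform of nu vanishes on
   the first axis of the lattice cross, then X mod 2 has the same law under p and under n.  Since
   p and n live on disjoint sets, the |nu|-mass of {|X| in E}, for E in (0, 1), is at most that of
   the rest of its periodization, {|X| > 1, X mod 2 in E or -E}, which is {tau |Y| in E} for the
   Gauss-type map tau y = |gam / y mod 2| on (0, gam).  Exchanging X and Y and adding,
   w E = |nu|{|X| in E} + |nu|{|Y| in E} satisfies w E <= w (tau^-1 E).  When gam <= 1, the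
   densities 1 / (c - y) + 1 / (c + y) with c = 1 + 1 / (n + 1) are such that the transfer
   operator of tau maps the n-th one below the next one minus 1 / (10 (n + 2)).  These losses have
   an infinite sum, so iterating the inequality forces the absolutely continuous w to vanish.

   When gam > 1, the difference of the Poisson kernels of the points 1 + i sqrt (gam - 1) and
   -1 + i sqrt (gam - 1) is odd, positive on the positive axis, has zero periodization and is
   invariant under x |-> gam / x: carried to the hyperbola it is a counterexample. *)

Set Implicit Arguments.
Unset Strict Implicit.
Unset Printing Implicit Defensive.

Import Order.TTheory GRing.Theory Num.Theory.
Import numFieldNormedType.Exports.

Local Open Scope classical_set_scope.
Local Open Scope ring_scope.

(** The obstacle is the boundary case gam = 1. There tau has an indifferent fixed point at 1 and its
    invariant density 1 / (1 - y) + 1 / (1 + y) has infinite mass, so w cannot be compared with a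
    finite invariant measure and no fixed contraction rate is available. Moving the pole from 1 to
    some c > 1 makes the mass finite. After the substitution x = gam / y, the sum over the
    translates 2 k + t and 2 k - t nearly telescopes, and what survives is a density of the same
    shape with pole 2 - 1 / c. The orbit of 2 under this map tends to 1 so slowly that the defects
    of the telescoping, of order 1 - 1 / c, are not summable. How the losses act: if w <= C leb + e,
    iteration bounds the N-th total loss times w E by C times the N-th mass of E, plus e times the
    same total. That mass stays bounded while E keeps away from 1, so division leaves w E <= e up to
    a vanishing term; near 1 absolute continuity suffices. For gam < 1 the same densities serve,
    because the kernel obtained by the substitution only gets smaller. *)

Section bounded_measurable.
Context d (T : measurableType d) (R : realType).
Implicit Types (f g : T -> R).

Definition bounded_measurable f : Prop :=
  measurable_fun setT f /\ exists M, forall x, `|f x| <= M.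

Lemma bounded_measurable_cst (c : R) : bounded_measurable (cst c).
Proof. by split; [exact: measurable_cst | exists `|c|]. Qed.

Lemma bounded_measurableD f g : bounded_measurable f -> bounded_measurable g ->
  bounded_measurable (fun x => f x + g x).
Proof.
move=> [mf [M fM]] [mg [N gN]]; split; first exact: measurable_funD.
by exists (M + N) => x; rewrite (le_trans (ler_normD _ _))// lerD.
Qed.

Lemma bounded_measurableM f g : bounded_measurable f -> bounded_measurable g ->
  bounded_measurable (fun x => f x * g x).
Proof.
move=> [mf [M fM]] [mg [N gN]]; split; first exact: measurable_funM.
by exists (M * N) => x; rewrite normrM ler_pM.
Qed.

Lemma cos_bounded_measurable f : measurable_fun setT f ->
  bounded_measurable (fun x => cos (f x)).
Proof.
move=> mf; split.
  exact: measurableT_comp (continuous_measurable_fun (@continuous_cos R)) mf.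
by exists 1 => x; rewrite ler_norml cos_geN1 cos_le1.
Qed.

Lemma sin_bounded_measurable f : measurable_fun setT f ->
  bounded_measurable (fun x => sin (f x)).
Proof.
move=> mf; split.
  exact: measurableT_comp (continuous_measurable_fun (@continuous_sin R)) mf.
by exists 1 => x; rewrite ler_norml sin_geN1 sin_le1.
Qed.

Lemma bounded_measurable_integrable (mu : {finite_measure set T -> \bar R}) f :
  bounded_measurable f -> mu.-integrable setT (EFin \o f).
Proof.
move=> [mf [M fM]]; apply: measurable_bounded_integrable => //.
  by rewrite ltey_eq fin_num_measure.
exists `|M|; split; first by rewrite num_real.
by move=> K MK x _ /=; rewrite (le_trans (fM x))// (le_trans (ler_norm _))// ltW.
Qed.

Lemma Rintegral_linear (mu : {finite_measure set T -> \bar R}) (a b : R) f g :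
  bounded_measurable f -> bounded_measurable g ->
  \int[mu]_x (a * f x + b * g x) = a * \int[mu]_x f x + b * \int[mu]_x g x.
Proof.
move=> bf bg; rewrite RintegralD//.
- by rewrite !RintegralZl//; exact: bounded_measurable_integrable.
- apply: bounded_measurable_integrable.
  by apply: bounded_measurableM => //; exact: bounded_measurable_cst.
- apply: bounded_measurable_integrable.
  by apply: bounded_measurableM => //; exact: bounded_measurable_cst.
Qed.

End bounded_measurable.

(** * Equality of trigonometric moments, extended to trigonometric polynomials *)

Section trigonometric_moments.
Context d (T : measurableType d) (R : realType).
Variables (p n : {finite_measure set T -> \bar R}) (X : T -> R).
Hypothesis mX : measurable_fun setT X.

Definition same_integral (g : T -> R) : Prop := \int[p]_x g x = \int[n]_x g x.

Lemma same_integral_linear a b f g : bounded_measurable f -> bounded_measurable g ->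
  same_integral f -> same_integral g -> same_integral (fun x => a * f x + b * g x).
Proof. by move=> bf bg; rewrite /same_integral !Rintegral_linear// => -> ->. Qed.

Definition wave (m : int) (x : T) : R := pi * (X x * m%:~R).

Lemma measurable_wave m : measurable_fun setT (wave m).
Proof.
apply: measurable_funM; first exact: measurable_cst.
by apply: measurable_funM => //; exact: measurable_cst.
Qed.

Lemma waveD m k x : wave (m + k) x = wave m x + wave k x.
Proof. by rewrite /wave intrD !mulrDr. Qed.

Lemma waveB m k x : wave (m - k) x = wave m x - wave k x.
Proof. by rewrite /wave intrB !mulrBr. Qed.

(** The equality is demanded of [g] times every wave, and not of [g] alone, so that it survives
    multiplication by [cos (wave 1 x)] and [sin (wave 1 x)], and hence by every trigonometric
    polynomial in [X]. *)
Definition trig_balanced (g : T -> R) : Prop :=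
  bounded_measurable g /\ forall m : int,
    same_integral (fun x => g x * cos (wave m x)) /\
    same_integral (fun x => g x * sin (wave m x)).

Let bcos g m : bounded_measurable g ->
  bounded_measurable (fun x => g x * cos (wave m x)).
Proof.
move=> bg; apply: bounded_measurableM => //.
exact/cos_bounded_measurable/measurable_wave.
Qed.

Let bsin g m : bounded_measurable g ->
  bounded_measurable (fun x => g x * sin (wave m x)).
Proof.
move=> bg; apply: bounded_measurableM => //.
exact/sin_bounded_measurable/measurable_wave.
Qed.

Lemma trig_balanced_linear a b f g : trig_balanced f -> trig_balanced g ->
  trig_balanced (fun x => a * f x + b * g x).
Proof.
move=> [bf hf] [bg hg]; split.
  by apply: bounded_measurableD; apply: bounded_measurableM => //;
    exact: bounded_measurable_cst.
move=> m; have [fc fs] := hf m; have [gc gs] := hg m; split.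
  rewrite (_ : (fun x => _) = fun x =>
    a * (f x * cos (wave m x)) + b * (g x * cos (wave m x))).
    by apply: same_integral_linear => //; exact: bcos.
  by apply/funext => x; ring.
rewrite (_ : (fun x => _) = fun x =>
  a * (f x * sin (wave m x)) + b * (g x * sin (wave m x))).
  by apply: same_integral_linear => //; exact: bsin.
by apply/funext => x; ring.
Qed.

Lemma trig_balanced_cos g : trig_balanced g ->
  trig_balanced (fun x => g x * cos (wave 1 x)).
Proof.
move=> [bg hg]; split; first exact: bcos.
move=> m; have [c1 s1] := hg (m + 1); have [c2 s2] := hg (m - 1); split.
  rewrite (_ : (fun x => _) = fun x =>
    2^-1 * (g x * cos (wave (m + 1) x)) + 2^-1 * (g x * cos (wave (m - 1) x))).
    by apply: same_integral_linear => //; exact: bcos.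
  by apply/funext => x; rewrite waveB waveD cosB cosD; field.
rewrite (_ : (fun x => _) = fun x =>
  2^-1 * (g x * sin (wave (m + 1) x)) + 2^-1 * (g x * sin (wave (m - 1) x))).
  by apply: same_integral_linear => //; exact: bsin.
by apply/funext => x; rewrite waveB waveD sinB sinD; field.
Qed.

Lemma trig_balanced_sin g : trig_balanced g ->
  trig_balanced (fun x => g x * sin (wave 1 x)).
Proof.
move=> [bg hg]; split; first exact: bsin.
move=> m; have [c1 s1] := hg (m + 1); have [c2 s2] := hg (m - 1); split.
  rewrite (_ : (fun x => _) = fun x =>
    2^-1 * (g x * sin (wave (m + 1) x)) + (- 2^-1) * (g x * sin (wave (m - 1) x))).
    by apply: same_integral_linear => //; exact: bsin.
  by apply/funext => x; rewrite waveB waveD sinB sinD; field.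
rewrite (_ : (fun x => _) = fun x =>
  2^-1 * (g x * cos (wave (m - 1) x)) + (- 2^-1) * (g x * cos (wave (m + 1) x))).
  by apply: same_integral_linear => //; exact: bcos.
by apply/funext => x; rewrite waveB waveD cosB cosD; field.
Qed.

Hypothesis moments : forall m : int,
  same_integral (fun x => cos (wave m x)) /\
  same_integral (fun x => sin (wave m x)).

(** A trigonometric polynomial with values in [0, 1]. For b in [0, pi] it is below 1/2 exactly where
    [X x] is, modulo 2, at distance less than [b / pi] from [th / pi]: the threshold 1/2 cuts out an
    open arc. *)
Let gap (b th : R) x := 2^-1 + (cos b - cos (pi * X x - th)) / 4.

Lemma trig_balanced_gap b th g : trig_balanced g ->
  trig_balanced (fun x => g x * gap b th x).
Proof.
move=> hg; pose c1 := 2^-1 + cos b / 4.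
rewrite (_ : (fun x => _) = fun x => 1 * (c1 * g x + (- (cos th / 4)) * (g x * cos (wave 1 x)))
    + (- (sin th / 4)) * (g x * sin (wave 1 x))).
  apply: trig_balanced_linear; last exact: trig_balanced_sin.
  by apply: trig_balanced_linear => //; exact: trig_balanced_cos.
by apply/funext => x; rewrite /gap /c1 /wave cosB mulr1; field.
Qed.

Lemma trig_balanced_gapX b th k g : trig_balanced g ->
  trig_balanced (fun x => g x * gap b th x ^+ k).
Proof.
move=> hg; elim: k => [|k ih].
  by rewrite (_ : (fun x => _) = g)//; apply/funext => x; rewrite expr0 mulr1.
rewrite (_ : (fun x => _) = fun x => (g x * gap b th x ^+ k) * gap b th x).
  exact: trig_balanced_gap.
by apply/funext => x; rewrite exprSr mulrA.
Qed.

(** A polynomial in [gap]. Its shape is the one used in proofs of the Stone-Weierstrass theorem: for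
    suitable exponents it approaches the indicator of the arc where [gap] is below 1/2. *)
Lemma trig_balanced_bump b th k l :
  trig_balanced (fun x => (1 - gap b th x ^+ k) ^+ l).
Proof.
elim: l => [|l ih].
  rewrite (_ : (fun x => _) = cst 1); last by apply/funext => x; rewrite expr0.
  split=> [|m]; first exact: bounded_measurable_cst.
  have [hc hs] := moments m; split; rewrite /cst.
    by under eq_fun do rewrite mul1r.
  by under eq_fun do rewrite mul1r.
rewrite (_ : (fun x => _) = fun x => 1 * ((1 - gap b th x ^+ k) ^+ l) +
   (-1) * ((1 - gap b th x ^+ k) ^+ l * gap b th x ^+ k)).
  by apply: trig_balanced_linear => //; exact: trig_balanced_gapX.
by apply/funext => x; rewrite exprSr; ring.
Qed.

Lemma same_integral_bump b th k l :
  same_integral (fun x => (1 - gap b th x ^+ k) ^+ l).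
Proof.
have [_ /(_ 0)[+ _]] := trig_balanced_bump b th k l.
by under eq_fun do rewrite /wave !mulr0 cos0 mulr1.
Qed.

End trigonometric_moments.

(** * Convergence of the bumps to an indicator function *)

Section bump.
Context (R : realType).
Implicit Types (s y : R).

Lemma bernoulli_ge y k : 0 <= y <= 1 -> 1 - k%:R * y <= (1 - y) ^+ k.
Proof.
move=> /andP[y0 y1]; elim: k => [|k ih]; first by rewrite mul0r subr0 expr0.
rewrite exprS (le_trans _ (ler_wpM2l _ ih)) ?subr_ge0//.
rewrite -natr1; have : 0 <= k%:R :> R by []; nra.
Qed.

Lemma bernoulli_le y k : 0 <= y <= 1 -> (1 - y) ^+ k <= (1 + k%:R * y)^-1.
Proof.
move=> /andP[y0 y1].
have ky : 0 <= k%:R * y by rewrite mulr_ge0.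
rewrite -[leRHS]mul1r ler_pdivlMr ?ltr_pwDl//.
have h : 1 + k%:R * y <= (1 + y) ^+ k.
  elim: k {ky} => [|k ih]; first by rewrite mul0r addr0 expr0.
  rewrite exprS (le_trans _ (ler_wpM2l _ ih)) ?addr_ge0//.
  by rewrite -natr1; have : 0 <= k%:R :> R by []; nra.
rewrite (le_trans (ler_wpM2l _ h)) ?exprn_ge0 ?subr_ge0// -exprMn.
apply: exprn_ile1; last by nra.
by rewrite mulr_ge0 ?subr_ge0 ?addr_ge0.
Qed.

(** With s = q^2, Bernoulli bounds k q^k by 1 / (1 - q), and a geometric factor q^k is left over. *)
Lemma cvg_mulrn_expr s : 0 <= s < 1 -> k%:R * s ^+ k @[k --> \oo] --> 0.
Proof.
move=> /andP[s0 s1]; pose q := Num.sqrt s.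
have q0 : 0 <= q by exact: sqrtr_ge0.
have q1 : q < 1 by rewrite -sqrtr1 ltr_sqrt.
have sq : s = q ^+ 2 by rewrite sqr_sqrtr.
have d0 : 0 < 1 - q by rewrite subr_gt0.
have kq k : k%:R * q ^+ k <= (1 - q)^-1.
  have [->|k0] := eqVneq k 0%N; first by rewrite mul0r invr_ge0 ltW.
  have := @bernoulli_le (1 - q) k; rewrite subKr lerBlDr lerDl q0 andbT.
  move=> /(_ (ltW d0)) h.
  have k1 : 0 < k%:R :> R by rewrite ltr0n lt0n.
  rewrite (le_trans (ler_wpM2l (ltW k1) h))// -[leRHS]mul1r ler_pdivlMr//.
  rewrite mulrAC ler_pdivrMr ?ltr_pwDl ?mulr_ge0 ?(ltW d0) ?(ltW k1)//.
  by rewrite mul1r lerDr.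
apply: (@squeeze_cvgr _ _ _ _ (cst 0) (fun k => geometric (1 - q)^-1 q k)).
- apply: nearW => k; rewrite mulr_ge0 ?exprn_ge0//= sq -exprM mul2n -addnn exprD mulrA.
  by rewrite ler_wpM2r ?exprn_ge0.
- exact: cvg_cst.
- by apply: cvg_geometric; rewrite ger0_norm.
Qed.

(** Below 1/2 the bump is at least 1 - k (2 s)^k, from 1/2 on it is at most 1 / (1 + k). The factor
    [k] in the exponent is there for s = 1/2: (1 - 2^-k)^(2^k) would tend to 1/e, and the limit
    would not be an indicator at the ends of the arc. *)
Lemma bump_cvg s : 0 <= s <= 1 ->
  (1 - s ^+ k) ^+ (k * 2 ^ k) @[k --> \oo] --> ((s < 2^-1)%R%:R : R).
Proof.
move=> /andP[s0 s1].
have sk k : 0 <= s ^+ k <= 1 by rewrite exprn_ge0// exprn_ile1.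
have [sh|sh] := ltP s 2^-1.
  apply: (@squeeze_cvgr _ _ _ _ (fun k => 1 - k%:R * (2 * s) ^+ k) (cst 1)).
  - apply: nearW => k; apply/andP; split.
      have := bernoulli_ge (k * 2 ^ k) (sk k).
      by rewrite natrM natrX -mulrA -exprMn.
    by have /andP[? ?] := sk k; rewrite exprn_ile1 ?subr_ge0 ?gerBl.
  - rewrite -[X in _ --> X]subr0; apply: cvgB; first exact: cvg_cst.
    by apply: cvg_mulrn_expr; lra.
  - exact: cvg_cst.
apply: (@squeeze_cvgr _ _ _ _ (cst 0) (@harmonic R)).
- apply: nearW => k; have /andP[? ?] := sk k; rewrite exprn_ge0 ?subr_ge0//=.
  rewrite (le_trans (bernoulli_le _ (sk k)))//= lef_pV2 ?posrE ?ltr_pwDl ?mulr_ge0//.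
  rewrite -nat1r lerD2l natrM natrX -mulrA -exprMn ler_peMr// exprn_ege1//; lra.
- exact: cvg_cst.
- exact: cvg_harmonic.
Qed.

End bump.

(** * Reduction modulo 2 *)

Section fold.
Context (R : realType).
Implicit Types (x : R).

(** The chosen representatives are those in [-1, 1). The point 1 goes to -1, so the fold is odd
    except where it takes the value -1. *)
Definition fold2 x : R := x - (Num.floor ((x + 1) / 2))%:~R * 2.

Lemma fold2_itv x : -1 <= fold2 x < 1.
Proof. by rewrite /fold2; have /andP[] := floor_itv ((x + 1) / 2); rewrite intrD; lra. Qed.

Lemma fold2D x (k : int) : fold2 (x + k%:~R * 2) = fold2 x.
Proof.
rewrite /fold2 (_ : (x + k%:~R * 2 + 1) / 2 = (x + 1) / 2 + k%:~R); last by field.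
by rewrite floorDrz ?intrEfloor ?intrKfloor// intrD; ring.
Qed.

Lemma fold2_id x : -1 <= x < 1 -> fold2 x = x.
Proof.
move=> hx; rewrite /fold2 (_ : Num.floor _ = 0) ?mul0r ?subr0//.
by apply: floor_def; rewrite add0r; lra.
Qed.

Lemma fold2P x : exists k : int, x = fold2 x + k%:~R * 2.
Proof. by exists (Num.floor ((x + 1) / 2)); rewrite /fold2 subrK. Qed.

Lemma measurable_fold2 : measurable_fun setT fold2.
Proof.
apply: measurable_funB; first exact: measurable_id.
apply: measurable_funM; last exact: measurable_cst.
apply: nondecreasing_measurable => // x y xy.
by rewrite ler_int le_floor// ler_pM2r ?invr_gt0// lerD2r.
Qed.

Lemma cosD2piz (t : R) (k : int) : cos (t + pi * (k%:~R * 2)) = cos t.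
Proof.
have cn n (u : R) : cos (u + pi * (n%:R * 2)) = cos u.
  rewrite -[RHS](periodicn (@cosD2pi R) n) -(mulr_natr pi) -(mulr_natr (pi * 2)).
  by congr (cos (_ + _)); ring.
case: k => n; first exact: cn.
by rewrite NegzE -[LHS](cn n.+1) intrN -pmulrn; congr cos; ring.
Qed.

(** The arc of centre d - 1 and half-width d starts at the seam -1 of the fold, so it never wraps
    around. Cosine decreases on [0, pi], hence comparing cosines compares distances to the
    centre. *)
Lemma cos_fold2_itv (x d : R) : 0 <= d <= 1 ->
  (cos (pi * d) < cos (pi * x - pi * (d - 1))) = (-1 < fold2 x < 2 * d - 1).
Proof.
move=> hd; have [k xE] := fold2P x; have := fold2_itv x.
set r := fold2 x in xE * => hr.
have -> : cos (pi * x - pi * (d - 1)) = cos (pi * `|r - d + 1|).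
  transitivity (cos (pi * (r - d + 1))).
    by rewrite xE -[RHS](cosD2piz _ k); congr cos; ring.
  by case: ler0P => // _; rewrite mulrN cosN.
have piM (u : R) : 0 <= u <= 1 -> pi * u \in `[0, pi].
  by move=> /andP[u0 u1]; rewrite in_itv/= mulr_ge0 ?pi_ge0//= ger_pMr ?pi_gt0.
have [y1|y1] := leP (`|r - d + 1|) 1.
  rewrite ltr_cos ?piM ?normr_ge0 ?y1//.
  by rewrite ltr_pM2l ?pi_gt0// ltr_norml; apply/idP/idP; lra.
have r0 : 1 < r - d + 1 by move: y1; rewrite lter_normr => /orP[]; lra.
(* The distance to the centre exceeds half a period, so it is measured the other way round the
   circle. *)
have -> : cos (pi * `|r - d + 1|) = cos (pi * (2 - (r - d + 1))).
  rewrite gtr0_norm; last by lra.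
  by rewrite -cosN -[LHS](cosD2piz _ 1); congr cos; ring.
rewrite ltr_cos ?piM//; last by lra.
by rewrite ltr_pM2l ?pi_gt0//; apply/idP/idP; lra.
Qed.

End fold.

(** * Equal Fourier coefficients give equal laws modulo 2 *)

Section fourier_uniqueness.
Context d (T : measurableType d) (R : realType).
Variables (p n : {finite_measure set T -> \bar R}) (X : T -> R).
Hypothesis mX : measurable_fun setT X.
Hypothesis moments : forall m : int,
  same_integral p n (fun x => cos (wave X m x)) /\
  same_integral p n (fun x => sin (wave X m x)).

(** The bumps have equal integrals under [p] and [n], lie in [0, 1] and converge everywhere to the
    indicator of the arc, so dominated convergence applies. *)
Let same_arc (c : R) : 0 <= c <= 1 ->
  p (X @^-1` (@fold2 R @^-1` `]-1, 2 * c - 1[)) = n (X @^-1` (@fold2 R @^-1` `]-1, 2 * c - 1[)).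
Proof.
move=> c01; set A := X @^-1` _.
have mA : measurable A.
  rewrite -[A]setTI; apply: mX => //; rewrite -[X in measurable X]setTI.
  exact: measurable_fold2.
pose g x := 2^-1 + (cos (pi * c) - cos (pi * X x - pi * (c - 1))) / 4.
pose f k x : R := (1 - g x ^+ k) ^+ (k * 2 ^ k).
have g01 x : 0 <= g x <= 1.
  rewrite /g; have := cos_le1 (pi * c); have := cos_geN1 (pi * c).
  have := cos_le1 (pi * X x - pi * (c - 1)); have := cos_geN1 (pi * X x - pi * (c - 1)); lra.
have mf k : measurable_fun setT (EFin \o f k).
  apply/measurable_EFinP; have [[]//] := trig_balanced_bump mX moments (pi * c) (pi * (c - 1)) k (k * 2 ^ k).
have f01 k x : 0 <= f k x <= 1.
  have /andP[g0 g1] := g01 x.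
  by rewrite /f exprn_ge0 ?exprn_ile1 ?subr_ge0 ?gerBl ?exprn_ge0 ?exprn_ile1.
have fA x : (f k x)%:E @[k --> \oo] --> ((\1_A x)%:E : \bar R).
  apply: cvg_EFin; first exact: nearW.
  rewrite (_ : \1_A x = (g x < 2^-1)%R%:R :> R); first exact: bump_cvg.
  have -> : (g x < 2^-1) = (cos (pi * c) < cos (pi * X x - pi * (c - 1))).
    by rewrite /g; apply/idP/idP; lra.
  rewrite cos_fold2_itv// indicE; congr (nat_of_bool _)%:R.
  by apply/idP/idP; rewrite inE /A /= in_itv.
have lim (mu : {finite_measure set T -> \bar R}) :
    (\int[mu]_x (f k x)%:E)%E @[k --> \oo] --> mu A.
  have [||||_ _] := @dominated_convergence _ T R mu setT measurableT
    (fun k x => (f k x)%:E) (fun x => (\1_A x)%:E) (cst 1%E) mf.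
  - by apply/measurable_EFinP; exact: measurable_indic.
  - exact: aeW.
  - by apply: (bounded_measurable_integrable mu (f := cst 1)); exact: bounded_measurable_cst.
  - apply: aeW => x k _; have /andP[f0 f1] := f01 k x.
    by rewrite /= lee_fin ger0_norm.
  - by rewrite integral_indic// setIT.
apply: cvg_unique (lim n) => //.
rewrite (_ : (fun k => _) = (fun k => \int[p]_x (f k x)%:E)%E); first exact: lim.
apply/funext => k.
have bf : bounded_measurable (f k) by have [] := trig_balanced_bump mX moments (pi * c) (pi * (c - 1)) k (k * 2 ^ k).
have := congr1 EFin
  (same_integral_bump mX moments (pi * c) (pi * (c - 1)) k (k * 2 ^ k)).
rewrite /Rintegral !fineK//; apply: integrable_fin_num => //; exact: bounded_measurable_integrable.
Qed.

Let same_total : p setT = n setT.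
Proof.
have [+ _] := moments 0; rewrite /same_integral.
rewrite (_ : (fun x => _) = cst 1); last first.
  by apply/funext => x; rewrite /wave !mulr0 cos0.
rewrite !Rintegral_cst//= !mul1r => h; have := congr1 EFin h.
by rewrite !fineK//; exact: fin_num_measure.
Qed.

(** The rays to the left form a generating pi-system, and the trace of a ray on [-1, 1) is empty,
    everything, or the point -1 followed by an arc covered by [same_arc]. *)
Lemma measure_fold2_unique (E : set R) : measurable E ->
  p [set x | E (fold2 (X x))] = n [set x | E (fold2 (X x))].
Proof.
move=> mE; pose Y := @fold2 R \o X.
have mY : measurable_fun setT Y := measurableT_comp (@measurable_fold2 R) mX.
have mpre (B : set R) : measurable B -> measurable (Y @^-1` B).
  by move=> mB; rewrite -[X in measurable X]setTI; exact: mY.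
(* The seam belongs to no arc; its mass is what the full arc (-1, 1) leaves of the total mass. *)
have arc0 : p (Y @^-1` [set -1]) = n (Y @^-1` [set -1]).
  have h : Y @^-1` [set -1] = ~` (Y @^-1` `]-1, 2 * 1 - 1[).
    apply/seteqP; split=> x /=; rewrite in_itv/=.
      by move=> ->; rewrite ltxx.
    by have := fold2_itv (X x); rewrite -[fold2 _]/(Y x) => ? /negP ?; lra.
  have m1 := mpre _ (measurable_itv `](-1 : R), 2 * 1 - 1[).
  rewrite h -!setTD !measureD ?setTI//; last 2 first.
  - by rewrite ltey_eq fin_num_measure.
  - by rewrite ltey_eq fin_num_measure.
  congr (_ - _)%E; first exact: same_total.
  by apply: same_arc; rewrite ler01 lexx.
apply: (measure_unique (@RGenInftyO.G R) (fun k => `]-oo, k%:R[%classic) _ _ _ _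
  (pushforward p Y) (pushforward n Y)) => //.
- exact: RGenInftyO.measurableE.
- move=> _ _ [a ->] [b ->]; exists (Num.min a b).
  by apply/seteqP; split=> x /=; rewrite !in_itv/= lt_min => /andP.
- by move=> k; exists k%:R.
- rewrite -subTset => x _; exists (Num.truncn `|x|).+1 => //=; rewrite in_itv/=.
  by rewrite (le_lt_trans (ler_norm _))// truncnS_gt.
- move=> _ [b ->]; change (p (Y @^-1` `]-oo, b[) = n (Y @^-1` `]-oo, b[)).
  have [b1|b1] := ltP 1 b.
    rewrite (_ : _ @^-1` _ = setT)// -subTset => x _ /=; rewrite in_itv/=.
    by have := fold2_itv (X x); rewrite -[fold2 _]/(Y x); lra.
  have [b0|b0] := leP b (-1).
    rewrite (_ : _ @^-1` _ = set0) ?measure0// -subset0 => x /=; rewrite in_itv/=.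
    by have := fold2_itv (X x); rewrite -[fold2 _]/(Y x); lra.
  have -> : Y @^-1` `]-oo, b[ = Y @^-1` [set -1] `|` Y @^-1` `]-1, 2 * ((b + 1) / 2) - 1[.
    rewrite (_ : 2 * _ - 1 = b); last by field.
    apply/seteqP; split=> x /=; rewrite !in_itv/=; have := fold2_itv (X x);
      rewrite -[fold2 _]/(Y x) => hY.
      by move=> ?; have [->|?] := eqVneq (Y x) (-1); [left|right; lra].
    by case => [->|]; lra.
  have m0 := mpre _ (measurable_set1 (-1)).
  have m1 := mpre _ (measurable_itv `](-1), 2 * ((b + 1) / 2) - 1[).
  have m01 : Y @^-1` [set -1] `&` Y @^-1` `]-1, 2 * ((b + 1) / 2) - 1[ = set0.
    by rewrite -subset0 => x /= [->]; rewrite in_itv/= ltxx.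
  rewrite !measureU//.
  congr (_ + _)%E; first exact: arc0.
  by apply: same_arc; lra.
- by move=> k; rewrite ltey_eq fin_num_measure//; exact: mpre.
Qed.

End fourier_uniqueness.

(** * The substitution y = gam / x on Borel sets *)

Section density_measure.
Local Open Scope ereal_scope.
Context d (T : measurableType d) (R : realType) (mu : {measure set T -> \bar R}).
Variable f : T -> \bar R.
Hypotheses (mf : measurable_fun setT f) (f0 : forall x, 0 <= f x).

(** Made into a measure so that two integrals, as functions of the domain, can be identified by
    comparing them on intervals. *)
Definition density_measure (A : set T) : \bar R := \int[mu]_(x in A) f x.

Let density_measure0 : density_measure set0 = 0.
Proof. by rewrite /density_measure integral_set0. Qed.

Let density_measure_ge0 A : 0 <= density_measure A.
Proof. exact: integral_ge0. Qed.

Let density_measure_sigma_additive : semi_sigma_additive density_measure.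
Proof. exact: semi_sigma_additive_nng_induced. Qed.

HB.instance Definition _ := isMeasure.Build _ _ _ density_measure
  density_measure0 density_measure_ge0 density_measure_sigma_additive.

End density_measure.

Section inversion.
Context (R : realType).
Local Notation leb := (@lebesgue_measure R).
Implicit Types (phi : R -> R) (gam x : R).

Lemma inv_is_derive gam x : x != 0 -> is_derive x 1 (fun y : R => gam / y) (- (gam / x ^+ 2)).
Proof.
move=> x0; have dV := @is_deriveV R id x 1 1 x0 (is_derive_id x 1).
apply: is_derive_eq.
by rewrite scaler1 scalerN.
Qed.

Lemma continuous_divl gam x : 0 < x -> {for x, continuous (fun y : R => gam / y)}.
Proof.
move=> x0; apply: cvgM; first exact: cvg_cst.
by apply: cvgV; [exact: lt0r_neq0|exact: cvg_id].
Qed.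

Lemma derive1_divl gam x : 0 < x ->
  ((fun y : R => gam / y)^`())%classic x = - (gam / x ^+ 2).
Proof.
by move=> x0; rewrite derive1E; have := inv_is_derive gam (lt0r_neq0 x0) => /@derive_val.
Qed.

Lemma continuous_derive1_divl gam x : 0 < x ->
  {for x, continuous ((fun y : R => gam / y)^`())%classic}.
Proof.
move=> x0.
have cG : {for x, continuous (fun y : R => - (gam / y ^+ 2))}.
  apply: continuousN; apply: continuousM; first exact: cst_continuous.
  apply: continuousV; first by rewrite expf_neq0// lt0r_neq0.
  exact: exprn_continuous.
rewrite /prop_for/= /continuous_at derive1_divl//.
apply: cvg_trans cG; apply: near_eq_cvg; near=> y; rewrite derive1_divl//.
by near: y; exact: lt_nbhsr.
Unshelve. all: by end_near. Qed.

Lemma inv_substitution_itv phi gam (a b : R) :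
  {in `]0, +oo[, continuous phi} -> 0 < gam -> 0 < a -> a <= b ->
  (\int[leb]_(y in `[(gam / b)%R, (gam / a)%R]) (phi y)%:E =
   \int[leb]_(x in `[a, b]) (phi (gam / x) * (gam / x ^+ 2))%R%:E)%E.
Proof.
move=> cphi g0 a0 ab.
have b0 := lt_le_trans a0 ab.
rewrite (@integration_by_substitution_decreasing R (fun y => gam / y) phi a b)//.
- apply: eq_integral => x; rewrite inE/= in_itv/= => /andP[ax xb].
  rewrite -[gam / x ^+ 2]opprK -derive1_divl//; exact: lt_le_trans ax.
- move=> x y; rewrite !in_itv/= => /andP[ax _] /andP[ay _] xy.
  have x0 := lt_le_trans a0 ax; have y0 := lt_le_trans a0 ay.
  by rewrite ltr_pM2l// ltf_pV2.
- move=> x; rewrite in_itv/= => /andP[ax _].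
  exact: continuous_derive1_divl (lt_trans a0 ax).
- apply/cvg_ex; eexists; apply: cvg_at_right_filter.
  exact: continuous_derive1_divl a0.
- apply/cvg_ex; eexists; apply: cvg_at_left_filter.
  exact: continuous_derive1_divl b0.
- split.
  + move=> x; rewrite in_itv/= => /andP[ax _].
    by have := inv_is_derive gam (lt0r_neq0 (lt_trans a0 ax)) => /@ex_derive.
  + by apply: cvg_at_right_filter; exact: continuous_divl.
  + by apply: cvg_at_left_filter; exact: continuous_divl.
- apply: continuous_in_subspaceT => x; rewrite inE/= in_itv/= => /andP[bx _].
  by apply: cphi; rewrite in_itv/= (lt_le_trans _ bx)// divr_gt0.
Qed.

Lemma continuous_pos_measurable_fun phi : {in `]0, +oo[, continuous phi} ->
  measurable_fun (`](0 : R), +oo[ : set R) (EFin \o phi).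
Proof.
move=> cphi; apply/measurable_EFinP.
apply: open_continuous_measurable_fun; first exact: interval_open.
by move=> x; rewrite inE/= => /cphi.
Qed.

Lemma continuous_pos_measurable phi : {in `]0, +oo[, continuous phi} ->
  measurable_fun [set: R] ((EFin \o phi) \_ `](0 : R), +oo[).
Proof.
move=> cphi.
have mphi := continuous_pos_measurable_fun cphi.
have mI : measurable (`](0 : R), +oo[ : set R) := measurable_itv _.
have := (measurable_restrictT (EFin \o phi) mI).1 => H; move: mphi => /H {}H.
exact: H.
Qed.

Lemma restrict_pos_ge0 phi : {in `]0, +oo[, forall y, 0 <= phi y} ->
  forall x, (0 <= ((EFin \o phi) \_ `]0%R, +oo[) x)%E.
Proof.
move=> phi0 x; apply: erestrict_ge0 => y /=.
by rewrite lee_fin => /phi0.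
Qed.

(** The formula on compact intervals spreads to Borel sets by uniqueness of measures. This is done
    in the logarithmic coordinate, where the bounded intervals ]u, v] correspond to intervals that
    stay away from 0 and from infinity: there the integrals are finite, whatever [phi] does at the
    two ends of the half-line. *)
Lemma inv_substitution phi gam (A : set R) :
  {in `]0, +oo[, continuous phi} -> {in `]0, +oo[, forall y, 0 <= phi y} ->
  0 < gam -> measurable A ->
  (\int[leb]_(y in [set y | (0 < y)%R /\ A (gam / y)%R]) (phi y)%:E =
   \int[leb]_(x in [set x | (0 < x)%R /\ A x]) (phi (gam / x) * (gam / x ^+ 2))%R%:E)%E.
Proof.
move=> cphi phi0 g0 mA.
pose psi x := phi (gam / x) * (gam / x ^+ 2).
have cpsi : {in `]0, +oo[, continuous psi}.
  move=> x; rewrite in_itv/= andbT => x0.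
  apply: (@continuousM R R (fun y => phi (gam / y)) (fun y => gam / y ^+ 2) x).
    apply: (@continuous_comp R R R (fun y => gam / y) phi x).
      exact: continuous_divl.
    by apply: cphi; rewrite in_itv/= andbT divr_gt0.
  apply: (@continuousM R R (cst gam) (fun y => (y ^+ 2)^-1) x).
    exact: cst_continuous.
  apply: (@continuousV R R (fun y => y ^+ 2) x).
    by rewrite expf_neq0// lt0r_neq0.
  exact: exprn_continuous.
have psi0 : {in `]0, +oo[, forall y, 0 <= psi y}.
  move=> x; rewrite in_itv/= andbT => x0.
  rewrite mulr_ge0 ?divr_ge0 ?exprn_ge0 ?(ltW x0) ?(ltW g0)// phi0//.
  by rewrite in_itv/= divr_gt0.
pose Phi := (EFin \o phi) \_ `](0 : R), +oo[; pose Psi := (EFin \o psi) \_ `](0 : R), +oo[.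
have mPhi : measurable_fun setT Phi := continuous_pos_measurable cphi.
have mPsi : measurable_fun setT Psi := continuous_pos_measurable cpsi.
have Phi0 := restrict_pos_ge0 phi0; have Psi0 := restrict_pos_ge0 psi0.
(* This is the logarithm of gam / y for y > 0. Elsewhere [ln] only has a default value, which does
   no harm because [Phi] and [Psi] vanish there. *)
pose h y := ln gam - ln y.
have mh : measurable_fun setT h.
  by apply: measurable_funB; [exact: measurable_cst|exact: measurable_ln].
have hE y : 0 < y -> expR (h y) = gam / y.
  by move=> y0; rewrite /h -ln_div ?posrE// lnK// posrE divr_gt0.
have mB : measurable (@expR R @^-1` A).
  by rewrite -[X in measurable X]setTI; exact: measurable_expR.
have mI : measurable (`](0 : R), +oo[ : set R) := measurable_itv _.
have lnI u v : u <= v -> (\int[leb]_(x in @ln R @^-1` `]u, v]) Psi x =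
    \int[leb]_(x in `[(expR u)%R, (expR v)%R]) (psi x)%:E)%E.
  move=> uv; rewrite -integral_mkcondr -integral_itv_obnd_cbnd; last first.
    apply: (measurable_funS mI); last exact: continuous_pos_measurable_fun.
    by move=> x /=; rewrite !in_itv/= => /andP[/(lt_trans (expR_gt0 u)) ->].
  congr (integral _ _ _); apply/seteqP; split => y /=; rewrite !in_itv/= ?andbT.
    by move=> [/andP[uy yv] y0]; rewrite -[y]lnK ?posrE// ltr_expR ler_expR uy.
  move=> /andP[uy yv]; have y0 := lt_trans (expR_gt0 u) uy.
  by split => //; rewrite -ltr_expR -ler_expR lnK ?posrE// uy.
have hI u v : u <= v -> (\int[leb]_(x in h @^-1` `]u, v]) Phi x =
    \int[leb]_(x in `[(gam / expR v)%R, (gam / expR u)%R]) (phi x)%:E)%E.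
  move=> uv; rewrite -integral_mkcondr -integral_itv_bndo_bndc; last first.
    apply: (measurable_funS mI); last exact: continuous_pos_measurable_fun.
    move=> x /=; rewrite !in_itv/= andbT => /andP[+ _].
    by apply: lt_le_trans; rewrite divr_gt0 ?expR_gt0.
  congr (integral _ _ _); apply/seteqP; split => y /=; rewrite !in_itv/= ?andbT.
    move=> [/andP[uy yv] y0].
    move: uy yv; rewrite -ltr_expR -ler_expR hE// ltr_pdivlMr// ler_pdivrMr// => uy yv.
    by rewrite ler_pdivrMr ?expR_gt0// ltr_pdivlMr ?expR_gt0// mulrC yv mulrC.
  rewrite ler_pdivrMr ?expR_gt0// ltr_pdivlMr ?expR_gt0// => /andP[vy yu].
  have y0 : 0 < y by rewrite -(pmulr_lgt0 _ (expR_gt0 v)) (lt_le_trans g0).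
  split => //; rewrite -ltr_expR -ler_expR hE// ltr_pdivlMr// ler_pdivrMr//.
  by rewrite mulrC yu mulrC.
have H (B : set R) : measurable B ->
    (\int[leb]_(y in h @^-1` B) Phi y = \int[leb]_(x in @ln R @^-1` B) Psi x)%E.
  move=> mB'.
  apply: (measure_unique (@ocitv R) (fun k => `]-k%:R, k%:R]%classic) _ _ _ _
    (pushforward (density_measure leb Phi) h)
    (pushforward (density_measure leb Psi) (@ln R))) => //.
  - exact: ocitvI.
  - by move=> k; exists (-k%:R, k%:R).
  - rewrite -subTset => x _; exists (Num.truncn `|x|).+1 => //=; rewrite in_itv/=.
    by have := truncnS_gt `|x|; rewrite ltr_norml => /andP[-> /ltW ->].
  - move=> _ [[u v] _ <-] /=; change (\int[leb]_(y in h @^-1` `]u, v]) Phi y =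
      \int[leb]_(x in @ln R @^-1` `]u, v]) Psi x)%E.
    have [vu|/ltW uv] := leP v u.
      by rewrite set_itv_ge ?bnd_simp// ?preimage_set0 ?integral_set0// -leNgt.
    rewrite hI// lnI// inv_substitution_itv//; first exact: expR_gt0.
    by rewrite ler_expR.
  - move=> k; change (\int[leb]_(y in h @^-1` `](- k%:R)%R, k%:R%R]) Phi y < +oo)%E.
    rewrite hI//; last by rewrite (@le_trans _ _ 0) ?oppr_le0.
    rewrite ltey_eq; apply/orP; left.
    apply: integrable_fin_num => //; apply: continuous_compact_integrable.
      exact: segment_compact.
    apply: continuous_in_subspaceT => x; rewrite inE/= in_itv/= => /andP[bx _].
    by apply: cphi; rewrite in_itv/= andbT (lt_le_trans _ bx)// divr_gt0 ?expR_gt0.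
have := H _ mB; rewrite /Phi /Psi -!integral_mkcondr => {}H.
transitivity (\int[leb]_(x in (h @^-1` (expR @^-1` A)) `&` `]0%R, +oo[) (EFin \o phi) x)%E.
  congr (integral _ _ _); apply/seteqP; split => y /=; rewrite in_itv/= andbT.
    by move=> [y0]; rewrite hE.
  by move=> [+ y0]; rewrite hE.
rewrite H; congr (integral _ _ _); apply/seteqP; split => y /=; rewrite in_itv/= andbT.
  by move=> [+ y0]; rewrite lnK.
by move=> [y0]; rewrite lnK.
Qed.

End inversion.

(** * Translations and reflections of the line *)

Section affine_substitution.
Context (R : realType).
Local Notation leb := (@lebesgue_measure R).

Lemma lebesgue_measure_shift (a : R) (A : set R) : measurable A ->
  leb ((fun t => a + t) @^-1` A) = leb A.
Proof.
have mf : measurable_fun setT (fun t : R => a + t).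
  by apply: measurable_funD; [exact: measurable_cst|exact: measurable_id].
move=> mA; apply/esym.
change (leb A = pushforward leb ((fun t => a + t) : _ -> measurableTypeR R) A).
apply: lebesgue_measure_unique => //= _ [[u v] _ <-].
rewrite /pushforward/= (_ : _ @^-1` _ = `](u - a), (v - a)]%classic).
  by rewrite !lebesgue_measure_itv/= !lte_fin ltrD2r; case: ifP => // _; congr EFin; ring.
by apply/seteqP; split => x /=; rewrite !in_itv/= ltrBlDl lerBrDl.
Qed.

Lemma lebesgue_measure_reflect (a : R) (A : set R) : measurable A ->
  leb ((fun t => a - t) @^-1` A) = leb A.
Proof.
move=> mA.
have mf : measurable_fun setT (fun t : R => a - t).
  by apply: measurable_funB; [exact: measurable_cst|exact: measurable_id].
have mB := mf measurableT A mA; rewrite setTI in mB.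
rewrite -(lebesgue_measure_shift a mA) -(lebesgue_measureN mB).
by rewrite /pushforward; congr (leb _); apply/seteqP; split => x; rewrite /preimage/= opprK.
Qed.

Lemma ge0_integral_preserving (f : R -> R) (D : set R) (G : R -> \bar R) :
  measurable_fun setT f -> (forall A, measurable A -> leb (f @^-1` A) = leb A) ->
  measurable D -> measurable_fun D G -> (forall x, D x -> (0 <= G x)%E) ->
  (\int[leb]_(x in D) G x = \int[leb]_(t in f @^-1` D) G (f t))%E.
Proof.
move=> mf lf mD mG G0.
have mf' : @measurable_fun _ _ (measurableTypeR R) (measurableTypeR R) setT f := mf.
transitivity (\int[pushforward leb (f : measurableTypeR R -> measurableTypeR R)]_(x in D) G x)%E.
  by apply: eq_measure_integral => A mA _; apply/esym; exact: lf.
by apply: ge0_integral_pushforward => // x; rewrite inE; exact: G0.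
Qed.

End affine_substitution.

(** * The densities and the transfer operator of tau *)

Section gauss_type_density.
Context (R : realType).
Local Notation leb := (@lebesgue_measure R).
Implicit Types (c t y b x : R).

Definition pole_density c y : R := (c - y)^-1 + (c + y)^-1.
(** Explicit form of the orbit of 2 under c |-> 2 - 1 / c, as [poleS] records. *)
Definition pole (n : nat) : R := 1 + n.+1%:R^-1.
(** A tenth of 1 - 1 / [pole n]; the first gap of the telescoping sum in [pole_sum_le] yields at
    least a sixth of that quantity. *)
Definition loss (n : nat) : R := (10 * n.+2%:R)^-1.
(** The preimage of [E] under tau, confined to the domain (0, gam) of that map. *)
Definition escape (gam : R) (E : set R) : set R :=
  [set y | [/\ 0 < y, 1 < gam / y & E `|fold2 (gam / y)|]].

(** The density with pole 1 / b after the substitution y = 1 / x, Jacobian included. As a difference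
    of shifted reciprocals it is ready for telescoping. *)
Definition pole_kernel b x : R := (x - b)^-1 - (x + b)^-1.

Lemma pole_gt1 n : 1 < pole n.
Proof. by rewrite /pole ltrDl invr_gt0. Qed.

Lemma poleS n : pole n.+1 = 2 - (pole n)^-1.
Proof.
rewrite /pole -(natr1 n.+1); have : 0 < n.+1%:R :> R by [].
move: (n.+1%:R) => m h; field.
by rewrite !lt0r_neq0// addr_gt0.
Qed.

Lemma loss_gt0 n : 0 < loss n.
Proof. by rewrite invr_gt0 mulr_gt0. Qed.

Let lossE n : 1 - (pole n)^-1 = 10 * loss n.
Proof.
rewrite /pole /loss -(natr1 n.+1); have : 0 < n.+1%:R :> R by [].
move: (n.+1%:R) => m h; field.
by rewrite !lt0r_neq0// addr_gt0.
Qed.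

(** With b = 1 / [pole n], the positive terms at k = 0 have pole 2 - b = [pole n.+1] and already
    make up the right-hand side. Every later positive term is at most the subtracted term just
    before it, because 2 m + b <= 2 (m + 1) - b, and the first of these comparisons leaves room for
    the loss. *)
Lemma pole_sum_le n (J : nat) t : 0 < t < 1 ->
  \sum_(k < J) (pole_kernel (pole n)^-1 (2 * k.+1%:R + t) + pole_kernel (pole n)^-1 (2 * k.+1%:R - t))
   + loss n <= pole_density (pole n.+1) t.
Proof.
move=> /andP[t0 t1]; set b := (pole n)^-1.
have p1 := pole_gt1 n.
have b0 : 0 < b by rewrite invr_gt0 (lt_trans _ p1).
have b1 : b < 1 by rewrite invf_lt1// (lt_trans _ p1).
have lb : loss n = (1 - b) / 10 by rewrite lossE; field.
pose S (J : nat) := \sum_(k < J) (pole_kernel b (2 * k.+1%:R + t) + pole_kernel b (2 * k.+1%:R - t)).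
have K0 x : 1 <= x -> 0 <= pole_kernel b x.
  by move=> x1; rewrite subr_ge0 lef_pV2 ?posrE; lra.
have Smono i : S i <= S i.+1.
  rewrite /S big_ord_recr/= lerDl.
  have i1 : 1 <= i.+1%:R :> R by rewrite ler1n.
  by rewrite addr_ge0// K0//; lra.
suff H i : S i.+2 + loss n + ((2 * i.+2%:R + b - t)^-1 + (2 * i.+2%:R + b + t)^-1)
    <= pole_density (pole n.+1) t.
  have i2 : 1 <= J.+2%:R :> R by rewrite ler1n.
  have := H J; have := Smono J; have := Smono J.+1; rewrite -/(S J).
  have : 0 <= (2 * J.+2%:R + b - t)^-1 by rewrite invr_ge0; lra.
  have : 0 <= (2 * J.+2%:R + b + t)^-1 by rewrite invr_ge0; lra.
  lra.
elim: i => [|i ih].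
  rewrite /S !big_ord_recr big_ord0/= /pole_kernel /pole_density poleS -/b lb add0r.
  (* The difference is 2 (1 - b) over a product of factors at most 3 and 4, hence at least (1 - b) /
     6. *)
  have h1 : (2 + b - t)^-1 - (4 - b - t)^-1 >= (1 - b) / 10.
    rewrite [leRHS](_ : _ = (1 - b) * 2 / ((2 + b - t) * (4 - b - t))); last first.
      by field; rewrite !gt_eqF//; lra.
    rewrite ler_pdivlMr; last by rewrite mulr_gt0; lra.
    rewrite -mulrA ler_wpM2l; [by []|lra|].
    have : (2 + b - t) * (4 - b - t) <= 3 * 4 by rewrite ler_pM; lra.
    lra.
  have h2 : (2 + b + t)^-1 - (4 - b + t)^-1 >= 0.
    by rewrite subr_ge0 lef_pV2 ?posrE; lra.
  rewrite (_ : 2 * 1 + t - b = 2 - b + t); last by ring.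
  rewrite (_ : 2 * 1 - t - b = 2 - b - t); last by ring.
  rewrite (_ : 2 * 1 + t + b = 2 + b + t); last by ring.
  rewrite (_ : 2 * 1 - t + b = 2 + b - t); last by ring.
  rewrite (_ : 2 * 2 + t - b = 4 - b + t); last by ring.
  rewrite (_ : 2 * 2 - t - b = 4 - b - t); last by ring.
  rewrite (_ : 2 * 2 + t + b = 2 * 2 + b + t); last by ring.
  rewrite (_ : 2 * 2 - t + b = 2 * 2 + b - t); last by ring.
  lra.
apply: le_trans ih; rewrite /S big_ord_recr/= -/(S i.+2) /pole_kernel.
set m := i.+2; have i1 : 1 <= m%:R :> R by rewrite ler1n.
have -> : m.+1%:R = m%:R + 1 :> R by rewrite -natr1.
have h1 : (2 * (m%:R + 1) - t - b)^-1 <= (2 * m%:R + b - t)^-1.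
  by rewrite lef_pV2 ?posrE; lra.
have h2 : (2 * (m%:R + 1) + t - b)^-1 <= (2 * m%:R + b + t)^-1.
  by rewrite lef_pV2 ?posrE; lra.
rewrite (_ : 2 * (m%:R + 1) + t + b = 2 * (m%:R + 1) + b + t); last by ring.
rewrite (_ : 2 * (m%:R + 1) - t + b = 2 * (m%:R + 1) + b - t); last by ring.
lra.
Qed.

End gauss_type_density.

Section escape_inequality.
Context (R : realType).
Local Notation leb := (@lebesgue_measure R).
Implicit Types (c t y b x : R).

Lemma measurable_absfold2 : measurable_fun setT (fun x : R => `|fold2 x|).
Proof. by apply: measurableT_comp => //; exact: measurable_fold2. Qed.

(** For x > 1 and [E] inside (0, 1) the untranslated copies of [E] and [-E] are out of reach, which
    is why the translations start at 2. *)
Lemma absfold2P (E : set R) x : E `<=` `]0, 1[ -> 1 < x ->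
  E `|fold2 x| <-> exists k : nat, E (x - 2 * k.+1%:R) \/ E (2 * k.+1%:R - x).
Proof.
move=> E01 x1; split=> [Ex|[k Ek]].
  have := E01 _ Ex; rewrite /= in_itv/= => /andP[f0 f1].
  have [k xE] := fold2P x; rewrite ltr_norml in f1.
  have k0 : (0 < k)%R.
    by rewrite -(@ltr_int R); lra.
  case: k k0 xE => [[//|k] _ xE|//].
  exists k; rewrite -pmulrn in xE.
  have fE : fold2 x = x - 2 * k.+1%:R by rewrite {2}xE; ring.
  move: Ex; case: ler0P => _; rewrite fE; [rewrite opprB|]; by [right|left].
case: Ek => Ek; have := E01 _ Ek; rewrite /= in_itv/= => /andP[h0 h1].
  rewrite (_ : x = (x - 2 * k.+1%:R) + k.+1%:~R * 2); last by rewrite -pmulrn; ring.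
  rewrite fold2D fold2_id; last by lra.
  by rewrite gtr0_norm.
rewrite (_ : x = (x - 2 * k.+1%:R) + k.+1%:~R * 2); last by rewrite -pmulrn; ring.
rewrite fold2D fold2_id; last by lra.
by rewrite ltr0_norm ?opprB//; lra.
Qed.

(** Continuous away from 0, and the default value 0^-1 = 0 agrees with extension by 0. *)
Lemma measurable_inv : measurable_fun [set: R] (@GRing.inv R).
Proof.
have oD : open [set x : R | x != 0].
  rewrite (_ : [set x : R | _] = ~` [set 0]); last first.
    by apply/seteqP; split => x /= /eqP.
  by rewrite openC; exact: closed_eq.
have mi : measurable_fun [set x : R | x != 0] (@GRing.inv R).
  apply: open_continuous_measurable_fun => // x; rewrite inE/=.
  exact: inv_continuous.
have := (measurable_restrictT (@GRing.inv R) (open_measurable oD)).1 => H.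
have {}H := H mi; rewrite (_ : @GRing.inv R = (@GRing.inv R) \_ [set x : R | x != 0]) //.
apply/funext => x; rewrite /patch; case: ifPn => //; rewrite notin_setE/= => /negP.
by rewrite negbK => /eqP ->; rewrite invr0.
Qed.

Lemma measurable_funV (D : set R) (f : R -> R) :
  measurable_fun D f -> measurable_fun D (fun x => (f x)^-1).
Proof. exact: measurableT_comp measurable_inv. Qed.

Lemma measurable_divl (b : R) : measurable_fun [set: R] (fun t => b / t).
Proof. by apply: measurable_funM; [exact: measurable_cst|exact: measurable_inv]. Qed.

Lemma measurable_pole_kernel (D : set R) b : measurable_fun D (pole_kernel b).
Proof.
apply: measurable_funB; apply: measurable_funV.
  by apply: measurable_funB; [exact: measurable_id|exact: measurable_cst].
by apply: measurable_funD; [exact: measurable_id|exact: measurable_cst].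
Qed.

Lemma measurable_pole_density (D : set R) c : measurable_fun D (pole_density c).
Proof.
apply: measurable_funD; apply: measurable_funV.
  by apply: measurable_funB; [exact: measurable_cst|exact: measurable_id].
by apply: measurable_funD; [exact: measurable_cst|exact: measurable_id].
Qed.

Lemma measurable_escape gam (E : set R) : measurable E -> measurable (escape gam E).
Proof.
move=> mE.
have mg := measurable_divl gam.
have mf : measurable_fun [set: R] (fun y => `|fold2 (gam / y)|).
  exact: measurableT_comp measurable_absfold2 mg.
rewrite (_ : escape gam E = `]0, +oo[ `&` ((fun y => gam / y) @^-1` `]1, +oo[ `&`
    (fun y => `|fold2 (gam / y)|) @^-1` E)); last first.
  apply/seteqP; split => y /=; first by case=> *; rewrite !in_itv/= !andbT.
  by rewrite !in_itv/= !andbT => -[? []].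
apply: measurableI; first exact: measurable_itv.
apply: measurableI.
  by have := mg measurableT _ (measurable_itv `](1 : R), +oo[); rewrite setTI.
by have := mf measurableT _ mE; rewrite setTI.
Qed.

Lemma escape_itv gam (E : set R) : 0 < gam <= 1 -> escape gam E `<=` `]0, 1[.
Proof.
move=> /andP[g0 g1] y [y0 + _]; rewrite /= in_itv/= y0/=.
by rewrite ltr_pdivlMr// mul1r => /lt_le_trans ->.
Qed.

Lemma pole_kernel_ge0 b x : 0 < b < 1 -> 1 <= x -> 0 <= pole_kernel b x.
Proof. by move=> b01 x1; rewrite subr_ge0 lef_pV2 ?posrE; lra. Qed.

(** The left-hand side equals [pole_kernel (gam * c^-1) x], and the kernel increases with its
    parameter: gam <= 1 gives the comparison. *)
Lemma pole_density_inv gam c x : 0 < gam <= 1 -> 1 < c -> 1 < x ->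
  pole_density c (gam / x) * (gam / x ^+ 2) <= pole_kernel c^-1 x.
Proof.
move=> /andP[g0 g1] c1 x1; rewrite -[c in pole_density c]invrK.
have : 0 < c^-1 by rewrite invr_gt0; lra.
have : c^-1 < 1 by rewrite invf_lt1//; lra.
move: (c^-1) => b b1 b0.
have gb : 0 < gam * b by rewrite mulr_gt0.
have gbb : gam * b <= b by rewrite ler_piMl// ltW.
have -> : pole_density b^-1 (gam / x) * (gam / x ^+ 2) = pole_kernel (gam * b) x.
  rewrite /pole_density /pole_kernel; field.
  by apply/and4P; split; apply: lt0r_neq0; lra.
by rewrite lerB// lef_pV2 ?posrE; lra.
Qed.

(** Under x = gam / y the escape set becomes the part beyond 1 of the periodization of [E] and [-E].
    It is cut into the disjoint sets 2 (k + 1) + E and 2 (k + 1) - E, all are pulled back to [E],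
    and the resulting sum is bounded pointwise by [pole_sum_le]. *)
Lemma pole_density_escape gam n (E : set R) : 0 < gam <= 1 ->
  measurable E -> E `<=` `]0, 1[ ->
  (\int[leb]_(y in escape gam E) (pole_density (pole R n) y)%:E
     + (loss R n)%:E * leb E <= \int[leb]_(y in E) (pole_density (pole R n.+1) y)%:E)%E.
Proof.
move=> /andP[g0 g1] mE E01.
set c := pole R n; have c1 : 1 < c := pole_gt1 R n.
have b0 : 0 < c^-1 by rewrite invr_gt0; lra.
have b1 : c^-1 < 1 by rewrite invf_lt1//; lra.
pose A := [set x : R | 1 < x /\ E `|fold2 x|].
have mA : measurable A.
  rewrite (_ : A = `]1, +oo[ `&` (fun x : R => `|fold2 x|) @^-1` E); last first.
    by apply/seteqP; split => x []; rewrite /= in_itv/= andbT.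
  apply: measurableI; first exact: measurable_itv.
  by have := measurable_absfold2 measurableT mE; rewrite setTI.
(* The substitution asks for a continuous nonnegative integrand on the whole half-line, but the
   density has a pole at c. It is frozen beyond 1, which changes nothing on the escape set,
   contained in (0, 1). *)
pose phi y := pole_density c (Num.min y 1).
have mphi : measurable_fun [set: R] phi.
  have mm : measurable_fun [set: R] (fun y : R => Num.min y 1).
    by apply: measurable_minr; [exact: measurable_id|exact: measurable_cst].
  have md : measurable_fun [set: R] (pole_density c) := measurable_pole_density (D := setT) c.
  exact: (measurableT_comp md mm).
have cphi : {in `]0, +oo[, continuous phi}.
  move=> y; rewrite in_itv/= andbT => y0.
  have cmin : {for y, continuous (fun y : R => Num.min y 1)}.
    by apply: (@continuous_min R R id (cst 1)); [exact: cvg_id|exact: cvg_cst].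
  have min1 : Num.min y 1 <= 1 by rewrite ge_min lexx orbT.
  have min0 : 0 < Num.min y 1 by rewrite lt_min y0 ltr01.
  apply: (@continuousD R R R (fun y => (c - Num.min y 1)^-1) (fun y => (c + Num.min y 1)^-1) y).
    apply: (@continuousV R R (fun y => c - Num.min y 1) y); first by rewrite gt_eqF//; lra.
    by apply: (@continuousB R R R (cst c) (fun y => Num.min y 1) y) => //; exact: cvg_cst.
  apply: (@continuousV R R (fun y => c + Num.min y 1) y); first by rewrite gt_eqF//; lra.
  by apply: (@continuousD R R R (cst c) (fun y => Num.min y 1) y) => //; exact: cvg_cst.
have phi0 : {in `]0, +oo[, forall y, 0 <= phi y}.
  move=> y; rewrite in_itv/= andbT => y0; rewrite /phi /pole_density.
  have : Num.min y 1 <= 1 by rewrite ge_min lexx orbT.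
  have : 0 < Num.min y 1 by rewrite lt_min y0 ltr01.
  by move=> *; rewrite addr_ge0// invr_ge0; lra.
have -> : (\int[leb]_(y in escape gam E) (pole_density c y)%:E =
    \int[leb]_(y in [set y | (0 < y)%R /\ A (gam / y)%R]) (phi y)%:E)%E.
  transitivity (\int[leb]_(y in escape gam E) (phi y)%:E)%E.
    apply: eq_integral => y; rewrite inE => /(@escape_itv gam _ _ y); rewrite g0 g1 => /(_ isT).
    by rewrite /= in_itv/= /phi => /andP[_ y1]; rewrite min_l// ltW.
  congr (integral _ _ _); apply/seteqP; split=> y; first by case.
  by case=> ? [].
rewrite inv_substitution//.
have -> : [set x : R | 0 < x /\ A x] = A.
  by apply/seteqP; split=> [x []//|x [x1 Ex]]; split => //=; lra.
have A1 : A `<=` `]1, +oo[ by move=> x [x1 _]; rewrite /= in_itv/= x1.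
have mK : measurable_fun A (EFin \o pole_kernel c^-1).
  by apply/measurable_EFinP; exact: measurable_pole_kernel.
have K0 x : 1 <= x -> 0 <= pole_kernel c^-1 x.
  by apply: pole_kernel_ge0; rewrite b0 b1.
apply: (@le_trans _ _ (\int[leb]_(x in A) (pole_kernel c^-1 x)%:E + (loss R n)%:E * leb E)%E).
  apply: leeD2r; apply: ge0_le_integral => //.
  - move=> x /A1; rewrite /= in_itv/= andbT => x1; rewrite lee_fin.
    rewrite mulr_ge0 ?phi0 ?divr_ge0 ?exprn_ge0 ?(ltW g0)//; last by lra.
    by rewrite in_itv/= andbT divr_gt0//; lra.
  - apply/measurable_EFinP; apply: measurable_funM.
      exact: measurable_funTS (measurableT_comp mphi (measurable_divl gam)).
    apply: measurable_funM; first exact: measurable_cst.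
    by apply: measurable_funV; exact: exprn_measurable.
  - move=> x /A1; rewrite /= in_itv/= andbT => x1; rewrite lee_fin /phi.
    have gx1 : gam / x < 1 by rewrite ltr_pdivrMr; lra.
    by rewrite (min_l (ltW gx1)); apply: pole_density_inv; rewrite ?g0.
pose F (k : nat) := [set x : R | E (x - 2 * k.+1%:R) \/ E (2 * k.+1%:R - x)].
pose K k t := pole_kernel c^-1 (2 * k.+1%:R + t) + pole_kernel c^-1 (2 * k.+1%:R - t).
have F1 k x : F k x -> 2 * k.+1%:R - 1 < x < 2 * k.+1%:R + 1.
  by case=> /E01; rewrite /= in_itv/=; lra.
have k1 k : 1 <= k.+1%:R :> R by rewrite ler1n.
have AF : A = \bigcup_k F k.
  apply/seteqP; split => [x [x1 /(absfold2P E01 x1)[k Ek]]|x [k _ Fx]].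
    by exists k.
  have x1 : 1 < x by have := F1 _ _ Fx; have := k1 k; lra.
  by split=> //; apply/(absfold2P E01 x1); exists k.
have mF1 k : measurable [set x : R | E (x - 2 * k.+1%:R)].
  have : measurable_fun [set: R] (fun x => x - 2 * k.+1%:R).
    by apply: measurable_funB; [exact: measurable_id|exact: measurable_cst].
  by move=> /(_ measurableT _ mE); rewrite setTI.
have mF2 k : measurable [set x : R | E (2 * k.+1%:R - x)].
  have : measurable_fun [set: R] (fun x => 2 * k.+1%:R - x).
    by apply: measurable_funB; [exact: measurable_cst|exact: measurable_id].
  by move=> /(_ measurableT _ mE); rewrite setTI.
have mF k : measurable (F k).
  by have := measurableU _ _ (mF1 k) (mF2 k).
have mKp k : measurable_fun E (fun t => (pole_kernel c^-1 (2 * k.+1%:R + t))%:E).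
  apply/measurable_EFinP; apply: measurableT_comp; first exact: measurable_pole_kernel.
  by apply: measurable_funD; [exact: measurable_cst|exact: measurable_id].
have mKm k : measurable_fun E (fun t => (pole_kernel c^-1 (2 * k.+1%:R - t))%:E).
  apply/measurable_EFinP; apply: measurableT_comp; first exact: measurable_pole_kernel.
  by apply: measurable_funB; [exact: measurable_cst|exact: measurable_id].
have Kp0 k t : E t -> 0 <= pole_kernel c^-1 (2 * k.+1%:R + t).
  by move=> /E01; rewrite /= in_itv/= => t01; apply: K0; have := k1 k; lra.
have Km0 k t : E t -> 0 <= pole_kernel c^-1 (2 * k.+1%:R - t).
  by move=> /E01; rewrite /= in_itv/= => t01; apply: K0; have := k1 k; lra.
have FE k : (\int[leb]_(x in F k) (pole_kernel c^-1 x)%:E = \int[leb]_(t in E) (K k t)%:E)%E.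
  have KF x : F k x -> (0 <= (pole_kernel c^-1 x)%:E)%E.
    by move=> /F1 h; rewrite lee_fin K0//; have := k1 k; lra.
  rewrite ge0_integral_setU//=; last 2 first.
  - by apply/measurable_EFinP; exact: measurable_pole_kernel.
  - apply/disj_setPS => x [/=] /E01 + /E01; rewrite /= !in_itv/=; lra.
  have mKS (B : set R) : measurable_fun B (fun x => (pole_kernel c^-1 x)%:E).
    by apply/measurable_EFinP; exact: measurable_pole_kernel.
  have mp : measurable_fun [set: R] (fun t => 2 * k.+1%:R + t).
    by apply: measurable_funD; [exact: measurable_cst|exact: measurable_id].
  have mm : measurable_fun [set: R] (fun t => 2 * k.+1%:R - t).
    by apply: measurable_funB; [exact: measurable_cst|exact: measurable_id].
  rewrite (ge0_integral_preserving mp (lebesgue_measure_shift _) (mF1 k) (mKS _)); last first.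
    by move=> x Ex; apply: KF; left.
  rewrite (ge0_integral_preserving mm (lebesgue_measure_reflect _) (mF2 k) (mKS _)); last first.
    by move=> x Ex; apply: KF; right.
  rewrite (_ : _ @^-1` _ = E); last first.
    by apply/seteqP; split => t; rewrite /preimage/= addrAC subrr add0r.
  rewrite (_ : _ @^-1` _ = E); last first.
    by apply/seteqP; split => t; rewrite /preimage/= subKr.
  rewrite -ge0_integralD//.
  - exact: Kp0.
  - exact: mKp.
  - exact: Km0.
  - exact: mKm.
  - exact: mF1.
  - exact: mF2.
rewrite AF ge0_integral_bigcup//; last 3 first.
- by rewrite -AF.
- by rewrite -AF => x /A1; rewrite /= in_itv/= andbT => /ltW x1; rewrite lee_fin K0.
- have Fle i j x : F i x -> F j x -> (i <= j)%N.
    by move=> /F1 hi /F1 hj; rewrite -2!ltnS -(ltr_nat R) -(natr1 j.+1); lra.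
  move=> i j _ _ [x [Fi Fj]]; apply/eqP.
  by rewrite eqn_leq (Fle _ _ _ Fi Fj) (Fle _ _ _ Fj Fi).
under eq_eseriesr do rewrite FE.
have pl t : E t -> 0 <= pole_density (pole R n.+1) t - loss R n.
  move=> /E01; rewrite /= in_itv/= => t01.
  by have := pole_sum_le n 0 t01; rewrite big_ord0 add0r subr_ge0.
have mpole : measurable_fun E (pole_density (pole R n.+1)) by exact: measurable_pole_density.
have mKk k : measurable_fun E (fun t => (K k t)%:E).
  by have := emeasurable_funD (mKp k) (mKm k).
have K0' k t : E t -> 0 <= K k t by move=> Et; apply: addr_ge0; [exact: Kp0|exact: Km0].
(* The loss is subtracted inside the integrand, which [pl] keeps nonnegative; the series is then the
   limit of partial sums, each bounded by [pole_sum_le]. *)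
apply: (@le_trans _ _ (\int[leb]_(y in E) (pole_density (pole R n.+1) y - loss R n)%R%:E
   + (loss R n)%:E * leb E)%E).
  apply: leeD2r; apply: lime_le.
    by apply: is_cvg_nneseries => k _ _; apply: integral_ge0 => t Et; rewrite lee_fin K0'.
  apply: nearW => J; rewrite big_mkord -ge0_integral_sum//=; last 2 first.
  - by move=> k; exact: mKk.
  - by move=> k t Et; rewrite lee_fin K0'.
  apply: ge0_le_integral => //.
  - by move=> t Et; apply: sume_ge0 => k _; rewrite lee_fin K0'.
  - by apply: emeasurable_sum => k; exact: mKk.
  - by apply/measurable_EFinP; apply: measurable_funB => //; exact: measurable_cst.
  - move=> t /E01; rewrite /= in_itv/= => t01.
    by rewrite sumEFin lee_fin lerBrDr pole_sum_le.
rewrite -integral_cst// -ge0_integralD//.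
- by rewrite le_eqVlt; apply/orP; left; apply/eqP/eq_integral => y _; rewrite /= -EFinD subrK.
- by apply/measurable_EFinP; apply: measurable_funB => //; exact: measurable_cst.
- by move=> t _; rewrite lee_fin ltW// loss_gt0.
Qed.

End escape_inequality.

(** * Absolute continuity and the fold inequality *)

Section absolutely_continuous_bound.
Context d (T : measurableType d) (R : realType).
Local Notation leb := (@lebesgue_measure R).

(** A substitute for a bounded density, with [C] depending on [e]. If [leb E] is below the delta
    belonging to [e], the term [e] suffices; otherwise the total mass is at most (total mass /
    delta) times [leb E]. *)
Lemma absolutely_continuous_bound (rho : {finite_measure set T -> \bar R}) (Z : T -> R) :
  measurable_fun setT Z ->
  (forall N : set R, measurable N -> leb N = 0%E -> rho (Z @^-1` N) = 0%E) ->
  forall e : R, 0 < e -> exists C : R, 0 <= C /\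
    forall E : set R, measurable E -> E `<=` `]0, 1[ ->
      fine (rho (Z @^-1` E)) <= C * fine (leb E) + e.
Proof.
move=> mZ ac e e0.
have mpre (B : set R) : measurable B -> measurable (Z @^-1` B).
  by move=> mB; have := mZ measurableT _ mB; rewrite setTI.
have mZ' : @measurable_fun _ _ T (measurableTypeR R) setT Z := mZ.
pose nu : {charge set (measurableTypeR R) -> \bar R} :=
  measure_function_pushforward__canonical__charge_Charge (charge_of_finite_measure rho) mZ'.
have [P [N PN]] := Hahn_decomposition nu.
have numu : nu `<< leb.
  by apply/null_content_dominatesP => A mA lA; exact: ac.
have [dl [d0 dP]] := charge_variation_continuous PN numu e0.
exists (fine (rho setT) / dl); split.
  by rewrite divr_ge0 ?fine_ge0 ?(ltW d0).
move=> E mE E01.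
have mpE := mpre _ mE.
have rE : rho (Z @^-1` E) \is a fin_num by exact: fin_num_measure.
have rT : rho setT \is a fin_num by exact: fin_num_measure.
have lE : leb E \is a fin_num.
  rewrite ge0_fin_numE//; apply: (@le_lt_trans _ _ (leb `]0%R, 1%R[)).
    by apply: le_measure; rewrite ?inE//; exact: measurable_itv.
  by rewrite lebesgue_measure_itv/= lte_fin ltr01 -EFinB ltry.
have [lt|ge] := ltP (leb E) dl%:E.
  have : (rho (Z @^-1` E) < e%:E)%E.
    apply: le_lt_trans (dP _ mE lt); apply: le_trans (abse_charge_variation PN mE).
    by rewrite gee0_abs//; exact: measure_ge0.
  rewrite -{1}(fineK rE) lte_fin => /ltW/le_trans; apply; rewrite lerDr.
  by rewrite mulr_ge0 ?divr_ge0 ?fine_ge0// ltW.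
rewrite (@le_trans _ _ (fine (rho setT)))//.
  by rewrite fine_le// le_measure ?inE.
rewrite ler_wpDr ?(ltW e0)// mulrAC ler_pdivlMr// ler_wpM2l ?fine_ge0//.
by rewrite -lee_fin fineK.
Qed.

End absolutely_continuous_bound.

Section fold_escape.
Context d (T : measurableType d) (R : realType).
Variables (p n : {finite_measure set T -> \bar R}) (X : T -> R).
Hypothesis mX : measurable_fun setT X.
Hypothesis moments : forall m : int,
  same_integral p n (fun x => cos (wave X m x)) /\
  same_integral p n (fun x => sin (wave X m x)).
Variable Q : set R.
Hypotheses (mQ : measurable Q) (nQ : n (X @^-1` Q) = 0%E)
  (pQ : p (X @^-1` ~` Q) = 0%E).

Let mpre (B : set R) : measurable B -> measurable (X @^-1` B).
Proof. by move=> mB; have := mX measurableT mB; rewrite setTI. Qed.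

Definition fold_outside (E : set R) : set R := [set x | 1 < `|x| /\ E (fold2 x)].

Lemma measurable_fold_outside E : measurable E -> measurable (fold_outside E).
Proof.
move=> mE; apply: measurableI; last first.
  by have := @measurable_fold2 R measurableT _ mE; rewrite setTI.
rewrite (_ : (fun x => _) = (@Num.norm R R) @^-1` `]1, +oo[).
  have := @normr_measurable R setT measurableT _ (measurable_itv `]1, +oo[).
  by rewrite setTI.
by apply/seteqP; split=> x /=; rewrite in_itv/= andbT.
Qed.

(* X^-1(E `&` Q) does not charge n, so its p-mass equals the n-mass of the rest of its
   periodization. *)
Lemma fold_escape (E : set R) : measurable E -> E `<=` `]-1, 1[ ->
  (p (X @^-1` E) + n (X @^-1` E) <=
   p (X @^-1` fold_outside E) + n (X @^-1` fold_outside E))%E.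
Proof.
move=> mE E1.
have le_pre (a : {finite_measure set T -> \bar R}) (B C : set R) : measurable B ->
    measurable C -> B `<=` C -> (a (X @^-1` B) <= a (X @^-1` C))%E.
  move=> mB mC BC; apply: le_measure; rewrite ?inE; [exact: mpre|exact: mpre|].
  by move=> x; exact: BC.
have split_period (B : set R) : B `<=` `]-1, 1[ ->
    [set x | B (fold2 (X x))] `<=` (X @^-1` B) `|` (X @^-1` fold_outside B).
  move=> B1 x /= Bx; have [x1|x1] := ltP 1 `|X x|; first by right.
  left; have := B1 _ Bx; rewrite /= in_itv/= => /andP[f1 f2].
  suff h : -1 <= X x < 1 by rewrite fold2_id in Bx.
  move: x1; rewrite ler_norml => /andP[-> h]; rewrite lt_neqAle h andbT/=.
  (* The value 1 has to be excluded since it folds to -1; this is possible because [B] avoids -1. *)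
  apply/eqP => X1; move: f1; rewrite X1 -(fold2D 1 (-1)).
  by rewrite (_ : 1 + _ = -1 :> R) ?fold2_id ?ltxx//; lra.
have sub_period (B : set R) : B `<=` `]-1, 1[ ->
    X @^-1` B `<=` [set x | B (fold2 (X x))].
  move=> B1 x /= Bx; have := B1 _ Bx; rewrite /= in_itv/= => /andP[h1 h2].
  by rewrite fold2_id// (ltW h1).
have mper (B : set R) : measurable B -> measurable [set x | B (fold2 (X x))].
  move=> mB; have := measurableT_comp (@measurable_fold2 R) mX measurableT mB.
  by rewrite setTI.
have half (a b : {finite_measure set T -> \bar R}) (B : set R) : measurable B -> B `<=` E ->
    a [set x | B (fold2 (X x))] = b [set x | B (fold2 (X x))] -> b (X @^-1` B) = 0%E ->
    (a (X @^-1` B) <= b (X @^-1` fold_outside B))%E.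
  move=> mB BE ab bB; have B1 := subset_trans BE E1.
  apply: (@le_trans _ _ (a [set x | B (fold2 (X x))])).
    by apply: le_measure; rewrite ?inE//; [exact: mpre|exact: mper|exact: sub_period].
  rewrite ab (@le_trans _ _ (b ((X @^-1` B) `|` (X @^-1` fold_outside B))))//.
    apply: le_measure; rewrite ?inE//; [exact: mper| |exact: split_period].
    by apply: measurableU; apply: mpre => //; exact: measurable_fold_outside.
  rewrite -[leRHS]add0e -[X in (_ <= X + _)%E]bB; apply: measureU2 => //.
    exact: mpre.
  by apply: mpre; exact: measurable_fold_outside.
have mEQ : measurable (E `&` Q) by exact: measurableI.
have mEQc : measurable (E `&` ~` Q) by apply: measurableI => //; exact: measurableC.
have null0 (a : {finite_measure set T -> \bar R}) (B C : set R) : measurable B -> measurable C ->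
    C `<=` B -> a (X @^-1` B) = 0%E -> a (X @^-1` C) = 0%E.
  move=> mB mC CB aB; apply/eqP; rewrite eq_le measure_ge0 andbT -aB.
  exact: le_pre.
have same (B : set R) : measurable B ->
    p [set x | B (fold2 (X x))] = n [set x | B (fold2 (X x))].
  exact: measure_fold2_unique.
have bound (a b : {finite_measure set T -> \bar R}) (B C : set R) : measurable B -> measurable C ->
    E `<=` B `|` C -> B `<=` E -> C `<=` E -> a (X @^-1` C) = 0%E -> b (X @^-1` B) = 0%E ->
    a [set x | B (fold2 (X x))] = b [set x | B (fold2 (X x))] ->
    (a (X @^-1` E) <= b (X @^-1` fold_outside E))%E.
  move=> mB mC EBC BE CE aC bB ab.
  apply: (@le_trans _ _ (a (X @^-1` B))).
    rewrite -[leRHS]adde0 -[X in (_ <= _ + X)%E]aC.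
    apply: (@le_trans _ _ (a ((X @^-1` B) `|` (X @^-1` C)))).
      by apply: le_pre EBC => //; exact: measurableU.
    by apply: measureU2; exact: mpre.
  apply: (le_trans (half _ _ _ mB BE ab bB)); apply: le_pre.
  - exact: measurable_fold_outside.
  - exact: measurable_fold_outside.
  - by move=> x [h1 h2]; split => //; exact: BE.
have EU : E `<=` (E `&` Q) `|` (E `&` ~` Q) by rewrite -setIUr setUv setIT.
rewrite addeC; apply: leeD.
  apply: (bound n p (E `&` ~` Q) (E `&` Q)) => //; rewrite 1?setUC//.
  - by apply: null0 nQ => // x [].
  - by apply: (null0 _ _ _ (measurableC mQ) mEQc _ pQ) => x [].
  - by rewrite same.
apply: (bound p n (E `&` Q) (E `&` ~` Q)) => //.
- by apply: (null0 _ _ _ (measurableC mQ) mEQc _ pQ) => x [].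
- by apply: null0 nQ => // x [].
- exact: same.
Qed.

End fold_escape.

(** * Sub-invariant absolutely continuous set functions vanish *)

Section escape_subinvariant.
Context (R : realType).
Local Notation leb := (@lebesgue_measure R).
Local Notation mass n E := (fine (\int[leb]_(y in E) (pole_density (pole R n) y)%:E)).

Lemma unit_lebesgue_fin_num (E : set R) : measurable E -> E `<=` `]0, 1[ ->
  leb E \is a fin_num.
Proof.
move=> mE E01; rewrite ge0_fin_numE//; apply: (@le_lt_trans _ _ (leb `]0%R, 1%R[)).
  by apply: le_measure; rewrite ?inE//; exact: measurable_itv.
by rewrite lebesgue_measure_itv/= lte_fin ltr01 -EFinB ltry.
Qed.

Lemma pole_density_ge0 n (y : R) : 0 < y < 1 -> 0 <= pole_density (pole R n) y.
Proof.
have := pole_gt1 R n => p1 y01.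
by rewrite /pole_density addr_ge0// invr_ge0; lra.
Qed.

(** For r < 1 the bound stays below 1 / (1 - r) + 1 for all n, since the poles exceed 1; for r = 1
    it only yields finiteness. *)
Lemma pole_mass_le n (r : R) (E : set R) : r <= 1 -> measurable E -> E `<=` `]0, r[ ->
  (\int[leb]_(y in E) (pole_density (pole R n) y)%:E <= ((pole R n - r)^-1 + 1)%:E)%E.
Proof.
move=> r1 mE Er; have p1 := pole_gt1 R n.
have E01 : E `<=` `]0, 1[.
  by move=> y /Er; rewrite /= !in_itv/= => /andP[-> yr]; exact: lt_le_trans r1.
apply: (@le_trans _ _ (\int[leb]_(y in E) cst ((pole R n - r)^-1 + 1)%:E y)%E).
  apply: ge0_le_integral => //.
  - by move=> y /E01; rewrite /= in_itv/= => y01; rewrite lee_fin pole_density_ge0.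
  - by apply/measurable_EFinP; exact: measurable_pole_density.
  - move=> y /Er; rewrite /= in_itv/= => /andP[y0 yr]; rewrite lee_fin lerD//.
      by rewrite lef_pV2 ?posrE; lra.
    by rewrite invf_le1; lra.
have c0 : 0 <= (pole R n - r)^-1 + 1 by rewrite addr_ge0// invr_ge0; lra.
rewrite integral_cst// -[leRHS]mule1; apply: lee_pmul => //.
apply: (@le_trans _ _ (leb `]0%R, 1%R[)).
  by apply: le_measure; rewrite ?inE//; exact: measurable_itv.
by rewrite lebesgue_measure_itv/= lte_fin ltr01 -EFinB subr0.
Qed.

Lemma pole_mass_fin_num n (E : set R) : measurable E -> E `<=` `]0, 1[ ->
  (\int[leb]_(y in E) (pole_density (pole R n) y)%:E)%E \is a fin_num.
Proof.
move=> mE E01; rewrite ge0_fin_numE; last first.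
  apply: integral_ge0 => y /E01; rewrite /= in_itv/= => y01.
  by rewrite lee_fin pole_density_ge0.
exact: le_lt_trans (pole_mass_le n (lexx 1) mE E01) (ltry _).
Qed.

Definition total_loss (N : nat) : R := \sum_(k < N) loss R k.

(** Ten times the losses form the harmonic series without its first term, so a bound would make that
    series converge. *)
Lemma total_loss_unbounded (B : R) : exists N, B < total_loss N.
Proof.
apply: contrapT => h; apply: (@dvg_harmonic R).
have sE N : series harmonic N.+1 = 1 + 10 * total_loss N.
  rewrite /series/= big_mkord big_ord_recl/= invr1; congr (_ + _).
  rewrite /total_loss big_distrr/=; apply: eq_bigr => k _.
  rewrite /loss invfM mulrA divff ?mul1r//.
apply: nondecreasing_is_cvgn.
  by apply: nondecreasing_series => k _ _; rewrite ltW// harmonic_gt0.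
exists (1 + 10 * B) => _ [N _ <-].
rewrite (@le_trans _ _ (series harmonic N.+1))//.
  rewrite /series/= !big_mkord big_ord_recr/= lerDl invr_ge0//.
rewrite sE lerD2l ler_pM2l// leNgt; apply/negP => hB; apply: h.
by exists N.
Qed.

Variables (gam : R) (w : set R -> R).
Hypothesis gam01 : 0 < gam <= 1.
Hypothesis w_escape : forall E : set R, measurable E -> E `<=` `]0, 1[ -> w E <= w (escape gam E).
Hypothesis w_sub : forall A B : set R, measurable A -> measurable B -> w (A `|` B) <= w A + w B.
Hypothesis w_ac : forall e : R, 0 < e -> exists C : R, 0 <= C /\
  forall E : set R, measurable E -> E `<=` `]0, 1[ -> w E <= C * fine (leb E) + e.

Let mass_escape n (E : set R) : measurable E -> E `<=` `]0, 1[ ->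
  mass n (escape gam E) + loss R n * fine (leb E) <= mass n.+1 E.
Proof.
move=> mE E01; have := pole_density_escape n gam01 mE E01.
have f1 := pole_mass_fin_num n (measurable_escape gam mE) (escape_itv gam01).
have f2 := pole_mass_fin_num n.+1 mE E01.
have f3 := unit_lebesgue_fin_num mE E01.
by rewrite -(fineK f1) -(fineK f2) -{1}(fineK f3) -EFinM -EFinD lee_fin.
Qed.

(** In the inductive step the weight [total_loss N] is carried to [escape gam E] by sub-invariance,
    while the new weight [loss R N] is paid for by the bound C leb + e. The cost C times [loss R N]
    times [leb E] is what [mass_escape] gains. *)
Let iterate_bound (C e : R) (N : nat) : 0 <= C -> 0 < e ->
  (forall E : set R, measurable E -> E `<=` `]0, 1[ -> w E <= C * fine (leb E) + e) ->
  forall E : set R, measurable E -> E `<=` `]0, 1[ ->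
  total_loss N * w E <= C * mass N E + total_loss N * e.
Proof.
move=> C0 e0 Ce; elim: N => [|N ih] E mE E01.
  rewrite /total_loss big_ord0 !mul0r addr0 mulr_ge0// fine_ge0// integral_ge0//.
  by move=> y /E01; rewrite /= in_itv/= => y01; rewrite lee_fin pole_density_ge0.
have H0 : 0 <= total_loss N by apply: sumr_ge0 => k _; exact/ltW/loss_gt0.
have L0 := loss_gt0 R N.
have -> : total_loss N.+1 = total_loss N + loss R N by rewrite /total_loss big_ord_recr.
have h1 := ih _ (measurable_escape gam mE) (escape_itv gam01).
have h2 := ler_wpM2l H0 (w_escape mE E01).
have h3 := ler_wpM2l C0 (mass_escape N mE E01).
have h4 := ler_wpM2l (ltW L0) (Ce _ mE E01).
nra.
Qed.

(** On ]0, r[ the masses are bounded independently of N while the total loss is not, so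
    [iterate_bound] would fail for large N if w exceeded [e]. *)
Let w_inner (r e : R) : 0 < r < 1 -> 0 < e -> w `]0, r[ <= e.
Proof.
move=> /andP[r0 r1] e0; have [C [C0 Ce]] := w_ac e0.
rewrite leNgt; apply/negP => we.
have mE : measurable (`]0, r[ : set R) := measurable_itv _.
have E01 : (`]0, r[ : set R) `<=` `]0, 1[.
  by move=> y /=; rewrite !in_itv/= => /andP[-> /lt_trans ->].
have [N] := total_loss_unbounded (C * ((1 - r)^-1 + 1) / (w `]0, r[ - e)).
rewrite ltr_pdivrMr ?subr_gt0// ltNge => /negP; apply.
have := iterate_bound N C0 e0 Ce mE E01.
have : mass N (`]0, r[ : set R) <= (1 - r)^-1 + 1.
  have p1 := pole_gt1 R N.
  rewrite -lee_fin fineK; last exact: pole_mass_fin_num.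
  apply: le_trans (pole_mass_le N (ltW r1) mE (@subset_refl _ _)) _.
  by rewrite lee_fin lerD2r lef_pV2 ?posrE; lra.
move=> /(ler_wpM2l C0) h; rewrite mulrBr; lra.
Qed.

Lemma escape_subinvariant_le0 : w `]0, 1[ <= 0.
Proof.
apply/ler_addgt0Pr => e e0; rewrite add0r.
have e3 : 0 < e / 3 by rewrite divr_gt0.
have [C [C0 Ce]] := w_ac e3.
(* The set function on [1 - dl, 1[ is controlled by absolute continuity alone, so C dl <= e / 3 is
   wanted. The [e] in the denominator allows C = 0 and forces dl < 1. *)
pose dl := e / 3 / (C + e); have Ce0 : 0 < C + e by lra.
have d0 : 0 < dl by rewrite !divr_gt0.
have d1 : dl < 1 by rewrite ltr_pdivrMr//; lra.
have r01 : 0 < 1 - dl < 1 by lra.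
have m1 : measurable (`]0, 1 - dl[ : set R) := measurable_itv _.
have m2 : measurable (`[1 - dl, 1[ : set R) := measurable_itv _.
have -> : `]0, 1[%classic = `]0, 1 - dl[%classic `|` `[1 - dl, 1[%classic :> set R.
  apply/seteqP; split => y /=; rewrite !in_itv/=.
    by move=> ?; have [?|?] := ltP y (1 - dl); [left|right]; lra.
  by case; lra.
apply: le_trans (w_sub m1 m2) _.
have h1 := w_inner r01 e3.
have h2 : w `[1 - dl, 1[ <= C * dl + e / 3.
  apply: le_trans (Ce _ m2 _) _.
    by move=> y /=; rewrite !in_itv/=; lra.
  rewrite lerD2r ler_wpM2l// lebesgue_measure_itv/= lte_fin.
  by rewrite ifT/=; lra.
have h3 : C * dl <= e / 3.
  by rewrite mulrA ler_pdivrMr//; nra.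
lra.
Qed.

End escape_subinvariant.

(** * Null sets under Lipschitz and continuously differentiable maps *)

Section lusin.
Context (R : realType).
Local Notation leb := (@lebesgue_measure R).
Implicit Types (f : R -> R) (N U : set R).

(** A cover of [N] by open intervals of lengths u k yields a cover of the image by intervals of
    length 2 L u k, each centred at the image of one point of [N] in the k-th interval. *)
Lemma lipschitz_negligible f N (L : R) : 0 <= L ->
  (forall x y, N x -> N y -> `|f x - f y| <= L * `|x - y|) ->
  leb.-negligible N -> leb.-negligible (f @` N).
Proof.
move=> L0 fL /negligible_outer_measure N0; apply/negligible_outer_measure.
apply/eqP; rewrite eq_le outer_measure_ge0 andbT; apply/lee_addgt0Pr => e e0; rewrite add0e.
(* The added 1 allows L = 0. *)
pose dl := e / (2 * L + 1); have L1 : 0 < 2 * L + 1 by lra.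
have dl0 : 0 < dl by rewrite divr_gt0.
have [F [oF NF] Fe] : exists2 F : nat -> set R, open_itv_cover N F &
    (\sum_(0 <= k <oo) wlength idfun (F k) <= dl%:E)%E.
  have : ((wlength idfun)^* N)%mu \is a fin_num by rewrite N0.
  rewrite outer_measure_open_itv_cover.
  move=> /lb_ereal_inf_adherent-/(_ _ dl0)[_/= [F]] NF <- Fe.
  exists F => //; apply/ltW; move: Fe.
  by rewrite -outer_measure_open_itv_cover N0 add0e.
have len k : exists u : R, [/\ 0 <= u, wlength idfun (F k) = u%:E &
    forall x y, F k x -> F k y -> `|x - y| <= u].
  have [[a b] /= ->] := oF k; rewrite wlength_itv/= lte_fin.
  case: ifPn => [ab|ab].
    exists (b - a); split; [lra|by []|].
    by move=> x y /=; rewrite !in_itv/= ler_norml; lra.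
  exists 0; split => // x y /=; rewrite in_itv/= => /andP[ax xb].
  by move: ab; rewrite (lt_trans ax xb).
pose u k := sval (cid (len k)).
have uP k : [/\ 0 <= u k, wlength idfun (F k) = (u k)%:E &
    forall x y, F k x -> F k y -> `|x - y| <= u k] := svalP (cid (len k)).
have hull k : exists c : R, f @` (N `&` F k) `<=` `[c - L * u k, c + L * u k].
  have [->|/set0P[m [Nm Fm]]] := eqVneq (N `&` F k) set0.
    by exists 0 => x []/= ? [].
  exists (f m) => _ [x [Nx Fx] <-] /=; rewrite in_itv/=.
  have [_ _ /(_ _ _ Fx Fm)] := uP k.
  by move=> /(ler_wpM2l L0) /(le_trans (fL _ _ Nx Nm)); rewrite ler_norml; lra.
pose c k := sval (cid (hull k)).
have cP k : f @` (N `&` F k) `<=` `[c k - L * u k, c k + L * u k] := svalP (cid (hull k)).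
pose G k : set R := `[c k - L * u k, c k + L * u k]%classic.
have fG : f @` N `<=` \bigcup_k G k.
  move=> _ [x Nx <-]; have [k _ Fx] := NF _ Nx; exists k => //.
  by apply: cP; exists x.
have GE k : leb (G k) = (2 * L * u k)%:E.
  have [u0 _ _] := uP k; have Lu : 0 <= L * u k by rewrite mulr_ge0.
  rewrite lebesgue_measure_itv/= lte_fin; case: ifPn => [_|h].
    by rewrite -EFinB; congr EFin; ring.
  by congr EFin; lra.
apply: (@le_trans _ _ (leb (\bigcup_k G k))).
  by apply: (@le_outer_measure _ _ ((wlength idfun)^*)%mu).
apply: (@le_trans _ _ (\sum_(0 <= k <oo) leb (G k))%E).
  apply: measure_sigma_subadditive => //.
    by move=> k; exact: measurable_itv.
  by apply: bigcupT_measurable => k; exact: measurable_itv.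
under eq_eseriesr => k _.
  rewrite GE EFinM; have [_ <- _] := uP k.
  over.
rewrite nneseriesZl; last by move=> k _; have [u0 -> _] := uP k; rewrite lee_fin.
apply: (@le_trans _ _ ((2 * L)%:E * dl%:E)%E).
  by rewrite lee_wpmul2l// lee_fin; lra.
by rewrite -EFinM lee_fin /dl mulrA ler_pdivrMr//; nra.
Qed.

(** Near each point the derivative is bounded, so by the mean value theorem [f] is Lipschitz with a
    natural constant on some interval with rational ends. Such data are countable and enumerated by
    [pickle]. *)
Lemma C1_negligible f N U : open U -> N `<=` U ->
  (forall t, U t -> derivable f t 1) -> (forall t, U t -> {for t, continuous (f^`())%classic}) ->
  leb.-negligible N -> leb.-negligible (f @` N).
Proof.
move=> oU NU df cf nN.
pose lip (c : (rat * rat) * nat) : Prop := forall x y,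
  ratr c.1.1 < x < ratr c.1.2 -> ratr c.1.1 < y < ratr c.1.2 ->
  `|f x - f y| <= c.2%:R * `|x - y|.
pose M (c : (rat * rat) * nat) : set R :=
  if `[< lip c >] then N `&` `]ratr c.1.1, ratr c.1.2[ else set0.
pose F k := if unpickle k is Some c then f @` M c else set0.
suff FN : f @` N `<=` \bigcup_k F k.
  apply: (negligibleS (mu := leb) FN).
  apply: negligible_bigcup => k; rewrite /F; case: unpickle => [c|]; last exact: negligible_set0.
  rewrite /M; case: asboolP => [lc|_]; last by rewrite image_set0; exact: negligible_set0.
  apply: (@lipschitz_negligible _ _ c.2%:R) => //.
    by move=> x y [_ /=] + [_ /=]; rewrite !in_itv/=; exact: lc.
  by apply: negligibleS nN => x [].
move=> _ [t Nt <-].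
have Ut := NU _ Nt.
pose K := `|(f^`())%classic t| + 1.
have [e /= e0 eP] : exists2 e : R, 0 < e & forall s, `|t - s| < e ->
    U s /\ `|(f^`())%classic s| <= K.
  have hU : \forall s \near t, U s by exact: open_nbhs_nbhs.
  have hf : \forall s \near t, `|(f^`())%classic s| <= K.
    have /cvgrPdist_le/(_ 1 ltr01) := cf _ Ut; apply: filterS => s.
    by rewrite distrC => /(le_trans (lerB_dist _ _)); rewrite lerBlDl.
  have /nbhs_ballP[e /= e0 eP] : nbhs t (U `&` [set s | `|(f^`())%classic s| <= K]).
    exact: filterI.
  by exists e => // s ts; exact: eP.
have /rat_in_itvoo[a] : t - e < t by rewrite ltrBlDr ltrDl.
have /rat_in_itvoo[b] : t < t + e by rewrite ltrDl.
rewrite !in_itv/= => /andP[b1 b2] /andP[a1 a2].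
pose m := (Num.truncn K).+1.
have inF c : lip c -> ratr c.1.1 < t < ratr c.1.2 -> (\bigcup_k F k) (f t).
  move=> lc tc; exists (pickle c); first exact: I.
  rewrite /F pickleK; exists t; last by [].
  by rewrite /M; case: asboolP.
apply: (inF ((a, b), m)); last by rewrite a2.
have Km : K <= m%:R by rewrite ltW// truncnS_gt.
have main x y : x <= y -> ratr a < x -> y < ratr b -> `|f y - f x| <= m%:R * `|y - x|.
  move=> xy ax yb.
  have inU s : x <= s <= y -> U s /\ `|(f^`())%classic s| <= K.
    by move=> sxy; apply: eP; rewrite ltr_norml; lra.
  have [||z] := @MVT_segment R f (f^`())%classic x y xy.
  - move=> s; rewrite in_itv/= => sxy; apply: DeriveDef; last by rewrite derive1E.
    by apply: df; apply: (inU _ _).1; lra.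
  - apply: derivable_within_continuous => s; rewrite in_itv/= => sxy.
    by apply: df; exact: (inU _ _).1.
  rewrite in_itv/= => /inU[_ zK] ->; rewrite normrM ler_wpM2r//.
  exact: le_trans Km.
move=> x y /= /andP[ax xb] /andP[ay yb].
have [xy|/ltW xy] := leP x y; last exact: main.
by rewrite distrC (distrC x); exact: main.
Qed.

End lusin.

Section null_preimages.
Context (R : realType).
Local Notation leb := (@lebesgue_measure R).

Lemma negligible_image_union (f g : R -> R) (N A : set R) : measurable A ->
  A `<=` f @` N `|` g @` N -> leb.-negligible (f @` N) -> leb.-negligible (g @` N) ->
  leb A = 0%E.
Proof.
move=> mA AN fN gN; apply: (negligibleP leb mA).1.
by apply: (negligibleS (mu := leb) AN); exact: negligibleU.
Qed.

Lemma null_scale (a : R) (N : set R) : a != 0 -> measurable N -> leb N = 0%E ->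
  leb [set t | N `|a * t|] = 0%E.
Proof.
move=> a0 mN N0.
have nN : leb.-negligible N by apply/negligibleP.
apply: (negligible_image_union (f := fun t => a^-1 * t) (g := fun t => - a^-1 * t) (N := N)).
- have mg : measurable_fun [set: R] (fun t => a * t).
    by apply: measurable_funM; [exact: measurable_cst|exact: measurable_id].
  have mf := measurableT_comp (@normr_measurable R setT) mg.
  by have := mf measurableT _ mN; rewrite setTI.
- move=> t /= Nt; have [at0|at0] := leP 0 (a * t).
    by left; exists `|a * t| => //; rewrite ger0_norm// mulKf.
  by right; exists `|a * t| => //; rewrite ltr0_norm// mulrN mulNr opprK mulKf.
- apply: (lipschitz_negligible (L := `|a^-1|)) => // x y _ _.
  by rewrite -mulrBr normrM.
- apply: (lipschitz_negligible (L := `|a^-1|)) => // x y _ _.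
  by rewrite -mulrBr normrM normrN.
Qed.

(** The preimage is rewritten as an image: |b / t| = s > 0 forces t = b / s or t = - b / s, and both
    maps are continuously differentiable on the open half-line. *)
Lemma null_inv (b : R) (N : set R) : b != 0 -> measurable N -> leb N = 0%E ->
  leb [set t | t != 0 /\ N `|b / t|] = 0%E.
Proof.
move=> b0 mN N0; pose N' := N `&` `]0, +oo[.
have mI : measurable (`]0, +oo[ : set R) := measurable_itv _.
have nN : leb.-negligible N' by exists N; split => // x [].
have oI : open (`]0, +oo[%classic : set R) by exact: interval_open.
have NI : N' `<=` `]0, +oo[ by move=> x [].
have C1 (c : R) : leb.-negligible ((fun t => c / t) @` N').
  apply: (C1_negligible oI NI) => // t; rewrite /= in_itv/= andbT => t0.
    by have := inv_is_derive c (lt0r_neq0 t0) => /@ex_derive.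
  exact: continuous_derive1_divl.
apply: (negligible_image_union (f := fun t => b / t) (g := fun t => - b / t) (N := N')) => //.
  have mf := measurableT_comp (@normr_measurable R setT) (measurable_divl b).
  rewrite (_ : [set t | _] = [set~ 0] `&` (fun t => `|b / t|) @^-1` N).
    apply: measurableI; first by apply: measurableC; exact: measurable_set1.
    by have := mf measurableT _ mN; rewrite setTI.
  by apply/seteqP; split => t /= [/eqP ? ?].
move=> t /= [t0 Nt].
have N't : N' `|b / t|.
  by split => //=; rewrite in_itv/= andbT normr_gt0 mulf_neq0 ?invr_eq0.
have [bt0|bt0] := leP 0 (b / t).
  by left; exists `|b / t| => //; rewrite ger0_norm// invfM invrK mulrA divff// mul1r.
right; exists `|b / t| => //; rewrite ltr0_norm// invrN mulrNN.
by rewrite invfM invrK mulrA divff// mul1r.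
Qed.

End null_preimages.

(** * Charges on the hyperbola for gam at most 1 *)

Section jordan_restriction.
Context d (T : measurableType d) (R : realType) (nu : {charge set T -> \bar R}).
Variables (P N : set T) (PN : hahn_decomposition nu P N).

Lemma jordan_pos_setI A : measurable A -> jordan_pos PN A = nu (A `&` P).
Proof. by move=> mA; rewrite jordan_posE cjordan_posE /crestr0 mem_set. Qed.

Lemma jordan_neg_setI A : measurable A -> jordan_neg PN A = (- nu (A `&` N))%E.
Proof. by move=> mA; rewrite jordan_negE cjordan_negE /crestr0 mem_set. Qed.

End jordan_restriction.

Section charge_on_hyperbola.
Context (R : realType).
Local Notation leb := (@lebesgue_measure R).
Local Notation plane := (R * R)%type.
Variables (nu : {charge set plane -> \bar R}) (alpha beta : R).
Hypotheses (alpha0 : 0 < alpha) (beta0 : 0 < beta) (ab1 : alpha * beta <= 1).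
Hypothesis nu_supp : forall A : set plane, measurable A -> A `<=` ~` hyperbola R -> nu A = 0%E.
Hypothesis nu_ac : forall (A : set plane) (N : set R), measurable A -> measurable N ->
  leb N = 0%E -> nu (A `&` fst @^-1` N) = 0%E.
Variables (P N : set plane) (PN : hahn_decomposition nu P N).

Let p : {finite_measure set plane -> \bar R} := jordan_pos PN.
Let n : {finite_measure set plane -> \bar R} := jordan_neg PN.
Let X (x : plane) : R := alpha * x.1.
Let Y (x : plane) : R := beta * x.2.

Hypothesis momentsX : forall m : int,
  same_integral p n (fun x => cos (wave X m x)) /\
  same_integral p n (fun x => sin (wave X m x)).
Hypothesis momentsY : forall m : int,
  same_integral p n (fun x => cos (wave Y m x)) /\
  same_integral p n (fun x => sin (wave Y m x)).

Let mP : measurable P. Proof. by have [[]] := PN. Qed.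
Let mN : measurable N. Proof. by have [_ []] := PN. Qed.

Let pE A : measurable A -> p A = nu (A `&` P).
Proof. exact: jordan_pos_setI. Qed.

Let nE A : measurable A -> n A = (- nu (A `&` N))%E.
Proof. exact: jordan_neg_setI. Qed.

Let gam := alpha * beta.
Let gam01 : 0 < gam <= 1. Proof. by rewrite mulr_gt0. Qed.

Let mX : measurable_fun [set: plane] X.
Proof. by apply: measurable_funM; [exact: measurable_cst|exact: measurable_fst]. Qed.

Let mY : measurable_fun [set: plane] Y.
Proof. by apply: measurable_funM; [exact: measurable_cst|exact: measurable_snd]. Qed.

Let mhyp : measurable (hyperbola R).
Proof.
have mf : measurable_fun [set: plane] (fun x => x.1 * x.2).
  by apply: measurable_funM; [exact: measurable_fst|exact: measurable_snd].
have := mf measurableT [set 1] (measurable_set1 1); rewrite setTI.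
exact.
Qed.

Let p_off : p (~` hyperbola R) = 0%E.
Proof.
rewrite pE; last exact: measurableC mhyp.
by apply: nu_supp; [apply: measurableI => //; exact: measurableC|move=> x []].
Qed.

Let n_off : n (~` hyperbola R) = 0%E.
Proof.
rewrite nE; last exact: measurableC mhyp.
suff -> : nu (~` hyperbola R `&` N) = 0%E by rewrite oppe0.
by apply: nu_supp; [apply: measurableI => //; exact: measurableC mhyp|move=> x []].
Qed.

Let le_on (a : {finite_measure set plane -> \bar R}) (A B : set plane) :
  a (~` hyperbola R) = 0%E -> measurable A -> measurable B ->
  A `&` hyperbola R `<=` B -> (a A <= a B)%E.
Proof.
move=> a0 mA mB AB; rewrite -[leRHS]adde0 -a0.
apply: (@le_trans _ _ (a (B `|` ~` hyperbola R))).
  have mBC : measurable (B `|` ~` hyperbola R).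
    by apply: measurableU => //; exact: measurableC mhyp.
  apply: le_measure; rewrite ?inE// => x Ax.
   have [h|h] := pselect (hyperbola R x); last by right.
  by left; apply: AB.
by apply: measureU2 => //; exact: measurableC mhyp.
Qed.

Let null_on (a : {finite_measure set plane -> \bar R}) (A B : set plane) :
  a (~` hyperbola R) = 0%E -> measurable A -> measurable B ->
  A `&` hyperbola R `<=` B -> a B = 0%E -> a A = 0%E.
Proof.
move=> a0 mA mB AB B0; apply/eqP; rewrite eq_le measure_ge0 andbT -B0.
exact: le_on.
Qed.

Let XY x : hyperbola R x -> X x * Y x = gam.
Proof. by rewrite /hyperbola /X /Y/= mulrACA => ->; rewrite mulr1. Qed.

Let mpre (Z : plane -> R) (B : set R) : measurable_fun [set: plane] Z ->
  measurable B -> measurable (Z @^-1` B).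
Proof. by move=> mZ mB; have := mZ measurableT _ mB; rewrite setTI. Qed.

Let pN0 : p N = 0%E.
Proof. by rewrite pE//; have [_ _ _] := PN; rewrite setIC => ->; rewrite charge0. Qed.

Let nP0 : n P = 0%E.
Proof. by rewrite nE//; have [_ _ _ ->] := PN; rewrite charge0 oppe0. Qed.

(** Stated for a pair of coordinates so that it serves both (X, Y) and (Y, X). The chart [g]
    recovers a point of the hyperbola from its value of [Z], which turns the Hahn set [P] into a set
    of reals: thus the laws of [Z] under [p] and [n] still live on disjoint sets, as [fold_escape]
    demands. *)
Let escape_half (Z W : plane -> R) (g : R -> plane) :
  measurable_fun setT Z -> measurable_fun setT W -> measurable_fun setT g ->
  (forall x, hyperbola R x -> Z x * W x = gam /\ g (Z x) = x) ->
  (forall m : int, same_integral p n (fun x => cos (wave Z m x)) /\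
     same_integral p n (fun x => sin (wave Z m x))) ->
  forall E : set R, measurable E -> E `<=` `]0, 1[ ->
  (p [set x | E `|Z x|%R] + n [set x | E `|Z x|%R] <=
   p [set x | escape gam E `|W x|%R] + n [set x | escape gam E `|W x|%R])%E.
Proof.
move=> mZ mW mg ZW momZ E mE E01.
pose Q := g @^-1` P.
have mQ : measurable Q by have := mg measurableT _ mP; rewrite setTI.
have mQ' : measurable (~` Q) by exact: measurableC mQ.
have nQ : n (Z @^-1` Q) = 0%E.
  apply: (null_on n_off _ mP) => //; first exact: mpre.
  by move=> x [/= + /ZW[_ gZ]]; rewrite /Q/= gZ.
have pQ : p (Z @^-1` ~` Q) = 0%E.
  apply: (null_on p_off _ mN) => //; first exact: mpre.
  move=> x [/= + /ZW[_ gZ]]; rewrite /Q/= gZ => Px.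
  have [_ _ PNT _] := PN; have : (P `|` N) x by rewrite PNT.
  by case.
pose E' := [set t : R | E `|t|].
have mE' : measurable E' by have := @normr_measurable R setT measurableT _ mE; rewrite setTI.
have E'1 : E' `<=` `]-1, 1[.
  by move=> t /E01; rewrite /= !in_itv/= => /andP[_]; rewrite ltr_norml.
apply: (le_trans (fold_escape mZ momZ mQ nQ pQ mE' E'1)).
have mesc : measurable [set x | escape gam E `|W x|%R].
  have mnW : measurable_fun [set: plane] (fun x => `|W x|%R) by exact: measurableT_comp.
  by apply: (mpre mnW); exact: measurable_escape.
have key : (Z @^-1` fold_outside E') `&` hyperbola R `<=` [set x | escape gam E `|W x|%R].
  move=> x [/= [Z1 EZ] /ZW[ZWx _]]; have /andP[g0 _] := gam01.
  have Z0 : Z x != 0 by rewrite -normr_gt0 (lt_trans _ Z1).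
  have WE : W x = gam / Z x by rewrite -ZWx mulrC mulKf.
  have gW : gam / `|W x| = `|Z x|.
    by rewrite WE normrM normfV (gtr0_norm g0) invfM invrK mulrA divff ?mul1r ?gt_eqF.
  split; rewrite ?gW//.
    by rewrite WE normr_gt0; apply: mulf_neq0; [exact: lt0r_neq0 g0|rewrite invr_eq0].
  have [Zp|Zn] := leP 0 (Z x); first by rewrite (ger0_norm Zp); exact: EZ.
  rewrite (ltr0_norm Zn).
  (* The fold is odd here because its value lies in [E'], which avoids -1. *)
  suff -> : `|fold2 (- Z x)| = `|fold2 (Z x)| by exact: EZ.
  have := E'1 _ EZ; rewrite /= in_itv/= => f1.
  have [k ZE] := fold2P (Z x).
  rewrite {1}ZE opprD -mulNr -intrN fold2D fold2_id ?normrN//; lra.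
have mout : measurable (Z @^-1` fold_outside E').
  by apply: mpre => //; exact: measurable_fold_outside.
by apply: leeD; apply: le_on.
Qed.

Let p_null (M : set R) : measurable M -> leb M = 0%E -> p (fst @^-1` M) = 0%E.
Proof.
move=> mM M0; rewrite pE; last by apply: mpre => //; exact: measurable_fst.
by rewrite setIC; exact: nu_ac.
Qed.

Let n_null (M : set R) : measurable M -> leb M = 0%E -> n (fst @^-1` M) = 0%E.
Proof.
move=> mM M0; rewrite nE; last by apply: mpre => //; exact: measurable_fst.
by rewrite setIC nu_ac// oppe0.
Qed.

Let absX x := `|X x|%R.
Let absY x := `|Y x|%R.

Let mabsX : measurable_fun [set: plane] absX.
Proof. exact: measurableT_comp (@normr_measurable R setT) mX. Qed.

Let mabsY : measurable_fun [set: plane] absY.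
Proof. exact: measurableT_comp (@normr_measurable R setT) mY. Qed.

Let absX_null (a : {finite_measure set plane -> \bar R}) :
  (forall M : set R, measurable M -> leb M = 0%E -> a (fst @^-1` M) = 0%E) ->
  forall M : set R, measurable M -> leb M = 0%E -> a (absX @^-1` M) = 0%E.
Proof.
move=> a_null M mM M0.
apply: (a_null [set t | M `|alpha * t|]); last by rewrite null_scale// gt_eqF.
have mg : measurable_fun [set: R] (fun t => alpha * t).
  by apply: measurable_funM; [exact: measurable_cst|exact: measurable_id].
have mf := measurableT_comp (@normr_measurable R setT) mg.
by have := mf measurableT _ mM; rewrite setTI.
Qed.

(** On the hyperbola the second coordinate is the inverse of the first, so a null set of values of
    [Y] comes from a null set of first coordinates by [null_inv]. *)
Let absY_null (a : {finite_measure set plane -> \bar R}) : a (~` hyperbola R) = 0%E ->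
  (forall M : set R, measurable M -> leb M = 0%E -> a (fst @^-1` M) = 0%E) ->
  forall M : set R, measurable M -> leb M = 0%E -> a (absY @^-1` M) = 0%E.
Proof.
move=> a0 a_null M mM M0; pose M' := [set t : R | t != 0 /\ M `|beta / t|].
have mM' : measurable M'.
  have mf := measurableT_comp (@normr_measurable R setT) (measurable_divl beta).
  rewrite (_ : M' = [set~ 0] `&` (fun t => `|beta / t|) @^-1` M).
    apply: measurableI; first by apply: measurableC; exact: measurable_set1.
    by have := mf measurableT _ mM; rewrite setTI.
  by apply/seteqP; split => t /= [/eqP ? ?].
apply: (null_on a0 (mpre mabsY mM) _ _ (a_null _ mM' _)).
- by apply: mpre => //; exact: measurable_fst.
- move=> [x1 x2] [/= Mx]; rewrite /hyperbola/= => x12.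
  have x10 : x1 != 0 by apply: contra_eq_neq x12 => ->; rewrite mul0r eq_sym oner_neq0.
  split=> //; rewrite (_ : beta / x1 = beta * x2)//.
  by congr (_ * _); rewrite -[x1^-1]mulr1 -x12 mulKf.
- by apply: null_inv => //; rewrite gt_eqF.
Qed.

Let w (E : set R) : R := fine (p (absX @^-1` E)) + fine (n (absX @^-1` E)) +
  (fine (p (absY @^-1` E)) + fine (n (absY @^-1` E))).

Let finite_fin (a : {finite_measure set plane -> \bar R}) (A : set plane) :
  measurable A -> a A \is a fin_num.
Proof. by move=> mA; exact: fin_num_measure. Qed.

Let w_escape (E : set R) : measurable E -> E `<=` `]0, 1[ -> w E <= w (escape gam E).
Proof.
move=> mE E01; have mS := measurable_escape gam mE.
have toR (Z W : plane -> R) (A B : set R) : measurable A -> measurable B ->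
    measurable_fun [set: plane] Z -> measurable_fun [set: plane] W ->
    (p (Z @^-1` A) + n (Z @^-1` A) <= p (W @^-1` B) + n (W @^-1` B))%E ->
    fine (p (Z @^-1` A)) + fine (n (Z @^-1` A)) <= fine (p (W @^-1` B)) + fine (n (W @^-1` B)).
  move=> mA mB mZ mW; have mZA := mpre mZ mA; have mWB := mpre mW mB.
  by rewrite -(fineK (finite_fin p mZA)) -(fineK (finite_fin n mZA))
    -(fineK (finite_fin p mWB)) -(fineK (finite_fin n mWB)) -!EFinD lee_fin.
rewrite /w [leLHS]addrC; apply: lerD.
  apply: toR => //.
  apply: (escape_half (g := fun t => (beta / t, beta^-1 * t)) mY mX) => //.
    apply: measurable_fun_pair; first exact: measurable_divl.
    by apply: measurable_funM; [exact: measurable_cst|exact: measurable_id].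
  move=> [x1 x2] hx; rewrite mulrC XY//; split=> //; rewrite /Y/= mulKf ?gt_eqF//.
  move: hx; rewrite /hyperbola/= => x12.
  have x20 : x2 != 0 by apply: contra_eq_neq x12 => ->; rewrite mulr0 eq_sym oner_neq0.
  by rewrite invfM mulrA divff ?gt_eqF// mul1r -[x2^-1]mul1r -x12 mulfK.
apply: toR => //.
apply: (escape_half (g := fun t => (alpha^-1 * t, alpha / t)) mX mY) => //.
  apply: measurable_fun_pair; last exact: measurable_divl.
  by apply: measurable_funM; [exact: measurable_cst|exact: measurable_id].
move=> [x1 x2] hx; rewrite XY//; split=> //; rewrite /X/= mulKf ?gt_eqF//.
move: hx; rewrite /hyperbola/= => x12.
have x10 : x1 != 0 by apply: contra_eq_neq x12 => ->; rewrite mul0r eq_sym oner_neq0.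
by rewrite invfM mulrA divff ?gt_eqF// mul1r -[x1^-1]mulr1 -x12 mulKf.
Qed.

Let w_sub (A B : set R) : measurable A -> measurable B -> w (A `|` B) <= w A + w B.
Proof.
move=> mA mB.
have sub (a : {finite_measure set plane -> \bar R}) (Z : plane -> R) :
    measurable_fun [set: plane] Z ->
    fine (a (Z @^-1` (A `|` B))) <= fine (a (Z @^-1` A)) + fine (a (Z @^-1` B)).
  move=> mZ; have mZA := mpre mZ mA; have mZB := mpre mZ mB.
  have mZAB := mpre mZ (measurableU _ _ mA mB).
  rewrite -lee_fin EFinD (fineK (finite_fin a mZA)) (fineK (finite_fin a mZB)).
  rewrite (fineK (finite_fin a mZAB)); exact: measureU2.
have := sub p _ mabsX; have := sub n _ mabsX; have := sub p _ mabsY; have := sub n _ mabsY.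
rewrite /w; lra.
Qed.

Let w_ac (e : R) : 0 < e -> exists C : R, 0 <= C /\
  forall E : set R, measurable E -> E `<=` `]0, 1[ -> w E <= C * fine (leb E) + e.
Proof.
move=> e0; have e4 : 0 < e / 4 by rewrite divr_gt0.
have [C1 [C10 h1]] := absolutely_continuous_bound mabsX (absX_null p_null) e4.
have [C2 [C20 h2]] := absolutely_continuous_bound mabsX (absX_null n_null) e4.
have [C3 [C30 h3]] := absolutely_continuous_bound mabsY (absY_null p_off p_null) e4.
have [C4 [C40 h4]] := absolutely_continuous_bound mabsY (absY_null n_off n_null) e4.
exists (C1 + C2 + C3 + C4); split; first by rewrite !addr_ge0.
move=> E mE E01; have := h1 E mE E01; have := h2 E mE E01; have := h3 E mE E01.
by have := h4 E mE E01; rewrite /w; lra.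
Qed.

(** Since |X| |Y| = gam <= 1 on the hyperbola, |X| < 1 or |Y| < 1 unless |X| = 1, and |X| = 1 is a
    null event by absolute continuity. *)
Let total_zero (a : {finite_measure set plane -> \bar R}) : a (~` hyperbola R) = 0%E ->
  (forall M : set R, measurable M -> leb M = 0%E -> a (fst @^-1` M) = 0%E) ->
  a (absX @^-1` `]0, 1[) = 0%E -> a (absY @^-1` `]0, 1[) = 0%E -> a setT = 0%E.
Proof.
move=> a0 a_null aX aY.
have m1 := mpre mabsX (measurable_itv `]0, 1[).
have m2 := mpre mabsY (measurable_itv `]0, 1[).
have m3 := mpre mabsX (measurable_set1 1).
have m12 : measurable (absX @^-1` `]0, 1[ `|` absY @^-1` `]0, 1[) by exact: measurableU.
have aX1 : a (absX @^-1` [set 1]) = 0%E.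
  exact: (absX_null a_null (measurable_set1 1) (lebesgue_measure_set1 1)).
apply: (null_on a0 measurableT (B := (absX @^-1` `]0, 1[ `|` absY @^-1` `]0, 1[)
    `|` absX @^-1` [set 1])).
- exact: measurableU.
- move=> x [_ hx]; have := XY hx; have /andP[g0 g1] := gam01 => XYx.
  have XY1 : absX x * absY x <= 1 by rewrite /absX /absY -normrM XYx gtr0_norm.
  have XY0 : 0 < absX x * absY x by rewrite /absX /absY -normrM XYx gtr0_norm.
  have aX0 : 0 < absX x.
    by rewrite /absX normr_gt0; apply/eqP => X0; move: XY0; rewrite /absX X0 normr0 mul0r ltxx.
  have aY0 : 0 < absY x by rewrite -(pmulr_rgt0 _ aX0).
  have [l1|g|e1] := ltgtP (absX x) 1; [left; left|left; right|by right].
    by rewrite /= in_itv/= aX0.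
  by rewrite /= in_itv/= aY0/=; nra.
- apply: null_set_setU => //.
  exact: null_set_setU.
Qed.

Lemma charge_on_hyperbola_eq0 A : measurable A -> nu A = 0%E.
Proof.
pose I : set R := `]0, 1[%classic.
have mI : measurable I := measurable_itv _.
have fp (a : {finite_measure set plane -> \bar R}) (B : set plane) : 0 <= fine (a B).
  by rewrite fine_ge0.
have : w I <= 0 := escape_subinvariant_le0 gam01 w_escape w_sub w_ac.
rewrite /w => w0.
have f0 (a : {finite_measure set plane -> \bar R}) (Z : plane -> R) :
    measurable_fun [set: plane] Z -> fine (a (Z @^-1` I)) = 0 -> a (Z @^-1` I) = 0%E.
  by move=> mZ h; rewrite -[LHS](fineK (finite_fin a (mpre mZ mI))) h.
have := fp p (absX @^-1` I); have := fp n (absX @^-1` I).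
have := fp p (absY @^-1` I); have := fp n (absY @^-1` I) => h1 h2 h3 h4.
have pT : p setT = 0%E.
  by apply: (total_zero p_off p_null); apply: f0 => //; lra.
have nT : n setT = 0%E.
  by apply: (total_zero n_off n_null); apply: f0 => //; lra.
move=> mA.
have zero (a : {finite_measure set plane -> \bar R}) : a setT = 0%E -> a A = 0%E.
  by move=> aT; apply/eqP; rewrite eq_le measure_ge0 andbT -aT le_measure ?inE.
rewrite (jordan_decomp PN mA) /cadd/= cscaleN1.
change (p A - n A = 0)%E.
by rewrite (zero _ pT) (zero _ nT) sube0.
Qed.

End charge_on_hyperbola.

(** * Smooth parametrization and arc length of the hyperbola *)

Section smooth_curves.
Context (R : realType).
Local Notation leb := (@lebesgue_measure R).
Local Notation plane := (R * R)%type.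
Implicit Types (U : set R) (f : R -> R) (g : R -> plane).

(** A closed form of the iterated derivatives is needed only on [U]: since [U] is open, functions
    agreeing there have the same derivatives there. *)
Lemma smooth_on_iter U f (F : nat -> R -> R) : open U ->
  (forall t, U t -> f t = F 0%N t) ->
  (forall k t, U t -> is_derive t 1 (F k) (F k.+1 t)) -> smooth_on U f.
Proof.
move=> oU f0 dF.
have fF k : forall t, U t -> (f^`(k))%classic t = F k t.
  elim: k => [|k ih] t Ut; first by rewrite derive1n0 f0.
  rewrite derive1nS derive1E (@near_eq_derive _ _ _ _ (F k)).
    by have := dF k t Ut => /@derive_val.
  by near=> s; apply: ih; near: s; exact: open_nbhs_nbhs.
move=> k t Ut; apply: (@near_eq_derivable _ _ _ (F k)).
  by near=> s; rewrite fF//; near: s; exact: open_nbhs_nbhs.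
by have := dF k t Ut => /@ex_derive.
Unshelve. all: by end_near. Qed.

Lemma smooth_on_derivable U f t : smooth_on U f -> U t -> derivable f t 1.
Proof. by move=> /(_ 0%N) + Ut => /(_ _ Ut). Qed.

Lemma smooth_on_derive1_continuous U f t : smooth_on U f -> U t ->
  {for t, continuous (f^`())%classic}.
Proof.
move=> sf Ut; have := sf 1%N t Ut; rewrite derive1n1 => /derivable1_diffP.
exact: differentiable_continuous.
Qed.

Lemma measurable_speed U g : open U -> smooth_on U (coord1 g) -> smooth_on U (coord2 g) ->
  measurable_fun U (speed g).
Proof.
move=> oU s1 s2; apply: open_continuous_measurable_fun => // t; rewrite inE => Ut.
have c1 := smooth_on_derive1_continuous s1 Ut.
have c2 := smooth_on_derive1_continuous s2 Ut.
apply: (@continuous_comp R R R (fun t => ((coord1 g)^`())%classic t ^+ 2 +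
  ((coord2 g)^`())%classic t ^+ 2) Num.sqrt t); last exact: sqrt_continuous.
apply: (@continuousD R R R (fun t => ((coord1 g)^`())%classic t ^+ 2)
  (fun t => ((coord2 g)^`())%classic t ^+ 2) t).
  by apply: (@continuous_comp R R R _ (fun x => x ^+ 2) t c1); exact: exprn_continuous.
by apply: (@continuous_comp R R R _ (fun x => x ^+ 2) t c2); exact: exprn_continuous.
Qed.

End smooth_curves.

Section hyperbola_parametrization.
Context (R : realType).
Local Notation leb := (@lebesgue_measure R).
Local Notation plane := (R * R)%type.

Definition branch_itv (i : 'I_2) : interval R :=
  if i == ord0 then `]0, +oo[ else `]-oo, 0[.

Definition branch (i : 'I_2) (t : R) : plane := (t, t^-1).

Lemma branch_itv_neq0 i t : t \in branch_itv i -> t != 0.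
Proof.
by rewrite /branch_itv; case: ifP => _; rewrite in_itv/= ?andbT => ?; [rewrite gt_eqF|rewrite lt_eqF].
Qed.

Lemma open_neq0 : open [set t : R | t != 0].
Proof.
rewrite (_ : [set t : R | _] = ~` [set 0]); last first.
  by apply/seteqP; split => x /= /eqP.
by rewrite openC; exact: closed_eq.
Qed.

Lemma smooth_branch1 i : smooth_on [set t : R | t != 0] (coord1 (branch i)).
Proof.
apply: (@smooth_on_iter _ _ _ (fun k t => match k with 0 => t | 1 => 1 | _ => 0 end)) => //.
case=> [|[|k]] t _.
- exact: is_derive_id.
- exact: is_derive_cst.
- exact: is_derive_cst.
Qed.

Lemma smooth_branch2 i : smooth_on [set t : R | t != 0] (coord2 (branch i)).
Proof.
pose c (k : nat) : R := (-1) ^+ k * k`!%:R.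
apply: (@smooth_on_iter _ _ _ (fun k t => c k * (t ^+ k.+1)^-1)).
- exact: open_neq0.
- by move=> t /= t0; rewrite /coord2/= /c expr0 fact0 !mul1r expr1.
move=> k t /= t0.
have tk : t ^+ k.+1 != 0 by rewrite expf_neq0.
have dX : is_derive t 1 (fun y : R => y ^+ k.+1) (k.+1%:R * t ^+ k).
  have := @is_deriveX R R id k.+1 t 1 1 (is_derive_id t 1).
  rewrite exprfctE -[_%:A]/(_ * 1) mulr1; exact.
have dV := @is_deriveV R (fun y => y ^+ k.+1) t _ 1 tk dX.
apply: is_derive_eq.
rewrite /GRing.scale/= /c factS exprS natrM.
by rewrite !exprS; field; rewrite t0 expf_neq0.
Qed.

Lemma smooth_parametrization_branch i : smooth_parametrization (branch_itv i) (branch i).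
Proof.
split.
- have oI : open [set` branch_itv i] by rewrite /branch_itv; case: ifP => _; exact: interval_open.
  have -> : [set` branch_itv i]° = [set` branch_itv i] by exact/interior_id.
  by rewrite /branch_itv; case: ifP => _; [exists 1|exists (-1)]; rewrite /= in_itv/= ?andbT ?ltrN10.
- exists [set t : R | t != 0]; split.
  + exact: open_neq0.
  + by move=> t /=; exact: branch_itv_neq0.
  + exact: smooth_branch1.
  + exact: smooth_branch2.
- move=> t _; rewrite /speed gt_eqF// sqrtr_gt0.
  rewrite (_ : (coord1 (branch i))^`()%classic t = 1); last first.
    by rewrite derive1E; have := is_derive_id t (1 : R) => /@derive_val.
  by rewrite expr1n ltr_pwDl// sqr_ge0.
- by move=> s t _ _ /= [].
Qed.

Lemma parametrizes_branch : parametrizes (hyperbola R) branch_itv branch.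
Proof.
split => //.
- exact: smooth_parametrization_branch.
- apply/trivIsetP => i j _ _ ij; rewrite -subset0 => x [[s si <-] [t ti []]] ts _; subst t.
  move: ij si ti; rewrite /branch_itv; case: i => [[|[|//]] ?]; case: j => [[|[|//]] ?] //= _;
    by rewrite !in_itv/= ?andbT => s0 /(lt_trans s0); rewrite ltxx.
- apply/seteqP; split => [[x1 x2]|x [i _ [t ti <-]]]; rewrite /hyperbola/=; last first.
    by rewrite divff// (branch_itv_neq0 ti).
  move=> x12; have x10 : x1 != 0 by apply: contra_eq_neq x12 => ->; rewrite mul0r eq_sym oner_neq0.
  have x2E : x2 = x1^-1 by rewrite -[x1^-1]mulr1 -x12 mulKf.
  have [x1p|x1n] := ltP 0 x1.
    by exists ord0 => //; exists x1; rewrite /= ?in_itv/= ?x1p//; rewrite x2E.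
  exists ord_max => //; exists x1; rewrite /= ?in_itv/=; last by rewrite x2E.
  by rewrite lt_neqAle x10.
Qed.

(** The parameter of each branch is the first coordinate, so the domain of integration is contained
    in [N]. *)
Lemma arc_length_branch_null (N : set R) (A : set plane) : measurable N -> measurable A ->
  leb N = 0%E -> arc_length branch_itv branch (A `&` fst @^-1` N) = 0%E.
Proof.
move=> mN mA N0; rewrite /arc_length big1// => i _.
have mb : measurable_fun [set: R] (branch i).
  by apply: measurable_fun_pair; [exact: measurable_id|exact: measurable_inv].
set B := (X in (\int[_]_(t in X) _)%E).
have mI : measurable [set` branch_itv i] by exact: measurable_itv.
have mB : measurable B.
  apply: measurableI => //; have mAN : measurable (A `&` fst @^-1` N).
    apply: measurableI => //.
    by have := @measurable_fst _ _ R R measurableT _ mN; rewrite setTI.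
  by have := mb measurableT _ mAN; rewrite setTI.
have BN : B `<=` N by move=> t [_ [_]].
apply: null_set_integral => //.
  have ms := measurable_speed open_neq0 (@smooth_branch1 i) (@smooth_branch2 i).
  apply/measurable_EFinP; apply: measurable_funS ms.
    exact: open_measurable open_neq0.
  by move=> t [+ _]; exact: branch_itv_neq0.
apply/eqP; rewrite eq_le measure_ge0 andbT -N0.
by apply: le_measure; rewrite ?inE.
Qed.

End hyperbola_parametrization.

Local Open Scope complex_scope.

(** * From complex measures to charges; uniqueness for gam at most 1 *)

Section complex_measure_lemmas.
Context d (T : measurableType d) (R : realType).
Implicit Types (mu : complex_measure T R) (nu : {charge set T -> \bar R}).

Lemma measure_value_eq0 mu A : measurable A ->
  measure_value mu A = 0 <-> re_part mu A = 0%E /\ im_part mu A = 0%E.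
Proof.
move=> mA; rewrite /measure_value.
have re : re_part mu A \is a fin_num by exact: fin_num_measure.
have im : im_part mu A \is a fin_num by exact: fin_num_measure.
split => [[h1 h2]|[-> ->]]; last by [].
by rewrite -(fineK re) -(fineK im) h1 h2.
Qed.

(** A charge is not monotone, so countable subadditivity is applied to its two Jordan parts; they
    vanish on [F k] because their values there are, up to sign, values of [nu] on subsets of
    [F k]. *)
Lemma charge_null_cover nu (F : nat -> set T) A : measurable A ->
  (forall k, measurable (F k)) -> A `<=` \bigcup_k F k ->
  (forall k B, measurable B -> B `<=` F k -> nu B = 0%E) -> nu A = 0%E.
Proof.
move=> mA mF AF F0.
have [P [N PN]] := Hahn_decomposition nu.
have [[mP _] [mN _] _ _] := PN.
have null (m : {measure set T -> \bar R}) : (forall k, m (F k) = 0%E) -> m A = 0%E.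
  move=> m0; have mUF : measurable (\bigcup_k F k) by exact: bigcupT_measurable.
  apply: (negligibleP m mA).1; apply: (negligibleS (mu := m) AF).
  by apply: negligible_bigcup => k; apply: (negligibleP m (mF k)).2; exact: m0.
have p0 : jordan_pos PN A = 0%E.
  apply: null => k; rewrite [LHS](jordan_pos_setI PN (mF k)).
  by apply: (F0 k); [exact: measurableI (mF k) mP|exact: subIsetl].
have n0 : jordan_neg PN A = 0%E.
  apply: null => k; rewrite [LHS](jordan_neg_setI PN (mF k)).
  suff -> : nu (F k `&` N) = 0%E by rewrite oppe0.
  by apply: (F0 k); [exact: measurableI (mF k) mN|exact: subIsetl].
rewrite (jordan_decomp PN mA) /cadd/= cscaleN1.
by change (jordan_pos PN A - jordan_neg PN A = 0)%E; rewrite p0 n0 sube0.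
Qed.

Lemma charge_integral_opp nu f : bounded_measurable f ->
  charge_integral nu (fun x => - f x) = - charge_integral nu f.
Proof.
move=> bf; rewrite /charge_integral.
set h := proj2_sig _.
rewrite (_ : (fun x => - f x) = fun x => (-1) * f x + 0 * f x); last first.
  by apply/funext => x; ring.
by rewrite !Rintegral_linear//; ring.
Qed.

(** One vanishing transform only relates cosine integrals of one part to sine integrals of the
    other. The opposite frequency changes the sign of the sines, and the four real equations
    decouple. *)
Lemma complex_integral_expi0 mu (f : T -> R) : measurable_fun setT f ->
  complex_integral mu (fun x => expi (f x)) = 0 ->
  complex_integral mu (fun x => expi (- f x)) = 0 ->
  [/\ charge_integral (re_part mu) (fun x => cos (f x)) = 0,
      charge_integral (re_part mu) (fun x => sin (f x)) = 0,
      charge_integral (im_part mu) (fun x => cos (f x)) = 0 &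
      charge_integral (im_part mu) (fun x => sin (f x)) = 0].
Proof.
move=> mf; rewrite /complex_integral /expi/= => -[h1 h2] [].
have bs := sin_bounded_measurable mf.
have -> : (fun x => cos (- f x)) = (fun x => cos (f x)) by apply/funext => x; rewrite cosN.
have -> : (fun x => sin (- f x)) = (fun x => - sin (f x)) by apply/funext => x; rewrite sinN.
rewrite !charge_integral_opp// => h3 h4.
by split; lra.
Qed.

End complex_measure_lemmas.

Section uniqueness.
Context (R : realType).
Local Notation leb := (@lebesgue_measure R).
Local Notation plane := (R * R)%type.

(** A Lindelof argument: each point off the support lies in a box with rational corners on all of
    whose Borel subsets [mu] vanishes, and there are countably many such boxes. *)
Lemma measure_value_off_support (mu : complex_measure plane R) A :
  measurable A -> A `<=` ~` Defs.support mu -> measure_value mu A = 0.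
Proof.
move=> mA Asupp.
pose box (c : (rat * rat) * (rat * rat)) : set plane :=
  `]ratr c.1.1, ratr c.1.2[%classic `*` `]ratr c.2.1, ratr c.2.2[%classic.
pose good c := forall B : set plane, measurable B -> B `<=` box c -> measure_value mu B = 0.
pose F k := if unpickle k is Some c then (if `[< good c >] then box c else set0) else set0.
have mF k : measurable (F k).
  rewrite /F; case: unpickle => // c; case: asboolP => // _.
  by apply: measurableX; exact: measurable_itv.
have F0 k B : measurable B -> B `<=` F k -> measure_value mu B = 0.
  rewrite /F => mB; have mv0 : measure_value mu set0 = 0.
    by apply/measure_value_eq0 => //; rewrite !charge0.
  case: unpickle => [c|]; last by rewrite subset0 => ->.
  by case: asboolP => [gc|_]; [exact: gc|rewrite subset0 => ->].
have AF : A `<=` \bigcup_k F k.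
  move=> x /Asupp; rewrite /Defs.support/= => /existsNP[U] /not_implyP[oU] /not_implyP[Ux].
  move=> /forallNP hU.
  have /nbhs_ballP[e /= e0 xU] : nbhs x U by exact: open_nbhs_nbhs.
  have sep (y : R) : exists c : rat * rat, y - e < ratr c.1 < y /\ y < ratr c.2 < y + e.
    have /rat_in_itvoo[a] : y - e < y by rewrite ltrBlDr ltrDl.
    have /rat_in_itvoo[b] : y < y + e by rewrite ltrDl.
    by rewrite !in_itv /= => hb ha; exists (a, b).
  have [a [/andP[a1 a2] /andP[a3 a4]]] := sep x.1.
  have [b [/andP[b1 b2] /andP[b3 b4]]] := sep x.2.
  have inF c : good c -> box c x -> (\bigcup_k F k) x.
    move=> gc cx; exists (pickle c); first exact: I.
    by rewrite /F pickleK; case: asboolP.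
  apply: (inF (a, b)); last by split; rewrite /= in_itv/= ?a2 ?b2 ?a3 ?b3.
  move=> B mB Bbox; apply: contrapT => B0; apply: (hU B); split => // z Bz; apply: xU.
  have [/=] := Bbox z Bz; rewrite !in_itv/= => /andP[z1 z2] /andP[z3 z4].
  split; rewrite /ball/= ltr_distlC.
  - by rewrite (lt_trans a1 z1) (lt_trans z2 a4).
  - by rewrite (lt_trans b1 z3) (lt_trans z4 b4).
apply/measure_value_eq0 => //; split.
  apply: (charge_null_cover mA mF AF) => k B mB BF.
  by have /measure_value_eq0-/(_ mB)[] := F0 k B mB BF.
apply: (charge_null_cover mA mF AF) => k B mB BF.
by have /measure_value_eq0-/(_ mB)[] := F0 k B mB BF.
Qed.

Lemma lattice_cross_uniqueness (alpha beta : R) : 0 < alpha -> 0 < beta ->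
  alpha * beta <= 1 -> heisenberg_uniqueness_pair (hyperbola R) (lattice_cross alpha beta).
Proof.
move=> a0 b0 ab1; exists 2%N, (@branch_itv R), (@branch R).
split; first exact: parametrizes_branch.
move=> mu supp ac four A mA.
have off B : measurable B -> B `<=` ~` hyperbola R ->
    re_part mu B = 0%E /\ im_part mu B = 0%E.
  move=> mB Boff; apply/measure_value_eq0 => //; apply: measure_value_off_support => //.
  by move=> x Bx /supp; exact: Boff.
have nul (B : set plane) (N : set R) : measurable B -> measurable N -> leb N = 0%E ->
    re_part mu (B `&` fst @^-1` N) = 0%E /\ im_part mu (B `&` fst @^-1` N) = 0%E.
  move=> mB mN N0.
  have mBN : measurable (B `&` fst @^-1` N).
    apply: measurableI => //.
    by have := @measurable_fst _ _ R R measurableT _ mN; rewrite setTI.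
  by apply/measure_value_eq0 => //; apply: ac => //; exact: arc_length_branch_null.
pose X (x : plane) : R := alpha * x.1; pose Y (x : plane) : R := beta * x.2.
have mX : measurable_fun [set: plane] X.
  by apply: measurable_funM; [exact: measurable_cst|exact: measurable_fst].
have mY : measurable_fun [set: plane] Y.
  by apply: measurable_funM; [exact: measurable_cst|exact: measurable_snd].
have momX m := @complex_integral_expi0 _ _ _ mu (wave X m) (measurable_wave mX m).
have momY m := @complex_integral_expi0 _ _ _ mu (wave Y m) (measurable_wave mY m).
have fX m : complex_integral mu (fun x => expi (wave X m x)) = 0.
  rewrite -(four (alpha * m%:~R, 0)); last by left; exists m.
  rewrite /fourier; congr (complex_integral mu _); apply/funext => x; congr expi.
  by rewrite /wave /X /dot/=; ring.
have fY m : complex_integral mu (fun x => expi (wave Y m x)) = 0.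
  rewrite -(four (0, beta * m%:~R)); last by right; exists m.
  rewrite /fourier; congr (complex_integral mu _); apply/funext => x; congr expi.
  by rewrite /wave /Y /dot/=; ring.
have waveN (Z : plane -> R) (m : int) : (fun x => - wave Z m x) = wave Z (- m).
  by apply/funext => x; rewrite /wave intrN; ring.
have fXN m : complex_integral mu (fun x => expi (- wave X m x)) = 0.
  by rewrite -(fX (- m)); congr (complex_integral mu _); apply/funext => x; rewrite -waveN.
have fYN m : complex_integral mu (fun x => expi (- wave Y m x)) = 0.
  by rewrite -(fY (- m)); congr (complex_integral mu _); apply/funext => x; rewrite -waveN.
apply/measure_value_eq0 => //; split.
- apply: (charge_on_hyperbola_eq0 a0 b0 ab1 _ _ (PN := proj2_sig (hahn_pair (re_part mu)))) => //.
  + by move=> B mB Boff; have [] := off B mB Boff.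
  + by move=> B N mB mN N0; have [] := nul B N mB mN N0.
  + by move=> m; have [h1 h2 _ _] := momX m (fX m) (fXN m); split; apply/eqP; rewrite -subr_eq0;
      apply/eqP; [exact: h1|exact: h2].
  + by move=> m; have [h1 h2 _ _] := momY m (fY m) (fYN m); split; apply/eqP; rewrite -subr_eq0;
      apply/eqP; [exact: h1|exact: h2].
- apply: (charge_on_hyperbola_eq0 a0 b0 ab1 _ _ (PN := proj2_sig (hahn_pair (im_part mu)))) => //.
  + by move=> B mB Boff; have [] := off B mB Boff.
  + by move=> B N mB mN N0; have [] := nul B N mB mN N0.
  + by move=> m; have [_ _ h1 h2] := momX m (fX m) (fXN m); split; apply/eqP; rewrite -subr_eq0;
      apply/eqP; [exact: h1|exact: h2].
  + by move=> m; have [_ _ h1 h2] := momY m (fY m) (fYN m); split; apply/eqP; rewrite -subr_eq0;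
      apply/eqP; [exact: h1|exact: h2].
Qed.

End uniqueness.

(** * Finite measures with a density; Poisson kernels *)

Section finite_density.
Local Open Scope ereal_scope.
Context d (T : measurableType d) (R : realType) (mu : {measure set T -> \bar R}).
Variable f : T -> \bar R.
Hypotheses (mf : measurable_fun setT f) (f0 : forall x, 0 <= f x)
  (f_fin : \int[mu]_x f x < +oo).

Definition finite_density : set T -> \bar R := density_measure mu f.

Let finite_density0 : finite_density set0 = 0.
Proof. by rewrite /finite_density /density_measure integral_set0. Qed.

Let finite_density_ge0 A : 0 <= finite_density A.
Proof. exact: integral_ge0. Qed.

Let finite_density_sigma_additive : semi_sigma_additive finite_density.
Proof. exact: semi_sigma_additive_nng_induced. Qed.

HB.instance Definition _ := isMeasure.Build _ _ _ finite_density
  finite_density0 finite_density_ge0 finite_density_sigma_additive.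

Let finite_density_fin : fin_num_fun finite_density.
Proof.
move=> A mA; rewrite ge0_fin_numE//; apply: le_lt_trans f_fin.
by apply: ge0_subset_integral.
Qed.

HB.instance Definition _ := @Measure_isFinite.Build _ _ _
  finite_density finite_density_fin.

Lemma finite_density_measure :
  exists nu : {finite_measure set T -> \bar R}, forall A, nu A = \int[mu]_(x in A) f x.
Proof. by exists finite_density. Qed.

End finite_density.

Section density_integral.
Context (R : realType).
Local Notation leb := (@lebesgue_measure R).

(** The Radon-Nikodym derivative of [nu] has the same integrals as [f] over all measurable sets,
    hence equals [f] almost everywhere. *)
Lemma integral_finite_density (nu : {finite_measure set (measurableTypeR R) -> \bar R})
    (f g : R -> \bar R) :
  leb.-integrable setT f -> (forall A, measurable A -> nu A = \int[leb]_(x in A) f x)%E ->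
  nu.-integrable setT g -> (\int[nu]_x g x = \int[leb]_x (g x * f x))%E.
Proof.
move=> intf nuE intg.
have numu : charge_of_finite_measure nu `<< leb.
  apply/null_content_dominatesP => A mA lA; rewrite /charge_of_finite_measure nuE//.
  apply: null_set_integral => //; apply: measurable_funTS; exact: measurable_int intf.
rewrite -(Radon_Nikodym_change_of_variables numu measurableT intg).
have intRN := Radon_Nikodym_integrable numu.
apply: ae_eq_integral => //.
- by apply: emeasurable_funM; [exact: measurable_int intg|exact: measurable_int intRN].
- by apply: emeasurable_funM; [exact: measurable_int intg|exact: measurable_int intf].
- apply: ae_eqe_mul2l; apply: integral_ae_eq => //; first exact: measurable_int intf.
  by move=> E _ mE; rewrite -Radon_Nikodym_integral//= -nuE.
Qed.

End density_integral.

Section poisson.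
Context (R : realType).
Local Notation leb := (@lebesgue_measure R).
Implicit Types (eta gam x c : R) (phi : R -> R).

(** The inversion x |-> c / x carries the tail beyond 1 to ]0, c[ without changing the integral, and
    on bounded intervals the bound [M] is enough. *)
Lemma inv_invariant_lty phi c (M : R) : 0 < c ->
  {in `]0, +oo[, continuous phi} -> {in `]0, +oo[, forall y, 0 <= phi y <= M} ->
  (forall x, 0 < x -> phi (c / x) * (c / x ^+ 2) = phi x) ->
  (\int[leb]_(x in `]0%R, +oo[) (phi x)%:E < +oo)%E.
Proof.
move=> c0 cphi phiM inv.
have phi0 : {in `]0, +oo[, forall y, 0 <= phi y} by move=> y /phiM/andP[].
have mphi := continuous_pos_measurable_fun cphi.
have mI : measurable (`]1, +oo[ : set R) := measurable_itv _.
have mI0 : measurable (`]0, +oo[ : set R) := measurable_itv _.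
have fin (a : R) : 0 < a -> (\int[leb]_(x in `]0%R, a]) (phi x)%:E < +oo)%E.
  move=> a0; apply: (@le_lt_trans _ _ (\int[leb]_(x in `]0%R, a]) cst M%:E x)%E).
    apply: ge0_le_integral => //.
    - by move=> x; rewrite /= in_itv/= => /andP[x0 _]; rewrite lee_fin phi0// in_itv/= x0.
    - apply: measurable_funS mphi => //.
      by move=> x /=; rewrite !in_itv/= => /andP[->].
    - move=> x; rewrite /= in_itv/= => /andP[x0 _]; rewrite lee_fin.
      by have /andP[] := phiM x (ltac:(by rewrite in_itv/= x0)).
  have mJ : measurable (`]0, a] : set R) := measurable_itv _.
  have lE : leb (`]0, a] : set R) = a%:E.
    by rewrite lebesgue_measure_itv/= lte_fin a0 -EFinB subr0.
  rewrite (integral_cst leb mJ) [X in (_ * X)%E](_ : _ = a%:E); last exact: lE.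
  by rewrite -EFinM ltry.
have -> : `]0, +oo[%classic = (`]0, 1] `|` `]1, +oo[)%classic :> set R.
  apply/seteqP; split => x /=; rewrite !in_itv/= !andbT.
    by move=> x0; have [?|?] := leP x 1; [left; rewrite x0|right].
  by case=> [/andP[]//|/(lt_trans ltr01)].
rewrite ge0_integral_setU//=; last 3 first.
- apply: measurable_funS mphi => // x /=; rewrite !in_itv/= !andbT.
  by case=> [/andP[]//|/(lt_trans ltr01)].
- move=> x /=; rewrite !in_itv/= !andbT => h; rewrite lee_fin phi0// in_itv/= andbT.
  by case: h => [/andP[]//|/(lt_trans ltr01)].
- by apply/disj_setPS => x /= []; rewrite !in_itv/= andbT => /andP[_ x1] /(le_lt_trans x1); rewrite ltxx.
apply: lte_add_pinfty; first exact: fin.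
have -> : (\int[leb]_(x in `]1%R, +oo[) (phi x)%:E =
    \int[leb]_(y in [set y | (0 < y)%R /\ (`]1%R, +oo[%classic : set R) (c / y)%R]) (phi y)%:E)%E.
  rewrite (inv_substitution cphi phi0 c0 mI).
  rewrite (_ : [set x | _] = `]1, +oo[%classic); last first.
    apply/seteqP; split => x /=; rewrite in_itv/= andbT; first by case.
    by move=> x1; split=> //; exact: lt_trans x1.
  apply: eq_integral => x; rewrite inE/= in_itv/= andbT => x1.
  by rewrite inv// (lt_trans _ x1).
apply: le_lt_trans (fin c c0); apply: ge0_subset_integral.
- rewrite (_ : [set y | _] = `]0, c[%classic); first exact: measurable_itv.
  apply/seteqP; split => y /=; rewrite !in_itv/= andbT.
    by case=> y0; rewrite ltr_pdivlMr// mul1r y0.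
  by move=> /andP[y0 yc]; split => //; rewrite ltr_pdivlMr// mul1r.
- exact: measurable_itv.
- by apply: measurable_funS mphi => // x /=; rewrite !in_itv/= => /andP[->].
- by move=> x; rewrite /= in_itv/= => /andP[x0 _]; rewrite lee_fin phi0// in_itv/= x0.
- move=> y [y0 /=]; rewrite !in_itv/= andbT ltr_pdivlMr// mul1r y0/=; exact: ltW.
Qed.

(** The Poisson kernel of the upper half-plane at height eta, multiplied by pi. *)
Definition poisson eta x : R := eta / (x ^+ 2 + eta ^+ 2).

Lemma poisson_den_gt0 eta x : 0 < eta -> 0 < x ^+ 2 + eta ^+ 2.
Proof. by move=> e0; rewrite ltr_wpDl ?sqr_ge0// exprn_gt0. Qed.

Lemma poisson_gt0 eta x : 0 < eta -> 0 < poisson eta x.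
Proof. by move=> e0; rewrite divr_gt0// poisson_den_gt0. Qed.

Lemma poissonN eta x : poisson eta (- x) = poisson eta x.
Proof. by rewrite /poisson sqrrN. Qed.

Lemma poisson_continuous eta : 0 < eta -> continuous (poisson eta).
Proof.
move=> e0 x; apply: (@continuousM R R (cst eta) (fun x => (x ^+ 2 + eta ^+ 2)^-1) x).
  exact: cst_continuous.
apply: (@continuousV R R (fun x => x ^+ 2 + eta ^+ 2) x).
  by rewrite gt_eqF// poisson_den_gt0.
apply: (@continuousD R R R (fun x => x ^+ 2) (cst (eta ^+ 2)) x).
  exact: exprn_continuous.
exact: cst_continuous.
Qed.

Lemma measurable_poisson eta : 0 < eta -> measurable_fun [set: R] (poisson eta).
Proof. by move=> e0; apply: continuous_measurable_fun; exact: poisson_continuous. Qed.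

Lemma poisson_half_lty eta : 0 < eta ->
  (\int[leb]_(x in `]0%R, +oo[) (poisson eta x)%:E < +oo)%E.
Proof.
move=> e0; apply: (@inv_invariant_lty _ (eta ^+ 2) eta^-1).
- by rewrite exprn_gt0.
- by move=> x _; exact: poisson_continuous.
- move=> x _; rewrite ltW ?poisson_gt0//= /poisson ler_pdivrMr ?poisson_den_gt0//.
  rewrite mulrDr (_ : eta^-1 * eta ^+ 2 = eta); last by rewrite expr2 mulKf// gt_eqF.
  by rewrite lerDr mulr_ge0 ?sqr_ge0// invr_ge0 ltW.
- move=> x x0; rewrite /poisson; field.
  by rewrite !gt_eqF ?poisson_den_gt0//= ?exprn_gt0//; nra.
Qed.

Lemma integrable_poisson eta : 0 < eta -> leb.-integrable setT (EFin \o poisson eta).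
Proof.
move=> e0; have mp := measurable_poisson e0.
have p0 x : (0 <= (poisson eta x)%:E)%E by rewrite lee_fin ltW// poisson_gt0.
apply/integrableP; split; first by apply/measurable_EFinP.
have -> : (\int[leb]_x `|(EFin \o poisson eta) x| = \int[leb]_x (poisson eta x)%:E)%E.
  by apply: eq_integral => x _; rewrite gee0_abs//; exact: p0.
have -> : [set: R] = (`]-oo, 0] `|` `]0, +oo[)%classic :> set R.
  by apply/esym; rewrite -subTset => x _ /=; rewrite !in_itv/= andbT; have [?|?] := leP x 0; [left|right].
rewrite ge0_integral_setU//=; last 2 first.
- by apply/measurable_EFinP; exact: measurable_funTS.
- by apply/disj_setPS => x /= []; rewrite !in_itv/= andbT => /le_lt_trans /[apply]; rewrite ltxx.
apply: lte_add_pinfty; last exact: poisson_half_lty.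
have mopp : measurable_fun [set: R] (fun t => 0 - t).
  by apply: measurable_funB; [exact: measurable_cst|exact: measurable_id].
rewrite (ge0_integral_preserving mopp (lebesgue_measure_reflect 0)) //; last first.
  by apply/measurable_EFinP; exact: measurable_funTS.
rewrite (_ : _ @^-1` _ = `[0, +oo[%classic); last first.
  by apply/seteqP; split => x; rewrite /preimage/= !in_itv/= andbT sub0r oppr_le0.
rewrite -integral_itv_obnd_cbnd; last first.
  apply/measurable_EFinP; apply: measurable_funTS.
  exact: measurableT_comp mp mopp.
under eq_integral => x _ do rewrite sub0r poissonN.
exact: poisson_half_lty.
Qed.

Lemma integral_preserving (f : R -> R) (D : set R) (G : R -> \bar R) :
  measurable_fun setT f -> (forall A, measurable A -> leb (f @^-1` A) = leb A) ->
  measurable D -> measurable_fun setT G -> leb.-integrable (f @^-1` D) (G \o f) ->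
  (\int[leb]_(x in D) G x = \int[leb]_(t in f @^-1` D) G (f t))%E.
Proof.
move=> mf lf mD mG iG.
have mf' : @measurable_fun _ _ (measurableTypeR R) (measurableTypeR R) setT f := mf.
transitivity (\int[pushforward leb (f : measurableTypeR R -> measurableTypeR R)]_(x in D) G x)%E.
  by apply: eq_measure_integral => A mA _; apply/esym; exact: lf.
exact: integral_pushforward.
Qed.

End poisson.

(** * The twin density for gam > 1 *)

Section twin_density.
Context (R : realType).
Local Notation leb := (@lebesgue_measure R).
Variable gam : R.
Hypothesis gam1 : 1 < gam.

Let eta := Num.sqrt (gam - 1).

Let eta0 : 0 < eta. Proof. by rewrite sqrtr_gt0 subr_gt0. Qed.

Let eta2 : eta ^+ 2 = gam - 1. Proof. by rewrite sqr_sqrtr// subr_ge0 ltW. Qed.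

(* The harmonic measure difference of the points [-1 + i eta] and [1 + i eta] of the upper
   half-plane, which differ by 2 and whose images under [z |-> - gam / z] differ by 2 as well. *)
Definition twin_density (x : R) : R :=
  poisson (Num.sqrt (gam - 1)) (x - 1) - poisson (Num.sqrt (gam - 1)) (x + 1).

(** The map x |-> gam / x is the boundary trace of the reflection in the circle of radius sqrt gam
    about 0. Both points have squared modulus 1 + eta^2 = gam, so the reflection fixes them and
    preserves each Poisson kernel; this dictates the choice of eta. *)
Lemma twin_density_inv x : 0 < x ->
  twin_density (gam / x) * (gam / x ^+ 2) = twin_density x.
Proof.
move=> x0; rewrite /twin_density /poisson -/eta eta2; field.
have h1 : 0 < (x - 1) ^+ 2 + (gam - 1) by rewrite ltr_wpDl ?sqr_ge0 ?subr_gt0.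
have h2 : 0 < (x + 1) ^+ 2 + (gam - 1) by rewrite ltr_wpDl ?sqr_ge0 ?subr_gt0.
have h3 : 0 < (gam + x) ^+ 2 + (gam - 1) * x ^+ 2.
  by rewrite ltr_wpDl ?sqr_ge0// mulr_gt0 ?subr_gt0// exprn_gt0.
have h4 : 0 < (gam + -1 * x) ^+ 2 + (gam - 1) * x ^+ 2.
  by rewrite ltr_wpDl ?sqr_ge0// mulr_gt0 ?subr_gt0// exprn_gt0.
by rewrite !lt0r_neq0.
Qed.

(** A positive number is closer to 1 than to -1. *)
Lemma twin_density_gt0 x : 0 < x -> 0 < twin_density x.
Proof.
move=> x0; rewrite subr_gt0 ltr_pM2l// ltf_pV2 ?posrE ?poisson_den_gt0// ltrD2r.
nra.
Qed.

Lemma twin_density_continuous : continuous twin_density.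
Proof.
have cp (a : R) : continuous (fun x => poisson eta (x + a)).
  move=> x; apply: (@continuous_comp R R R (fun x => x + a) (poisson eta) x).
    by apply: (@continuousD R R R id (cst a) x); [exact: cvg_id|exact: cvg_cst].
  exact: poisson_continuous.
by move=> x; apply: (@continuousB R R R (fun x => poisson eta (x - 1)) (fun x => poisson eta (x + 1)) x);
  exact: cp.
Qed.

(** Only the positive half of the odd density is kept, as a genuine measure; the odd extension is
    recovered later by giving the two branches of the hyperbola opposite masses. *)
Definition half_twin : R -> \bar R := (EFin \o twin_density) \_ `](0 : R), +oo[.

Lemma measurable_half_twin : measurable_fun [set: R] half_twin.
Proof. by apply: continuous_pos_measurable => x _; exact: twin_density_continuous. Qed.

Lemma half_twin_ge0 x : (0 <= half_twin x)%E.
Proof.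
by apply: restrict_pos_ge0 => y; rewrite in_itv/= andbT => y0; rewrite ltW// twin_density_gt0.
Qed.

Let measurable_shifted (a : R) : measurable_fun [set: R] (fun x => poisson eta (x + a)).
Proof.
have ms : measurable_fun [set: R] (fun x => x + a).
  by apply: measurable_funD; [exact: measurable_id|exact: measurable_cst].
exact: measurableT_comp (measurable_poisson eta0) ms.
Qed.

Let integrable_shifted (a : R) : leb.-integrable setT (fun x => (poisson eta (x + a))%:E).
Proof.
apply/integrableP; split; first by apply/measurable_EFinP; exact: measurable_shifted.
have p0 x : (0 <= (poisson eta x)%:E)%E by rewrite lee_fin ltW// poisson_gt0.
have -> : (\int[leb]_x `|(poisson eta (x + a))%:E| = \int[leb]_x (poisson eta (x + a))%:E)%E.
  by apply: eq_integral => x _; rewrite gee0_abs//; exact: p0.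
have ms : measurable_fun [set: R] (fun x => - a + x).
  by apply: measurable_funD; [exact: measurable_cst|exact: measurable_id].
rewrite (ge0_integral_preserving ms (lebesgue_measure_shift _))//; last first.
  by apply/measurable_EFinP; exact: measurable_shifted.
rewrite preimage_setT.
have /integrableP[_ h] := integrable_poisson eta0.
apply: le_lt_trans h; rewrite le_eqVlt; apply/orP; left; apply/eqP/eq_integral => x _.
by rewrite addrAC addNr add0r gee0_abs//; exact: p0.
Qed.

Lemma integrable_half_twin : leb.-integrable setT half_twin.
Proof.
apply: (le_integrable _ _ _ (integrable_shifted (-1))) => //; first exact: measurable_half_twin.
move=> x _.
have p0 : (0 <= (poisson eta (x + -1))%:E)%E by rewrite lee_fin ltW// poisson_gt0.
rewrite (gee0_abs (half_twin_ge0 x)) (gee0_abs p0) /half_twin /patch.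
case: ifPn => _; last by rewrite lee_fin ltW// poisson_gt0.
by rewrite lee_fin /twin_density lerBlDr lerDl ltW// poisson_gt0.
Qed.

Lemma half_twin_lty : (\int[leb]_x half_twin x < +oo)%E.
Proof.
have /integrableP[_] := integrable_half_twin.
by under eq_integral => x _ do rewrite gee0_abs ?half_twin_ge0//.
Qed.

Lemma integral_restrict_pos (f : R -> R) :
  (\int[leb]_x ((f x)%:E * half_twin x) =
   \int[leb]_(x in `]0%R, +oo[) (f x * twin_density x)%:E)%E.
Proof.
rewrite [RHS]integral_mkcond; apply: eq_integral => x _.
by rewrite /half_twin /patch; case: ifPn => // _; rewrite mule0.
Qed.

(** As sine is odd, the integral equals that of [h] over the whole line: the half-line x <= 0
    contributes the term with [poisson eta (x + 1)]. Since [h] is antisymmetric about the point 1,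
    its integral vanishes. *)
Lemma integral_sin_twin_density (k : int) :
  (\int[leb]_(x in `]0%R, +oo[) (sin (pi * (x * k%:~R)) * twin_density x)%:E = 0)%E.
Proof.
pose s x : R := sin (pi * (x * k%:~R)).
have sN x : s (- x) = - s x by rewrite /s mulNr mulrN sinN.
pose h x := s x * poisson eta (x - 1).
have ms : measurable_fun [set: R] s.
  have mw : measurable_fun [set: R] (fun x : R => pi * (x * k%:~R)).
    apply: measurable_funM; first exact: measurable_cst.
    by apply: measurable_funM; [exact: measurable_id|exact: measurable_cst].
  by have [] := sin_bounded_measurable mw.
have mh : measurable_fun [set: R] h := measurable_funM ms (measurable_shifted (-1)).
have ih : leb.-integrable setT (EFin \o h).
  apply: (le_integrable _ _ _ (integrable_shifted (-1))) => //.
    by apply/measurable_EFinP.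
  move=> x _ /=; rewrite lee_fin normrM ler_piMl//.
  by rewrite ler_norml sin_geN1 sin_le1.
have reflect (a : R) : measurable_fun [set: R] (fun t => a - t).
  by apply: measurable_funB; [exact: measurable_cst|exact: measurable_id].
have mhr a : measurable_fun [set: R] (fun t => h (a - t)) := measurableT_comp mh (reflect a).
have ihr a : leb.-integrable setT (fun t => (h (a - t))%:E).
  apply: (le_integrable _ _ _ (integrable_shifted (1 - a))) => //.
    by apply/measurable_EFinP; exact: mhr.
  move=> x _ /=; rewrite lee_fin /h (_ : a - x - 1 = - (x + (1 - a))); last by ring.
  by rewrite poissonN normrM ler_piMl// ler_norml sin_geN1 sin_le1.
have int_reflect (a : R) (D : set R) : measurable D ->
    (\int[leb]_(x in D) (h x)%:E = \int[leb]_(t in (fun t => (a - t)%R) @^-1` D) (h (a - t))%:E)%E.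
  move=> mD; apply: (integral_preserving (reflect a) (lebesgue_measure_reflect a)) => //.
    by apply/measurable_EFinP.
  apply: integrableS (ihr a) => //.
  by have := reflect a measurableT _ mD; rewrite setTI.
have s2 x : s (2 - x) = - s x.
  have c1 : cos (pi * (k%:~R * 2)) = 1 :> R by rewrite -[pi * _]add0r cosD2piz cos0.
  have s1 : sin (pi * (k%:~R * 2)) = 0 :> R.
    by apply/eqP; rewrite -sqrf_eq0 sin2cos2 c1 expr1n subrr.
  rewrite /s (_ : pi * _ = pi * (k%:~R * 2) - pi * (x * k%:~R)); last by ring.
  by rewrite sinB c1 s1; ring.
have h2 x : h (2 - x) = - h x.
  by rewrite /h s2 mulNr -(poissonN eta (x - 1)); congr (- (_ * poisson eta _)); ring.
have fh : (\int[leb]_x (h x)%:E)%E \is a fin_num by exact: integrable_fin_num.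
have h0 : (\int[leb]_x (h x)%:E = 0)%E.
  have : (\int[leb]_x (h x)%:E = - \int[leb]_x (h x)%:E)%E.
    rewrite {1}(int_reflect 2 setT)// preimage_setT -integralN; last first.
      exact: integrable_add_def ih.
    by apply: eq_integral => x _; rewrite h2.
  rewrite -(fineK fh) -EFinN => -[] hh; congr EFin; lra.
have mI : measurable (`]0, +oo[ : set R) := measurable_itv _.
have mJ : measurable (`]-oo, 0] : set R) := measurable_itv _.
have TE : [set: R] = (`]-oo, 0] `|` `]0, +oo[)%classic.
  by apply/esym; rewrite -subTset => x _ /=; rewrite !in_itv/= andbT; have [?|?] := leP x 0; [left|right].
rewrite -h0 TE integral_setU//=; last 2 first.
- by rewrite -TE; apply/measurable_EFinP.
- by apply/disj_setPS => x /= []; rewrite !in_itv/= andbT => /le_lt_trans /[apply]; rewrite ltxx.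
rewrite (int_reflect 0 _ mJ) (_ : _ @^-1` _ = `[0, +oo[%classic); last first.
  by apply/seteqP; split => x; rewrite /preimage/= !in_itv/= andbT sub0r oppr_le0.
rewrite -integral_itv_obnd_cbnd; last first.
  by apply/measurable_EFinP; apply: measurable_funTS; exact: mhr.
rewrite -integralD//=; last 2 first.
- exact: integrableS (ihr 0).
- exact: integrableS ih.
apply: eq_integral => x _; rewrite -EFinD; congr EFin.
rewrite sub0r /h sN (_ : - x - 1 = - (x + 1)); last by ring.
by rewrite poissonN /twin_density -/eta -/(s x); ring.
Qed.

End twin_density.

(** * Sets of arc length zero for an arbitrary parametrization *)

Section positive_integral.
Context (R : realType).
Local Notation leb := (@lebesgue_measure R).

Lemma gt0_integral_eq0 (D : set R) (f : R -> R) : measurable D -> measurable_fun D f ->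
  (forall x, D x -> 0 < f x) -> (\int[leb]_(x in D) (f x)%:E = 0)%E ->
  leb.-negligible D.
Proof.
move=> mD mf f0 int0.
have mfE : measurable_fun D (EFin \o f) by apply/measurable_EFinP.
have : ae_eq leb D (EFin \o f) (cst 0%E).
  apply/(ae_eq_integral_abs leb mD mfE); rewrite -int0.
  by apply: eq_integral => x; rewrite inE => /f0 fx; rewrite gee0_abs// lee_fin ltW.
apply: negligibleS => x Dx /= /(_ Dx) [] fx.
by have := f0 _ Dx; rewrite fx ltxx.
Qed.

End positive_integral.

Section arc_length_null.
Context (R : realType).
Local Notation leb := (@lebesgue_measure R).
Local Notation plane := (R * R)%type.

(** The definition of a uniqueness pair only says that some parametrization exists, so the
    counterexample has to face any of them. Positive speed makes the parameter set null, and the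
    first coordinate, being continuously differentiable, maps null sets to null sets. *)
Lemma arc_length_null_projection (Gamma : set plane) (n : nat) (I : 'I_n -> interval R)
    (g : 'I_n -> R -> plane) (A : set plane) :
  parametrizes Gamma I g -> measurable A -> arc_length I g A = 0%E ->
  leb.-negligible (fst @` (A `&` Gamma)).
Proof.
move=> [_ smooth _ ->] mA; rewrite /arc_length => arc0.
have int0 i : (\int[leb]_(t in [set` I i] `&` g i @^-1` A) (speed (g i) t)%:E = 0)%E.
  have : (\sum_(i < n) \int[leb]_(t in [set` I i] `&` g i @^-1` A) (speed (g i) t)%:E == 0)%E.
    exact/eqP.
  rewrite seq_psume_eq0; last first.
    by move=> k _; apply: integral_ge0 => t _; rewrite lee_fin sqrtr_ge0.
  by move=> /allP /(_ i); rewrite mem_index_enum => /(_ isT) /eqP.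
have nul i : leb.-negligible (coord1 (g i) @` ([set` I i] `&` g i @^-1` A)).
  have [_ [U [oU IU s1 s2]] sp0 _] := smooth i.
  have mI : measurable [set` I i] by exact: measurable_itv.
  have mU : measurable U by exact: open_measurable.
  (* Nothing is known about [g i] outside [U]; extension by 0 gives coordinates measurable on the
     whole line and unchanged on the parameter interval. *)
  have contU (f : R -> R) : smooth_on U f -> measurable_fun [set: R] (f \_ U).
    move=> sf; have mfU : measurable_fun U f.
      apply: open_continuous_measurable_fun => // t; rewrite inE => Ut.
      by apply: differentiable_continuous; apply/derivable1_diffP; exact: smooth_on_derivable sf Ut.
    by have := (measurable_restrictT f mU).1 mfU.
  have mg' := measurable_fun_pair (contU _ s1) (contU _ s2).
  have mN : measurable ([set` I i] `&` g i @^-1` A).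
    rewrite (_ : _ `&` _ = [set` I i] `&`
      (fun t => ((coord1 (g i) \_ U) t, (coord2 (g i) \_ U) t)) @^-1` A).
      by apply: measurableI => //; have := mg' measurableT _ mA; rewrite setTI.
    apply/seteqP; split => t [/= It]; rewrite /patch mem_set; [|exact: IU| |exact: IU];
      by rewrite /coord1 /coord2 -surjective_pairing.
  apply: (C1_negligible oU) => //.
  - by move=> t [/IU].
  - by move=> t Ut; exact: smooth_on_derivable s1 Ut.
  - by move=> t Ut; exact: smooth_on_derive1_continuous s1 Ut.
  apply: gt0_integral_eq0 (int0 i) => //.
    by apply: measurable_funS (measurable_speed oU s1 s2) => // t [/IU].
  by move=> t [It _]; rewrite lt_neqAle eq_sym sp0// sqrtr_ge0.
pose F k : set R := if insub k is Some i
  then coord1 (g i) @` ([set` I i] `&` g i @^-1` A) else set0.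
have sub : fst @` (A `&` \bigcup_i curve_image (I i) (g i)) `<=` \bigcup_k F k.
  move=> _ [x [Ax [i _ [t It gt]]] <-]; exists (val i) => //.
  rewrite /F valK; exists t; last by rewrite /coord1 gt.
  by split => //=; rewrite gt.
apply: (negligibleS (mu := leb) sub); apply: negligible_bigcup => k.
by rewrite /F; case: insub => [i|]; [exact: nul|exact: negligible_set0].
Qed.

End arc_length_null.

(** * Charges that are differences of two image measures *)

Section charge_difference.
Context d d' (T : measurableType d) (T' : measurableType d') (R : realType).
Variables (m : {finite_measure set T -> \bar R}) (e e' : T -> T').
Hypotheses (me : measurable_fun setT e) (me' : measurable_fun setT e').

Lemma charge_difference : exists nu : {charge set T' -> \bar R},
  forall A, nu A = (m (e @^-1` A) - m (e' @^-1` A))%E.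
Proof.
pose n1 : {charge set T' -> \bar R} :=
  measure_function_pushforward__canonical__charge_Charge (charge_of_finite_measure m) me.
pose n2 : {charge set T' -> \bar R} :=
  measure_function_pushforward__canonical__charge_Charge (charge_of_finite_measure m) me'.
by exists (cadd n1 (copp n2)).
Qed.

(** The Hahn decomposition behind [charge_integral] is an arbitrary choice, so the Jordan parts need
    not be the two image measures. Crosswise sums of positive measures do agree, and the integral is
    additive in the measure. *)
Lemma charge_integral_difference (nu : {charge set T' -> \bar R}) (f : T' -> R) :
  (forall A, measurable A -> nu A = (m (e @^-1` A) - m (e' @^-1` A))%E) ->
  bounded_measurable f ->
  charge_integral nu f = \int[m]_x f (e x) - \int[m]_x f (e' x).
Proof.
move=> nuE bf; rewrite /charge_integral; set h := proj2_sig _.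
have mf : measurable_fun setT f by case: bf.
have bcomp (u : T -> T') : measurable_fun setT u -> bounded_measurable (f \o u).
  move=> mu; split; first exact: measurableT_comp.
  by case: bf => _ [M fM]; exists M => x; exact: fM.
pose mp : {measure set T' -> \bar R} :=
  measure_function_pushforward__canonical__measure_function_Measure m me.
pose mn : {measure set T' -> \bar R} :=
  measure_function_pushforward__canonical__measure_function_Measure m me'.
have ijp : (jordan_pos h).-integrable setT (EFin \o f) by exact: bounded_measurable_integrable.
have ijn : (jordan_neg h).-integrable setT (EFin \o f) by exact: bounded_measurable_integrable.
have ip : mp.-integrable setT (EFin \o f).
  apply: (integrable_pushforward me); rewrite ?preimage_setT//; first exact/measurable_EFinP.
  exact: bounded_measurable_integrable (bcomp e me).
have ineg : mn.-integrable setT (EFin \o f).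
  apply: (integrable_pushforward me'); rewrite ?preimage_setT//; first exact/measurable_EFinP.
  exact: bounded_measurable_integrable (bcomp e' me').
have key : (\int[jordan_pos h]_x (f x)%:E + \int[mn]_x (f x)%:E =
    \int[mp]_x (f x)%:E + \int[jordan_neg h]_x (f x)%:E)%E.
  transitivity (\int[measure_add (jordan_pos h) mn]_x (f x)%:E)%E.
    by rewrite (integral_measure_add measurableT ijp ineg).
  transitivity (\int[measure_add mp (jordan_neg h)]_x (f x)%:E)%E; last first.
    by rewrite (integral_measure_add measurableT ip ijn).
  apply: eq_measure_integral => A mA _; rewrite /= /msum !big_ord_recr !big_ord0 /= !add0e.
  have fe : m (e @^-1` A) \is a fin_num.
    by apply: fin_num_measure; have := me measurableT mA; rewrite setTI.
  have fe' : m (e' @^-1` A) \is a fin_num.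
    by apply: fin_num_measure; have := me' measurableT mA; rewrite setTI.
  have fp : jordan_pos h A \is a fin_num by exact: fin_num_measure.
  have fn : jordan_neg h A \is a fin_num by exact: fin_num_measure.
  have := nuE A mA; rewrite (jordan_decomp h mA) /cadd/= cscaleN1.
  change (jordan_pos h A - jordan_neg h A = m (e @^-1` A) - m (e' @^-1` A) ->
    jordan_pos h A + m (e' @^-1` A) = m (e @^-1` A) + jordan_neg h A)%E.
  rewrite -(fineK fe) -(fineK fe') -(fineK fp) -(fineK fn) -!EFinB => -[] h1.
  by rewrite -!EFinD; congr EFin; lra.
have pe : (\int[mp]_x (f x)%:E = \int[m]_x (f (e x))%:E)%E.
  rewrite [LHS](integral_pushforward me) ?preimage_setT//; first exact/measurable_EFinP.
  exact: bounded_measurable_integrable (bcomp e me).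
have ne : (\int[mn]_x (f x)%:E = \int[m]_x (f (e' x))%:E)%E.
  rewrite [LHS](integral_pushforward me') ?preimage_setT//; first exact/measurable_EFinP.
  exact: bounded_measurable_integrable (bcomp e' me').
have F1 : (\int[jordan_pos h]_x (f x)%:E)%E \is a fin_num by exact: integrable_fin_num.
have F2 : (\int[jordan_neg h]_x (f x)%:E)%E \is a fin_num by exact: integrable_fin_num.
have F3 : (\int[m]_x (f (e x))%:E)%E \is a fin_num.
  by apply: integrable_fin_num => //; exact: bounded_measurable_integrable (bcomp e me).
have F4 : (\int[m]_x (f (e' x))%:E)%E \is a fin_num.
  by apply: integrable_fin_num => //; exact: bounded_measurable_integrable (bcomp e' me').
move: key; rewrite pe ne /Rintegral -(fineK F1) -(fineK F2) -(fineK F3) -(fineK F4).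
by rewrite -!EFinD => -[]; lra.
Qed.

End charge_difference.

Lemma Rintegral_invariant d (T : measurableType d) (R : realType)
    (m : {finite_measure set T -> \bar R}) (e : T -> T) (f : T -> R) :
  measurable_fun setT e -> (forall A, measurable A -> m (e @^-1` A) = m A) ->
  bounded_measurable f -> \int[m]_x f (e x) = \int[m]_x f x.
Proof.
move=> me em [mf [M fM]]; rewrite /Rintegral; congr fine.
pose mp : {measure set T -> \bar R} :=
  measure_function_pushforward__canonical__measure_function_Measure m me.
transitivity (\int[mp]_x (f x)%:E)%E.
  rewrite [RHS](integral_pushforward me) ?preimage_setT//; first exact/measurable_EFinP.
  apply: bounded_measurable_integrable; split; first exact: measurableT_comp.
  by exists M => x; exact: fM.
by apply: eq_measure_integral => A mA _; exact: em.
Qed.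

(** * The measure with the twin density and its sine moments *)

Section twin_measure.
Context (R : realType).
Local Notation leb := (@lebesgue_measure R).
Variable gam : R.
Hypothesis gam1 : 1 < gam.
Variable m : {finite_measure set (measurableTypeR R) -> \bar R}.
Hypothesis mE : forall A, m A = (\int[leb]_(x in A) half_twin gam x)%E.

Let gam0 : 0 < gam. Proof. exact: lt_trans gam1. Qed.

Lemma twin_measureE (A : set R) :
  m A = (\int[leb]_(x in [set x | (0 < x)%R /\ A x]) (twin_density gam x)%:E)%E.
Proof.
rewrite mE [LHS]integral_mkcond [RHS]integral_mkcond; apply: eq_integral => x _.
rewrite /half_twin /patch; case: (pselect (A x)) => Ax; last first.
  by rewrite !memNset// => -[].
rewrite mem_set//; case: (ltP 0 x) => x0.
  by rewrite !mem_set//= in_itv/= x0.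
rewrite [in LHS]memNset ?[in RHS]memNset//= ?in_itv/= ?andbT; last by rewrite ltNge x0.
by rewrite ltNge x0 => -[].
Qed.

Lemma twin_measure_inv (A : set R) : measurable A -> m ((fun x => gam / x) @^-1` A) = m A.
Proof.
move=> mA; rewrite !twin_measureE.
rewrite (@inv_substitution R (twin_density gam) gam A)//.
- by apply: eq_integral => x; rewrite inE => -[x0 _]; rewrite twin_density_inv.
- by move=> x _; exact: twin_density_continuous.
- by move=> x; rewrite in_itv/= andbT => x0; rewrite ltW// twin_density_gt0.
Qed.

Lemma twin_measure_null (A : set R) : measurable A ->
  leb.-negligible [set x | 0 < x /\ A x] -> m A = 0%E.
Proof.
move=> mA nA.
have mA' : measurable [set x : R | 0 < x /\ A x].
  rewrite (_ : [set _ | _] = `]0, +oo[%classic `&` A).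
    by apply: measurableI => //; exact: measurable_itv.
  by apply/seteqP; split => x /=; rewrite in_itv/= andbT.
rewrite twin_measureE; apply: null_set_integral => //.
  apply: measurable_funTS; apply/measurable_EFinP; apply: continuous_measurable_fun.
  exact: twin_density_continuous.
exact: (negligibleP leb mA').1.
Qed.

Lemma twin_measure_neq0 : m `]0, +oo[%classic <> 0%E.
Proof.
rewrite mE => m0.
have mI : measurable (`]0, +oo[ : set R) := measurable_itv _.
have /(negligibleP leb mI).1 : leb.-negligible (`]0, +oo[ : set R).
  apply: (gt0_integral_eq0 mI (f := twin_density gam)).
  - apply: measurable_funTS; apply: continuous_measurable_fun.
    exact: twin_density_continuous.
  - by move=> x; rewrite /= in_itv/= andbT => x0; exact: twin_density_gt0.
  - rewrite -m0; apply: eq_integral => x xI.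
    by rewrite /half_twin /patch xI.
by have := lebesgue_measure_itv `](0 : R), +oo[; rewrite /= ltry => ->.
Qed.

Lemma twin_measure_sin (k : int) : \int[m]_x sin (pi * (x * k%:~R)) = 0.
Proof.
have bs : bounded_measurable (fun x : measurableTypeR R => sin (pi * (x * k%:~R))).
  apply: sin_bounded_measurable; apply: measurable_funM; first exact: measurable_cst.
  by apply: measurable_funM; [exact: measurable_id|exact: measurable_cst].
rewrite /Rintegral (integral_finite_density (integrable_half_twin gam1)).
- by rewrite integral_restrict_pos integral_sin_twin_density.
- by move=> A _; exact: mE.
- exact: bounded_measurable_integrable bs.
Qed.

Lemma twin_measure_sin_inv (k : int) : \int[m]_x sin (pi * (gam / x * k%:~R)) = 0.
Proof.
have mg : measurable_fun [set: measurableTypeR R] (fun x : measurableTypeR R => gam / x).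
  by apply: measurable_funM; [exact: measurable_cst|exact: measurable_inv].
pose s (x : measurableTypeR R) := sin (pi * (x * k%:~R)).
have bs : bounded_measurable s.
  apply: sin_bounded_measurable; apply: measurable_funM; first exact: measurable_cst.
  by apply: measurable_funM; [exact: measurable_id|exact: measurable_cst].
rewrite -(twin_measure_sin k).
exact: (Rintegral_invariant mg twin_measure_inv bs).
Qed.

End twin_measure.

Lemma twin_measure_exists (R : realType) (gam : R) : 1 < gam ->
  exists m : {finite_measure set (measurableTypeR R) -> \bar R},
    forall A, m A = (\int[@lebesgue_measure R]_(x in A) half_twin gam x)%E.
Proof.
move=> gam1; apply: finite_density_measure.
- exact: measurable_half_twin.
- exact: half_twin_ge0.
- exact: half_twin_lty.
Qed.

(** * The counterexample for gam > 1 *)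

Section sharpness.
Context (R : realType).
Local Notation leb := (@lebesgue_measure R).
Local Notation plane := (R * R)%type.

Lemma closed_hyperbola : closed (hyperbola R).
Proof.
have c : continuous (fun x : plane => x.1 * x.2).
  by move=> x; apply: cvgM; [exact: cvg_fst|exact: cvg_snd].
have -> : hyperbola R = (fun x : plane => x.1 * x.2) @^-1` [set 1] by [].
by apply: closed_comp => [x _|]; [exact: c|exact: closed_eq].
Qed.

(** The charge is the image of [m] on the branch with positive coordinates minus its mirror image
    under x |-> -x. Oddness cancels the cosines, and the sine integrals on the two axes are
    [twin_measure_sin] and [twin_measure_sin_inv]. *)
Lemma lattice_cross_nonuniqueness (alpha beta : R) : 0 < alpha -> 0 < beta ->
  1 < alpha * beta -> ~ heisenberg_uniqueness_pair (hyperbola R) (lattice_cross alpha beta).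
Proof.
move=> a0 b0 ab1 [n [I [g [pG uniq]]]].
have [m mE] := twin_measure_exists ab1.
(* Scaled so that on the branch s = 1 the parameter x is alpha x1, and beta x2 is then gam / x. *)
pose e (s : R) (x : measurableTypeR R) : plane := (s * (alpha^-1 * x), s * (alpha / x)).
have me s : measurable_fun setT (e s).
  apply: measurable_fun_pair.
    by do 2![apply: measurable_funM; first exact: measurable_cst]; exact: measurable_id.
  by do 2![apply: measurable_funM; first exact: measurable_cst]; exact: measurable_inv.
have m0 (A : set R) : measurable A -> leb.-negligible [set x | 0 < x /\ A x] -> m A = 0%E.
  exact: (twin_measure_null ab1 mE).
have mpre s A : measurable A -> measurable (e s @^-1` A).
  by move=> mA; have := me s measurableT _ mA; rewrite setTI.
have [nu nuE] := charge_difference m (me 1) (me (-1)).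
have nuI := charge_integral_difference (me 1) (me (-1)) (fun A _ => nuE A).
pose zero : {charge set plane -> \bar R} := czero.
(* The zero charge is seen as the difference of an image measure with itself, which avoids any look
   at its Hahn decomposition. *)
have zeroI f : bounded_measurable f -> charge_integral zero f = 0.
  move=> bf; rewrite (charge_integral_difference (m := m) (me 1) (me 1) _ bf) ?subrr// => A mA.
  by rewrite subee// fin_num_measure//; exact: mpre.
pose mu := ComplexMeasure nu zero.
have mu0 A : measurable A -> m (e 1 @^-1` A) = 0%E -> m (e (-1) @^-1` A) = 0%E ->
    measure_value mu A = 0.
  by move=> mA h1 h2; apply/measure_value_eq0 => //; rewrite /= nuE h1 h2 sube0.
have hyp s x : s ^+ 2 = 1 -> 0 < x -> hyperbola R (e s x).
  move=> s2 x0; rewrite /hyperbola/= (_ : _ * _ = s ^+ 2)//.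
  by field; rewrite !gt_eqF.
have supp : Defs.support mu `<=` hyperbola R.
  move=> x suppx; apply: contrapT => xG; have [|A [mA AG]] := suppx (~` hyperbola R) _ xG.
    by rewrite openC; exact: closed_hyperbola.
  apply; apply: mu0 => //; apply: m0; try exact: mpre.
    rewrite (_ : [set _ | _] = set0); first exact: negligible_set0.
    by rewrite -subset0 => y [y0 /AG]; apply; apply: hyp; rewrite ?expr1n.
  rewrite (_ : [set _ | _] = set0); first exact: negligible_set0.
  by rewrite -subset0 => y [y0 /AG]; apply; apply: hyp; rewrite ?sqrrN ?expr1n.
have ac : absolutely_continuous mu (arc_length I g).
  move=> A mA arc0; have nA := arc_length_null_projection pG mA arc0.
  have neg s : s ^+ 2 = 1 -> m (e s @^-1` A) = 0%E.
    move=> s2; apply: m0; first exact: mpre.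
    have fix_s x : alpha * s * (e s x).1 = x.
      rewrite /e/= (_ : _ * _ = s ^+ 2 * x); first by rewrite s2 mul1r.
      by field; exact: lt0r_neq0.
    have sub : [set x | 0 < x /\ (e s @^-1` A) x] `<=`
        (fun t => alpha * s * t) @` (fst @` (A `&` hyperbola R)).
      move=> x [x0 Ax]; exists (e s x).1; last exact: fix_s.
      by exists (e s x) => //; split => //; exact: hyp.
    apply: (negligibleS (mu := leb) sub).
    apply: (lipschitz_negligible (L := `|alpha * s|)) nA => // x y _ _.
    by rewrite -mulrBr normrM.
  by apply: mu0 => //; apply: neg; rewrite ?sqrrN expr1n.
have four xi : lattice_cross alpha beta xi -> fourier mu xi = 0.
  move=> Lxi; pose w (x : plane) := pi * dot x xi.
  have mw : measurable_fun setT w.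
    apply: measurable_funM; first exact: measurable_cst.
    apply: measurable_funD; apply: measurable_funM; try exact: measurable_cst.
      exact: measurable_fst.
    exact: measurable_snd.
  have bc := cos_bounded_measurable mw; have bs := sin_bounded_measurable mw.
  have wN x : w (e (-1) x) = - w (e 1 x) by rewrite /w /dot/=; ring.
  have sin0 : \int[m]_x sin (w (e 1 x)) = 0.
    case: Lxi => -[k _ xiE].
      rewrite -[RHS](twin_measure_sin ab1 mE k); apply: eq_Rintegral => x _.
      by rewrite /w /dot -xiE/=; congr (sin (pi * _)); rewrite mulr0 addr0; field; exact: lt0r_neq0.
    rewrite -[RHS](twin_measure_sin_inv ab1 mE k); apply: eq_Rintegral => x _.
    by rewrite /w /dot -xiE/=; congr (sin (pi * _)); ring.
  rewrite /fourier /complex_integral /expi/= !zeroI// !nuI//.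
  have -> : \int[m]_x cos (w (e (-1) x)) = \int[m]_x cos (w (e 1 x)).
    by apply: eq_Rintegral => x _; rewrite wN cosN.
  have -> : \int[m]_x sin (w (e (-1) x)) = 0.
    have bse := sin_bounded_measurable (measurableT_comp mw (me 1)).
    transitivity (\int[m]_x (-1 * sin (w (e 1 x)))).
      by apply: eq_Rintegral => x _; rewrite wN sinN mulN1r.
    by rewrite RintegralZl// ?sin0 ?mulr0//; exact: bounded_measurable_integrable bse.
  by rewrite sin0 !subrr addr0.
(* The right half-plane separates the branches, so no cancellation occurs and the charge of this set
   is the whole positive mass of [m]. *)
pose A0 : set plane := [set x | 0 < x.1].
have mA0 : measurable A0.
  rewrite (_ : A0 = fst @^-1` `]0, +oo[%classic); last first.
    by apply/seteqP; split => x; rewrite /A0/= in_itv/= andbT.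
  by rewrite -[_ @^-1` _]setTI; apply: measurable_fst => //; exact: measurable_itv.
have /(measure_value_eq0 mu mA0)[/= + _] := uniq mu supp ac four A0 mA0.
have x1 s x : (A0 (e s x)) = (0 < s * (alpha^-1 * x)) by [].
rewrite nuE (m0 (e (-1) @^-1` A0)); last 2 first.
- exact: mpre.
- rewrite (_ : [set _ | _] = set0); first exact: negligible_set0.
  rewrite -subset0 => x [x0]; rewrite /preimage/= x1 mulN1r oppr_gt0 ltNge.
  by rewrite mulr_ge0 ?invr_ge0 ?ltW.
rewrite sube0 (_ : e 1 @^-1` A0 = `]0, +oo[%classic); first exact: (twin_measure_neq0 ab1 mE).
apply/seteqP; split => x; rewrite /preimage/= x1 in_itv/= andbT mul1r.
  by rewrite pmulr_rgt0 ?invr_gt0.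
by rewrite pmulr_rgt0 ?invr_gt0.
Qed.

End sharpness.

Theorem theorem1p2 (R : realType) (alpha beta : R)
    (alpha_gt0 : 0 < alpha) (beta_gt0 : 0 < beta) :
  heisenberg_uniqueness_pair (hyperbola R) (lattice_cross alpha beta)
  <-> alpha * beta <= 1.
Proof.
split; last exact: lattice_cross_uniqueness.
move=> uniq; rewrite leNgt; apply/negP => ab1.
exact: (lattice_cross_nonuniqueness alpha_gt0 beta_gt0 ab1 uniq).
Qed.
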